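(* Let $\Gamma$ be a group, $\theta:\Gamma\to\Gamma$ an injective group morphism and $k\ge 2$. There exists a unique monoidal category $\mathcal{C}$ whose objects are the positive integers, whose morphisms from $n$ to $m$ are the $k$-ary forests with $n$ roots and $m$ leaves together with a permutation of the leaves and a labelling of the leaves by elements of $\Gamma$ (composed and tensored according to the rules given in the context), and whose composition satisfies the relation $$Y_k\circ g=(\theta(g),e,\dots,e)\circ Y_k\qquad\text{for all } g\in\Gamma ,$$ where $Y_k$ is the unique $k$-ary tree with $k$ leaves. Moreover, if $\mathcal{G}_{\mathcal{C}}$ is the universal groupoid of $\mathcal{C}$ and $\Gamma$ is a discrete group with the Haagerup property, then $\mathcal{G}_{\mathcal{C}}$ has the Haagerup property.
   Context: Forests. A $k$-ary forest with $n$ roots is an ordered list of $n$ finite ordered rooted trees in which each vertex has either $0$ or $k$ (ordered) children; leaves are numbered from left to right. $\mathcal{F}_k(n,m)$ is the set of $k$-ary forests with $n$ roots and $m$ leaves. The tensor product of forests is horizontal concatenation. Rules for $\mathcal{C}$. The morphism sets are $\mathcal{C}(n,m)=\mathcal{F}_k(n,m)\times S_m\times\Gamma^m$, and a triple $(f,\sigma,g)$ is read as the composition $g\circ\sigma\circ f$, where $f\in\mathcal{F}_k(n,m)$ is identified with a morphism $n\to m$, and $\sigma\in S_m$, $g\in\Gamma^m$ with morphisms $m\to m$. Forests compose by stacking, i.e. for $q\in\mathcal{F}_k(n,m)$ and $f\in\mathcal{F}_k(m,l)$ the forest $f\circ q\in\mathcal{F}_k(n,l)$ is obtained by attaching the $i$-th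 root of $f$ to the $i$-th leaf of $q$ for each $1\le i\le m$; permutations compose as in $S_m$; elements of $\Gamma^m$ compose as in the group $\Gamma^m$. For $\tau\in S_n$ and a forest $p$ with $n$ roots, $p\circ\tau=S(p,\tau)\circ\tau(p)$, where the $i$-th tree of $\tau(p)$ is the $\tau(i)$-th tree of $p$, and $S(p,\tau)$ is the permutation obtained by replacing, in the diagram of $\tau$ (segments joining bottom point $i$ to top point $\tau(i)$), the $i$-th segment by $l_{\tau(i)}$ parallel segments, $l_j$ being the number of leaves of the $j$-th tree of $p$. For $\sigma\in S_n$, $\sigma\circ(g_1,\dots,g_n)=(g_{\sigma^{-1}(1)},\dots,g_{\sigma^{-1}(n)})\circ\sigma$. The monoidal structure is $n\otimes m=n+m$ on objects and horizontal concatenation (of forests, permutations and tuples of group elements) on morphisms. (A unit object $0$ with only the empty diagram as endomorphism may be adjoined.) Universal groupoid. $\mathcal{G}_{\mathcal{C}}$ is the groupoid with the same objects as $\mathcal{C}$ obtained by formally inverting all morphisms of $\mathcal{C}$ (localization of $\mathcal{C}$ at all its morphisms). Haagerup property. A discrete group has the Haagerup property if it admits a net of positive definite functions vanishing at infinity and converging pointwise to $1$. Let $\mathcal{G}$ be a small groupoid with countably many objects, identified with its set of morphisms. A representation $(\pi,\mathscr{L})$ of $\mathcal{G}$ is a Hilbert space $\mathscr{L}=\bigoplus_{a\in\mathrm{ob}(\mathcal{G})}\mathscr{L}_a$ with a map $\pi:\mathcal{G}\to B(\mathscr{L})$, compatible with composition, such that $\pi(g)$ is a partial isometry with domain (initial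 space) $\mathscr{L}_{\mathrm{source}(g)}$ and range $\mathscr{L}_{\mathrm{target}(g)}$. A coefficient of $\mathcal{G}$ is a map $\mathcal{G}\to\mathbf{C}$, $g\mapsto\langle\eta,\pi(g)\xi\rangle$, for a representation $(\pi,\mathscr{L})$ and some unit vectors $\xi,\eta\in\mathscr{L}$; it is called positive definite (a positive definite function on $\mathcal{G}$) if $\eta=\xi$. A function $\phi$ on $\mathcal{G}$ vanishes at infinity if $\{g\in\mathcal{G}:|\phi(g)|\ge\varepsilon\}$ is finite for each $\varepsilon>0$. $\mathcal{G}$ has the Haagerup property if there is a net of positive definite functions on $\mathcal{G}$ that converges pointwise to $1$ and vanish at infinity.
   Formalization: In the definition of positive definite functions on a groupoid, the vector ξ is not required to be a unit vector; with unit vectors no groupoid with two or more objects could have the Haagerup property, since the values at the identities sum to at most 1. *)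

(* Defs.v *)
From mathcomp Require Import all_boot all_order all_algebra all_fingroup.
From mathcomp Require Import sesquilinear.
From mathcomp Require Import boolp classical_sets functions cardinality reals.
From mathcomp Require Import topology normedtype.
From mathcomp Require Import complex.

Set Implicit Arguments.
Unset Strict Implicit.
Unset Printing Implicit Defensive.

Import Order.TTheory GRing.Theory Num.Theory.
Import numFieldNormedType.Exports.

Local Open Scope ring_scope.
Local Open Scope complex_scope.
Local Open Scope classical_set_scope.
Local Open Scope nat_scope.

Record category_on (ob : Type) (hom : ob -> ob -> Type) := CategoryOn {
  cid : forall a, hom a a;
  ccomp : forall a b c, hom b c -> hom a b -> hom a c;
  ccompA : forall a b c d (h : hom c d) (g : hom b c) (f : hom a b),
    ccomp h (ccomp g f) = ccomp (ccomp h g) f;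
  ccomp1f : forall a b (f : hom a b), ccomp (cid b) f = f;
  ccompf1 : forall a b (f : hom a b), ccomp f (cid a) = f
}.
Arguments cid {ob hom} c0 a : rename.
Arguments ccomp {ob hom} c0 {a b c} g f : rename.

Definition cast_hom (ob : Type) (hom : ob -> ob -> Type) (a a' b b' : ob)
    (ea : a = a') (eb : b = b') (f : hom a b) : hom a' b' :=
  eq_rect a (fun x => hom x b') (eq_rect b (hom a) f b' eb) a' ea.

(* Strict monoidal structures whose objects, morphism sets, tensor product of
   objects and unit object are prescribed.  The associativity and unit laws for
   objects being mere equalities, the corresponding laws for morphisms hold up
   to transport along them. *)
Record strict_monoidal_on (ob : Type) (hom : ob -> ob -> Type)
    (tob : ob -> ob -> ob) (unit_ob : ob) := StrictMonoidalOn {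
  smcat :> category_on hom;
  tens : forall a b c d, hom a b -> hom c d -> hom (tob a c) (tob b d);
  tobA : forall a b c, tob a (tob b c) = tob (tob a b) c;
  tob1x : forall a, tob unit_ob a = a;
  tobx1 : forall a, tob a unit_ob = a;
  tens_id : forall a b, tens (cid smcat a) (cid smcat b) = cid smcat (tob a b);
  tens_comp : forall a b c a' b' c' (g : hom b c) (f : hom a b)
      (g' : hom b' c') (f' : hom a' b'),
    tens (ccomp smcat g f) (ccomp smcat g' f')
    = ccomp smcat (tens g g') (tens f f');
  tensA : forall a b c a' b' c' (f : hom a a') (g : hom b b') (h : hom c c'),
    cast_hom (tobA a b c) (tobA a' b' c') (tens f (tens g h))
    = tens (tens f g) h;
  tens1f : forall a b (f : hom a b),
    cast_hom (tob1x a) (tob1x b) (tens (cid smcat unit_ob) f) = f;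
  tensf1 : forall a b (f : hom a b),
    cast_hom (tobx1 a) (tobx1 b) (tens f (cid smcat unit_ob)) = f
}.
Arguments tens {ob hom tob unit_ob} s {a b c d} f g : rename.

Record category := Category {
  ob : Type;
  hom : ob -> ob -> Type;
  cat_on :> category_on hom
}.

Definition full_subcategory (C : category) (P : ob C -> Prop) : category :=
  @Category {a : ob C | P a} (fun a b => hom (sval a) (sval b))
    (@CategoryOn _ (fun a b : {a : ob C | P a} => hom (sval a) (sval b))
       (fun a => cid C (sval a)) (fun a b c g f => ccomp C g f)
       (fun a b c d h g f => ccompA C h g f)
       (fun a b f => ccomp1f C f) (fun a b f => ccompf1 C f)).

Record groupoid := Groupoid {
  gcat :> category;
  ginv : forall a b : ob gcat, hom a b -> hom b a;
  gcompVf : forall (a b : ob gcat) (f : hom a b),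
    ccomp gcat (ginv f) f = cid gcat a;
  gcompfV : forall (a b : ob gcat) (f : hom a b),
    ccomp gcat f (ginv f) = cid gcat b
}.

Record is_functor (C D : category) (F0 : ob C -> ob D)
    (F : forall a b, hom a b -> hom (F0 a) (F0 b)) : Prop := IsFunctor {
  functor_id : forall a, F a a (cid C a) = cid D (F0 a);
  functor_comp : forall a b c (g : hom b c) (f : hom a b),
    F a c (ccomp C g f) = ccomp D (F b c g) (F a b f)
}.

Section UniversalGroupoid.
Variable C : category.

Inductive gterm : ob C -> ob C -> Type :=
| GId a : gterm a a
| GGen a b : hom a b -> gterm a b
| GInv a b : gterm a b -> gterm b a
| GComp a b c : gterm b c -> gterm a b -> gterm a c.

Inductive gterm_eq : forall a b, gterm a b -> gterm a b -> Prop :=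
| GRefl a b (t : gterm a b) : gterm_eq t t
| GSym a b (t u : gterm a b) : gterm_eq t u -> gterm_eq u t
| GTrans a b (t u v : gterm a b) :
    gterm_eq t u -> gterm_eq u v -> gterm_eq t v
| GCongInv a b (t u : gterm a b) : gterm_eq t u -> gterm_eq (GInv t) (GInv u)
| GCongComp a b c (t t' : gterm b c) (u u' : gterm a b) :
    gterm_eq t t' -> gterm_eq u u' -> gterm_eq (GComp t u) (GComp t' u')
| GCompA a b c d (t : gterm c d) (u : gterm b c) (v : gterm a b) :
    gterm_eq (GComp t (GComp u v)) (GComp (GComp t u) v)
| GComp1f a b (t : gterm a b) : gterm_eq (GComp (GId b) t) t
| GCompf1 a b (t : gterm a b) : gterm_eq (GComp t (GId a)) t
| GCompVf a b (t : gterm a b) : gterm_eq (GComp (GInv t) t) (GId a)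
| GCompfV a b (t : gterm a b) : gterm_eq (GComp t (GInv t)) (GId b)
| GGenId a : gterm_eq (GGen (cid C a)) (GId a)
| GGenComp a b c (g : hom b c) (f : hom a b) :
    gterm_eq (GGen (ccomp C g f)) (GComp (GGen g) (GGen f)).

(* Quotient of [gterm a b] by [gterm_eq], as the type of equivalence classes. *)
Definition ug_hom (a b : ob C) : Type :=
  {P : gterm a b -> Prop | exists t, P = gterm_eq t}.

Definition ug_class a b (t : gterm a b) : ug_hom a b :=
  exist _ (gterm_eq t) (ex_intro _ t erefl).

Definition ug_repr a b (x : ug_hom a b) : gterm a b :=
  sval (boolp.cid (svalP x)).

Lemma ug_reprK a b (x : ug_hom a b) : ug_class (ug_repr x) = x.
Proof.
rewrite /ug_repr; case: (boolp.cid _) => t; case: x => P exP /= eP.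
by apply: eq_exist.
Qed.

Lemma ug_classP a b (t u : gterm a b) : ug_class t = ug_class u <-> gterm_eq t u.
Proof.
split=> [[e]|tu]; first by rewrite e; exact: GRefl.
apply: eq_exist; apply/funext => v; apply/propext; split.
- by apply: GTrans; apply: GSym.
- exact: GTrans.
Qed.

Lemma ug_classK a b (t : gterm a b) : gterm_eq (ug_repr (ug_class t)) t.
Proof. by apply/ug_classP; rewrite ug_reprK. Qed.

Definition ug_id a : ug_hom a a := ug_class (GId a).
Definition ug_inv a b (x : ug_hom a b) : ug_hom b a := ug_class (GInv (ug_repr x)).
Definition ug_comp a b c (x : ug_hom b c) (y : ug_hom a b) : ug_hom a c :=
  ug_class (GComp (ug_repr x) (ug_repr y)).

Lemma ug_invE a b (t : gterm a b) : ug_inv (ug_class t) = ug_class (GInv t).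
Proof. by apply/ug_classP/GCongInv/ug_classK. Qed.

Lemma ug_compE a b c (t : gterm b c) (u : gterm a b) :
  ug_comp (ug_class t) (ug_class u) = ug_class (GComp t u).
Proof. by apply/ug_classP/GCongComp; apply/ug_classK. Qed.

Lemma ug_compA a b c d (x : ug_hom c d) (y : ug_hom b c) (z : ug_hom a b) :
  ug_comp x (ug_comp y z) = ug_comp (ug_comp x y) z.
Proof.
rewrite -(ug_reprK x) -(ug_reprK y) -(ug_reprK z) !ug_compE.
exact/ug_classP/GCompA.
Qed.

Lemma ug_comp1f a b (x : ug_hom a b) : ug_comp (ug_id b) x = x.
Proof. by rewrite -(ug_reprK x) ug_compE; exact/ug_classP/GComp1f. Qed.

Lemma ug_compf1 a b (x : ug_hom a b) : ug_comp x (ug_id a) = x.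
Proof. by rewrite -(ug_reprK x) ug_compE; exact/ug_classP/GCompf1. Qed.

Lemma ug_compVf a b (x : ug_hom a b) : ug_comp (ug_inv x) x = ug_id a.
Proof.
by rewrite -(ug_reprK x) ug_invE ug_compE; exact/ug_classP/GCompVf.
Qed.

Lemma ug_compfV a b (x : ug_hom a b) : ug_comp x (ug_inv x) = ug_id b.
Proof.
by rewrite -(ug_reprK x) ug_invE ug_compE; exact/ug_classP/GCompfV.
Qed.

Definition universal_groupoid : groupoid :=
  @Groupoid (@Category (ob C) ug_hom (CategoryOn ug_compA ug_comp1f ug_compf1))
    ug_inv ug_compVf ug_compfV.

Definition ug_gen (a b : ob C) (f : hom a b) : @hom universal_groupoid a b :=
  ug_class (GGen f).

Lemma ug_gen_functor : @is_functor C universal_groupoid id ug_gen.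
Proof.
split=> [a|a b c g f]; first exact/ug_classP/GGenId.
by rewrite /= ug_compE; apply/ug_classP/GGenComp.
Qed.

Fixpoint gterm_eval (H : groupoid) (F0 : ob C -> ob H)
    (F : forall a b, hom a b -> hom (F0 a) (F0 b)) a b (t : gterm a b) :
    hom (F0 a) (F0 b) :=
  match t in gterm a b return hom (F0 a) (F0 b) with
  | GId a => cid H (F0 a)
  | GGen a b f => F a b f
  | GInv a b t => ginv (gterm_eval F t)
  | GComp a b c t u => ccomp H (gterm_eval F t) (gterm_eval F u)
  end.

Lemma ginv_unique (H : groupoid) (a b : ob H) (f : hom a b) (g : hom b a) :
  ccomp H g f = cid H a -> g = ginv f.
Proof.
by move=> gf; rewrite -[LHS](ccompf1 H) -(gcompfV f) ccompA gf ccomp1f.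
Qed.

Lemma gterm_eval_eq (H : groupoid) (F0 : ob C -> ob H)
    (F : forall a b, hom a b -> hom (F0 a) (F0 b)) :
  is_functor F -> forall a b (t u : gterm a b), gterm_eq t u ->
  gterm_eval F t = gterm_eval F u.
Proof.
case=> F1 FM a b t u; elim=> //=.
- by move=> ? ? ? ? ? _ ->.
- by move=> ? ? ? ? _ ->.
- by move=> ? ? ? ? ? ? ? _ -> _ ->.
- by move=> *; rewrite ccompA.
- by move=> *; rewrite ccomp1f.
- by move=> *; rewrite ccompf1.
- by move=> *; rewrite gcompVf.
- by move=> *; rewrite gcompfV.
Qed.

(* [universal_groupoid] is the localization of [C] at all its morphisms. *)
Theorem universal_groupoidP (H : groupoid) (F0 : ob C -> ob H)
    (F : forall a b, hom a b -> hom (F0 a) (F0 b)) :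
  is_functor F ->
  exists! G : forall a b, @hom universal_groupoid a b -> hom (F0 a) (F0 b),
    @is_functor universal_groupoid H F0 G /\
    (forall (a b : ob C) (f : hom a b), G a b (ug_gen f) = F a b f).
Proof.
move=> FF; exists (fun a b x => gterm_eval F (ug_repr x)); split.
  split; first split=> [a|a b c g f] /=.
  - exact: (gterm_eval_eq FF (ug_classK (GId a))).
  - exact: (gterm_eval_eq FF (ug_classK _)).
  - by move=> a b f; rewrite (gterm_eval_eq FF (ug_classK _)).
move=> G [[G1 GM] GF]; apply: functional_extensionality_dep => a.
apply: functional_extensionality_dep => b; apply: funext => x.
rewrite -[in RHS](ug_reprK x); elim: {x}(ug_repr x) => {a b}
  [a|a b f|a b t IH|a b c t IHt u IHu] /=.
- by rewrite -[LHS]G1.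
- by rewrite -GF.
- rewrite IH; apply/esym/ginv_unique.
  by rewrite -GM -ug_invE /= ug_compVf -[RHS]G1.
- by rewrite IHt IHu -GM /= ug_compE.
Qed.

End UniversalGroupoid.

Inductive ktree (k : nat) : Type :=
| Leaf
| Node of {ffun 'I_k -> ktree k}.
Arguments Leaf {k}.

Lemma ktree_ffun_ind (k : nat) (P : ktree k -> Prop) :
  P Leaf ->
  (forall c : {ffun 'I_k -> ktree k}, (forall i, P (c i)) -> P (Node c)) ->
  forall t, P t.
Proof.
move=> PL PN; fix IH 1 => -[|c]; first exact: PL.
by apply: PN => i; apply: IH.
Qed.

Fixpoint nleaves k (t : ktree k) : nat :=
  if t is Node c then sumn [seq nleaves (c i) | i <- enum 'I_k] else 1.

(* [graft t f] attaches the tree [f j] to the leaf number [j] of [t].  As the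
   leaves are numbered from left to right, the [j]-th leaf of the [i]-th child is
   the leaf number [flatten_index sh i j], where [sh] lists the numbers of leaves
   of the children. *)
Fixpoint graft k (t : ktree k) (f : nat -> ktree k) : ktree k :=
  if t is Node c then
    Node [ffun i => graft (c i)
      (fun j => f (flatten_index [seq nleaves (c i') | i' <- enum 'I_k] i j))]
  else f 0.

Lemma sum_flatten_index (sh : seq nat) (F : nat -> nat) :
  \sum_(i < size sh) \sum_(j < nth 0 sh i) F (flatten_index sh i j)
  = \sum_(r < sumn sh) F r.
Proof.
elim: sh F => [|n sh IH] F; first by rewrite !big_ord0.
rewrite [LHS]big_ord_recl [sumn _]/= big_split_ord; congr (_ + _).
rewrite -(IH (fun r => F (n + r))); apply: eq_bigr => i _.
by apply: eq_bigr => j _; rewrite /flatten_index /= addnA.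
Qed.

Lemma nleaves_graft k (t : ktree k) (f : nat -> ktree k) :
  nleaves (graft t f) = \sum_(j < nleaves t) nleaves (f j).
Proof.
elim/ktree_ffun_ind: t f => [|c IH] f /=; first by rewrite big_ord1.
rewrite -(sum_flatten_index _ (fun r => nleaves (f r))) sumnE big_map big_enum.
rewrite size_map size_enum_ord; apply: eq_bigr => i _; rewrite ffunE IH.
by rewrite (nth_map i) ?size_enum_ord // nth_ord_enum.
Qed.

Record forest (k n m : nat) := Forest {
  trees :> n.-tuple (ktree k);
  leaf_count : sumn [seq nleaves t | t <- trees] == m
}.

Section Forests.
Variable k : nat.

Definition shape n m (p : forest k n m) : n.-tuple nat :=
  [tuple of map (@nleaves k) p].

Lemma sumn_shape n m (p : forest k n m) : sumn (shape p) = m.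
Proof. exact/eqP/leaf_count. Qed.

Lemma id_forest_subproof n :
  sumn [seq nleaves t | t <- [tuple (@Leaf k) | _ < n]] == n.
Proof.
by rewrite /= -map_comp sumnE big_map big_enum sum1_card card_ord.
Qed.

Definition id_forest n : forest k n n := Forest (id_forest_subproof n).

Lemma corolla_subproof :
  sumn [seq nleaves t | t <- [tuple Node [ffun _ : 'I_k => Leaf]]] == k.
Proof.
rewrite /= addn0 sumnE big_map big_enum.
by rewrite (eq_bigr (fun=> 1)) => [|i _]; rewrite ?ffunE // sum1_card card_ord.
Qed.

Definition corolla : forest k 1 k := Forest corolla_subproof.

Lemma cat_forest_subproof n m n' m' (p : forest k n m) (q : forest k n' m') :
  sumn [seq nleaves t | t <- [tuple of p ++ q]] == m + m'.
Proof.
by rewrite /= map_cat sumn_cat; apply/eqP; congr (_ + _); apply/eqP/leaf_count.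
Qed.

Definition cat_forest n m n' m' (p : forest k n m) (q : forest k n' m') :
  forest k (n + n') (m + m') := Forest (cat_forest_subproof p q).

Definition stack_trees n m l (f : forest k m l) (q : forest k n m) :=
  [tuple graft (tnth q i) (fun j => nth Leaf f (flatten_index (shape q) i j))
  | i < n].

Lemma stack_subproof n m l (f : forest k m l) (q : forest k n m) :
  sumn [seq nleaves t | t <- stack_trees f q] == l.
Proof.
rewrite /= -map_comp -[X in _ == X](sumn_shape f) !sumnE !big_map -enumT /=.
rewrite big_enum /= (big_nth Leaf) size_tuple big_mkord; apply/eqP.
have := sum_flatten_index (shape q) (fun r => nleaves (nth Leaf f r)).
rewrite sumn_shape size_tuple => <-; apply: eq_bigr => i _.
by rewrite nleaves_graft (nth_map Leaf) ?size_tuple // -tnth_nth.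
Qed.

Definition stack n m l (f : forest k m l) (q : forest k n m) : forest k n l :=
  Forest (stack_subproof f q).

Lemma perm_forest_subproof n m (tau : 'S_n) (p : forest k n m) :
  sumn [seq nleaves t | t <- [tuple tnth p (tau i) | i < n]] == m.
Proof.
rewrite -[X in _ == X](sumn_shape p) /= -map_comp !sumnE !big_map -enumT.
by rewrite big_enum /= big_tuple [X in _ == X](reindex_inj (@perm_inj _ tau)).
Qed.

Definition perm_forest n m (tau : 'S_n) (p : forest k n m) : forest k n m :=
  Forest (perm_forest_subproof tau p).

Section Cabling.
Variables (n m : nat) (p : forest k n m) (tau : 'S_n).

Lemma cabling_root_subproof (r : 'I_m) :
  reshape_index (shape (perm_forest tau p)) r < n.
Proof.
rewrite -[X in _ < X](size_tuple (shape (perm_forest tau p))).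
by apply: reshape_indexP; rewrite sumn_shape.
Qed.

(* The root, in [perm_forest tau p], above which the leaf number [r] sits. *)
Definition cabling_root (r : 'I_m) : 'I_n := Ordinal (cabling_root_subproof r).

Lemma cabling_subproof1 (r : 'I_m) :
  reshape_offset (shape (perm_forest tau p)) r < nth 0 (shape p) (tau (cabling_root r)).
Proof.
have := @reshape_offsetP (shape (perm_forest tau p)) r.
rewrite sumn_shape ltn_ord => /(_ isT).
rewrite -[reshape_index _ _]/(val (cabling_root r)) -!tnth_nth.
by rewrite !tnth_map tnth_ord_tuple.
Qed.

Lemma cabling_subproof2 (r : 'I_m) :
  flatten_index (shape p) (tau (cabling_root r))
    (reshape_offset (shape (perm_forest tau p)) r) < m.
Proof.
by rewrite -[X in _ < X](sumn_shape p) flatten_indexP ?cabling_subproof1.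
Qed.

Definition cabling_fun (r : 'I_m) : 'I_m := Ordinal (cabling_subproof2 r).

Lemma cabling_fun_inj : injective cabling_fun.
Proof.
move=> r s /(congr1 val) /= e; apply: val_inj => /=.
have eo := congr1 (reshape_offset (shape p)) e.
have ei := congr1 (reshape_index (shape p)) e.
rewrite !flatten_indexKr ?cabling_subproof1 // in eo.
rewrite !flatten_indexKl ?cabling_subproof1 // in ei.
have /(congr1 val) /= er := perm_inj (val_inj ei).
by rewrite -(reshape_indexK (shape (perm_forest tau p)) r) er eo reshape_indexK.
Qed.

(* The permutation S(p, tau): the [i]-th segment of the diagram of [tau] is
   replaced by as many parallel segments as the [tau i]-th tree of [p] has
   leaves, see [cablingE]. *)
Definition cabling : 'S_m := perm cabling_fun_inj.

Lemma cablingE (i : 'I_n) (j : nat) (r : 'I_m) :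
  j < nleaves (tnth p (tau i)) ->
  r = flatten_index (shape (perm_forest tau p)) i j :> nat ->
  cabling r = flatten_index (shape p) (tau i) j :> nat.
Proof.
move=> jlt er; rewrite permE /=.
have jlt' : j < nth 0 (shape (perm_forest tau p)) i.
  by rewrite -tnth_nth !tnth_map tnth_ord_tuple.
have -> : cabling_root r = i by apply: val_inj; rewrite /= er flatten_indexKl.
by rewrite er flatten_indexKr.
Qed.

End Cabling.

End Forests.

Section CatPerm.
Variables (m n : nat) (s : 'S_m) (t : 'S_n).

Definition cat_perm_fun (i : 'I_(m + n)) : 'I_(m + n) :=
  match fintype.split i with inl a => lshift n (s a) | inr b => rshift m (t b) end.

Lemma cat_perm_fun_inj : injective cat_perm_fun.
Proof.
rewrite /cat_perm_fun => i j.
case: (split_ordP i) => a ->; case: (split_ordP j) => b -> /eqP.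
- by rewrite eq_lshift => /eqP/perm_inj ->.
- by rewrite eq_lrshift.
- by rewrite eq_rlshift.
- by rewrite eq_rshift => /eqP/perm_inj ->.
Qed.

Definition cat_perm : 'S_(m + n) := perm cat_perm_fun_inj.

End CatPerm.

Definition cat_ffun (T : Type) m n (g : {ffun 'I_m -> T}) (h : {ffun 'I_n -> T}) :
    {ffun 'I_(m + n) -> T} :=
  [ffun i => match fintype.split i with inl a => g a | inr b => h b end].

Section LabelledForests.
Variables (k : nat) (Gamma : groupType).

(* The triple (f, sigma, g) stands for g o sigma o f. *)
Definition lforest (n m : nat) : Type :=
  (forest k n m * 'S_m * {ffun 'I_m -> Gamma})%type.

Definition of_forest n m (f : forest k n m) : lforest n m := (f, 1%g, 1%g).
Definition of_perm m (sigma : 'S_m) : lforest m m := (id_forest k m, sigma, 1%g).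
Definition of_labels m (g : {ffun 'I_m -> Gamma}) : lforest m m :=
  (id_forest k m, 1%g, g).

(* The monoidal structures on labelled forests considered here have [0] as unit
   object: [lforest 0 0] only contains the empty diagram, while [lforest 0 n] and
   [lforest n 0] are empty for [0 < n]. *)
Record diagram_rules (C : strict_monoidal_on lforest addn 0) : Prop :=
    DiagramRules {
  rule_triple n m (f : forest k n m) (sigma : 'S_m) (g : {ffun 'I_m -> Gamma}) :
    ccomp C (of_labels g) (ccomp C (of_perm sigma) (of_forest f))
    = (f, sigma, g);
  rule_forest n m l (f : forest k m l) (q : forest k n m) :
    ccomp C (of_forest f) (of_forest q) = of_forest (stack f q);
  (* [(tau * sigma)%g] is [sigma \o tau] *)
  rule_perm m (sigma tau : 'S_m) :
    ccomp C (of_perm sigma) (of_perm tau) = of_perm (tau * sigma)%g;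
  rule_labels m (g h : {ffun 'I_m -> Gamma}) :
    ccomp C (of_labels g) (of_labels h) = of_labels (g * h)%g;
  rule_forest_perm n m (p : forest k n m) (tau : 'S_n) :
    ccomp C (of_forest p) (of_perm tau)
    = ccomp C (of_perm (cabling p tau)) (of_forest (perm_forest tau p));
  rule_perm_labels m (sigma : 'S_m) (g : {ffun 'I_m -> Gamma}) :
    ccomp C (of_perm sigma) (of_labels g)
    = ccomp C (of_labels [ffun i => g (sigma^-1%g i)]) (of_perm sigma);
  rule_tens n m n' m' (f : forest k n m) (sigma : 'S_m)
      (g : {ffun 'I_m -> Gamma}) (f' : forest k n' m') (sigma' : 'S_m')
      (g' : {ffun 'I_m' -> Gamma}) :
    tens C ((f, sigma, g) : lforest n m) ((f', sigma', g') : lforest n' m')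
    = (cat_forest f f', cat_perm sigma sigma', cat_ffun g g')
}.

Definition corolla_relation (theta : Gamma -> Gamma)
    (C : strict_monoidal_on lforest addn 0) : Prop :=
  forall g : Gamma,
    ccomp C (of_forest (corolla k)) (of_labels [ffun _ : 'I_1 => g])
    = ccomp C
        (of_labels [ffun i : 'I_k => if val i == 0 then theta g else 1%g])
        (of_forest (corolla k)).

Definition positive_part (C : strict_monoidal_on lforest addn 0) : category :=
  @full_subcategory (Category C) (fun n : nat => 0 < n).

End LabelledForests.

Local Open Scope ring_scope.

Section Nets.
Variable R : realType.

Record directed (I : Type) (le : I -> I -> Prop) : Prop := Directed {
  directed_refl : forall i, le i i;
  directed_trans : forall i j l, le i j -> le j l -> le i l;
  directed_inhabited : exists i : I, True;
  directed_ub : forall i j, exists l, le i l /\ le j l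
}.

Definition vanishes_at_infinity (X : Type) (phi : X -> R[i]) : Prop :=
  forall e : R, 0 < e -> finite_set [set x | e%:C <= `|phi x|].

Definition net_cvg1 (I X : Type) (le : I -> I -> Prop) (phi : I -> X -> R[i]) :
    Prop :=
  forall (x : X) (e : R), 0 < e ->
    exists i0, forall i, le i0 i -> `|phi i x - 1| < e%:C.

Definition haagerup_for (X : Type) (posdef : (X -> R[i]) -> Prop) : Prop :=
  exists (I : Type) (le : I -> I -> Prop) (phi : I -> X -> R[i]),
    [/\ directed le,
        forall i, posdef (phi i),
        forall i, vanishes_at_infinity (phi i) &
        net_cvg1 le phi].

End Nets.

Section GroupHaagerup.
Variable R : realType.

Definition group_posdef (Gamma : groupType) (phi : Gamma -> R[i]) : Prop :=
  forall (n : nat) (g : 'I_n -> Gamma) (c : 'I_n -> R[i]),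
    0 <= \sum_(i < n) \sum_(j < n)
           Num.conj (c i) * c j * phi ((g i)^-1 * g j)%g.

Definition group_haagerup (Gamma : groupType) : Prop :=
  haagerup_for (@group_posdef Gamma).

End GroupHaagerup.

Section GroupoidHaagerup.
Variable R : realType.

(* [inner] is linear in its first variable and conjugate-linear in the second. *)
Record hilbert := Hilbert {
  hspace :> completeNormedModType R[i];
  inner : {dot hspace for Num.conj};
  inner_norm : forall x : hspace, `|x| ^+ 2 = inner x x
}.

Definition closed_subspace (H : hilbert) (E : set H) : Prop :=
  [/\ E 0, forall (a : R[i]) x y, E x -> E y -> E (a *: x + y) & closed E].

Definition is_hilbert_sum (H : hilbert) (A : Type) (E : A -> set H) : Prop :=
  [/\ forall a, closed_subspace (E a),
      forall a b, a <> b -> forall x y, E a x -> E b y -> inner H x y = 0 &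
      closure [set x | exists (n : nat) (a : 'I_n -> A) (y : 'I_n -> H),
                 (forall i, E (a i) (y i)) /\ x = \sum_(i < n) y i]
      = setT].

Definition partial_isometry (H : hilbert) (T : H -> H) (E F : set H) : Prop :=
  [/\ forall x, E x -> `|T x| = `|x|,
      forall x, (forall y, E y -> inner H x y = 0) -> T x = 0 &
      T @` E = F].

Record groupoid_rep (G : groupoid) := GroupoidRep {
  rspace : hilbert;
  rfiber : ob G -> set rspace;
  rop : forall a b : ob G, hom a b -> {linear rspace -> rspace};
  rfiber_sum : is_hilbert_sum rfiber;
  rop_continuous : forall (a b : ob G) (g : hom a b), continuous (rop g);
  rop_isometry : forall (a b : ob G) (g : hom a b),
    partial_isometry (rop g) (rfiber a) (rfiber b);
  rop_comp : forall (a b c : ob G) (g : hom b c) (h : hom a b) x,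
    rop (ccomp G g h) x = rop g (rop h x)
}.

Definition arrow (G : groupoid) : Type := {ab : ob G * ob G & hom ab.1 ab.2}.

Definition coefficient (G : groupoid) (pi : groupoid_rep G)
    (xi eta : rspace pi) (g : arrow G) : R[i] :=
  inner (rspace pi) (rop pi (tagged g) xi) eta.

(* No normalization is imposed on [xi]: the identities of [G] act by the
   projections onto the fibers, so that the values of a diagonal coefficient at
   the identities sum to [`|xi| ^+ 2].  Asking [`|xi| = 1] would prevent a net of
   such functions from converging to 1 as soon as [G] has two objects. *)
Definition groupoid_posdef (G : groupoid) (phi : arrow G -> R[i]) : Prop :=
  exists (pi : groupoid_rep G) (xi : rspace pi), phi = coefficient xi xi.

Definition groupoid_haagerup (G : groupoid) : Prop :=
  haagerup_for (@groupoid_posdef G).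

End GroupoidHaagerup.

(* Main.v *)
(* A labelled forest is determined by the list of the addresses and labels of its
   leaves.  Composition is explicit on such lists, which gives the category; it is
   unique since the corolla relation determines how labels move through an
   arbitrary forest.  The category is cancellative and has common multiples, so
   that the morphisms of its universal groupoid are fractions y^-1 x.  Hence a
   kernel K(x, y) on the pairs of morphisms with the same target that is positive
   definite and invariant under postcomposition defines a function y^-1 x |->
   K(x, y) on the groupoid; cut down to finitely many objects, it is a diagonal
   coefficient by the GNS construction, carried out in a reproducing kernel
   Hilbert space.

   Take K(x, y) = a ^ d(x, y) * prod_j kappa(x_j, y_j), where 0 < a < 1, d(x, y) is
   the number of carets of x and y that do not match, and kappa compares the labels
   of the leaves number j by averaging over N shifts by theta a positive definite
   function phi on Gamma.  If a fraction y^-1 x, where y is a full forest of least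
   possible depth D, has a large coefficient, then D is bounded: otherwise a last
   caret of y that does not merge with x would sit below a matched vertex at distance
   more than N, where kappa vanishes unless the label is in the image of theta.  Then
   x ranges over a finite set, because phi vanishes at infinity.  The coefficients
   tend to 1 as a and phi tend to 1 and N to infinity. *)
From HB Require Import structures.
From mathcomp Require Import all_boot all_order all_algebra all_fingroup.
From mathcomp Require Import sesquilinear.
From mathcomp Require Import boolp classical_sets functions cardinality reals.
From mathcomp Require Import topology normedtype.
From mathcomp Require Import complex zify ring lra.
Require Import Defs.

Set Implicit Arguments.
Unset Strict Implicit.
Unset Printing Implicit Defensive.

Import Order.TTheory GRing.Theory Num.Theory.
Import numFieldNormedType.Exports.

(** * Positive kernels *)

(** The obstacle is that [theta] need not be onto and that [phi] is not [theta]-invariant, whereas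
    the kernel must not change when both arguments are composed with the same morphism. Such a
    composition turns the label g of a leaf into theta^m(g), up to a left factor, at the one new
    leaf reached by m zeros, and deletes it at the others. Hence a leaf is recorded as (p, g), where
    p counts the trailing zeros of its address, and this pair is spread over the translates
    theta^t(g) with t in [-p, N - p): passing to (p + 1, theta(g)) merely reindexes them. A negative
    t stands for a kernel supported on the image of theta^(-t); once p >= N only such t remain, and
    this detects the carets that do not merge. The windows of p and q overlap in N - |p - q| shifts,
    so that long windows bring the kernel close to 1. Labels also disturb the matching of vertices:
    the label of a leaf of x reaches only the leftmost leaf of what is grafted on it, hence the
    label of the leftmost leaf is erased in the forest above a vertex. Working with kernels rather
    than representations turns tensor products into Schur products. *)

Section PositiveKernels.
Local Open Scope ring_scope.
Variable C : numClosedFieldType.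

Section Form.
Variable X : Type.
Implicit Types (K : X -> X -> C) (u v w : seq (C * X)) (x y : X).

(** Finite combinations of points are lists of weighted points, repetitions allowed, so that [++]
    adds them. No quotient is taken: two lists stand for the same vector when their functions
    [kcomb] agree. *)
Definition kcomb K u y : C := \sum_(p <- u) p.1 * K p.2 y.
Definition keval (f : X -> C) v : C := \sum_(q <- v) q.1^* * f q.2.
Definition kform K u v : C := keval (kcomb K u) v.
Definition kscale (a : C) v := [seq (a * p.1, p.2) | p <- v].

Definition psd K := forall v, 0 <= kform K v v.

Lemma keval_cat f u v : keval f (u ++ v) = keval f u + keval f v.
Proof. by rewrite /keval big_cat. Qed.

Lemma keval_scale f a v : keval f (kscale a v) = a^* * keval f v.
Proof.
rewrite /keval /kscale big_map mulr_sumr; apply: eq_bigr => p _ /=.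
by rewrite rmorphM mulrA.
Qed.

Lemma keval1 f a x : keval f [:: (a, x)] = a^* * f x.
Proof. by rewrite /keval big_seq1. Qed.

Lemma keval_lin f g a v :
  keval (fun x => a * f x + g x) v = a * keval f v + keval g v.
Proof.
rewrite /keval mulr_sumr -big_split; apply: eq_bigr => q _ /=.
by rewrite mulrDr mulrCA.
Qed.

Lemma keval_ext f g v : f =1 g -> keval f v = keval g v.
Proof. by move=> fg; apply: eq_bigr => q _; rewrite fg. Qed.

Lemma kcomb_cat K u v y : kcomb K (u ++ v) y = kcomb K u y + kcomb K v y.
Proof. by rewrite /kcomb big_cat. Qed.

Lemma kcomb_scale K a u y : kcomb K (kscale a u) y = a * kcomb K u y.
Proof.
rewrite /kcomb /kscale big_map mulr_sumr; apply: eq_bigr => p _ /=.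
by rewrite mulrA.
Qed.

Lemma kcomb1 K a x y : kcomb K [:: (a, x)] y = a * K x y.
Proof. by rewrite /kcomb big_seq1. Qed.

Lemma kform_catl K u v w : kform K (u ++ v) w = kform K u w + kform K v w.
Proof.
rewrite -[X in _ = X + _]mul1r -keval_lin; apply: keval_ext => y.
by rewrite kcomb_cat mul1r.
Qed.

Lemma kform_scalel K a u w : kform K (kscale a u) w = a * kform K u w.
Proof.
rewrite /kform /keval mulr_sumr; apply: eq_bigr => q _.
by rewrite kcomb_scale mulrCA.
Qed.

Lemma kform_catr K u v w : kform K u (v ++ w) = kform K u v + kform K u w.
Proof. exact: keval_cat. Qed.

Lemma kform_scaler K a u w : kform K u (kscale a w) = a^* * kform K u w.
Proof. exact: keval_scale. Qed.

Lemma kformE K u v :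
  kform K u v = \sum_(p <- u) \sum_(q <- v) p.1 * q.1^* * K p.2 q.2.
Proof.
rewrite exchange_big; apply: eq_bigr => q _; rewrite mulr_sumr.
by apply: eq_bigr => p _; rewrite mulrCA mulrA.
Qed.

Lemma kform11 K a x b y : kform K [:: (a, x)] [:: (b, y)] = a * b^* * K x y.
Proof. by rewrite kformE !big_seq1. Qed.

Lemma kform_split (b : pred X) K u v : kform K u v =
  kform K [seq p <- u | b p.2] [seq q <- v | b q.2] +
  kform K [seq p <- u | b p.2] [seq q <- v | ~~ b q.2] +
  (kform K [seq p <- u | ~~ b p.2] [seq q <- v | b q.2] +
   kform K [seq p <- u | ~~ b p.2] [seq q <- v | ~~ b q.2]).
Proof.
rewrite !kformE !big_filter [LHS](bigID (fun p => b p.2)) /=.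
by congr (_ + _); rewrite -big_split; apply: eq_bigr => p _ /=;
  rewrite !big_filter [LHS](bigID (fun q => b q.2)).
Qed.

Lemma kform_ext K L u v : (forall x y, K x y = L x y) -> kform K u v = kform L u v.
Proof. by move=> KL; rewrite !kformE; under eq_bigr do under eq_bigr do rewrite KL. Qed.

Lemma psd_ext K L : (forall x y, K x y = L x y) -> psd K -> psd L.
Proof. by move=> KL pK v; rewrite -(kform_ext v v KL). Qed.

Lemma kform_herm_of K u v : (forall x y, K x y = (K y x)^*) ->
  kform K u v = (kform K v u)^*.
Proof.
move=> H; rewrite !kformE exchange_big rmorph_sum; apply: eq_bigr => q _.
rewrite rmorph_sum; apply: eq_bigr => p _.
by rewrite !rmorphM /= conjCK -H [q.1^* * _]mulrC.
Qed.

(* The diagonal of [kform K] is real, hence by polarization [K] is hermitian. *)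
Lemma psd_herm K : psd K -> forall x y, K x y = (K y x)^*.
Proof.
move=> pK x y.
have rK a b : a * b^* * K x y + b * a^* * K y x \is Num.real.
  have := ger0_real (pK ([:: (a, x)] ++ [:: (b, y)])).
  rewrite kform_catl !kform_catr !kform11 => r.
  have rx := ger0_real (pK [:: (a, x)]); have ry := ger0_real (pK [:: (b, y)]).
  rewrite !kform11 in rx ry.
  have -> : a * b^* * K x y + b * a^* * K y x =
    (a * a^* * K x x + a * b^* * K x y + (b * a^* * K y x + b * b^* * K y y))
      - a * a^* * K x x - b * b^* * K y y by ring.
  by rewrite !rpredB.
have /CrealP := rK 1 1; have /CrealP := rK 1 'i.
rewrite !rmorphD !rmorphM /= !conjCi !conjC1 ?rmorphN ?conjCi /= ?mul1r ?mulr1.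
move: (K x y) (K y x) => P Q; rewrite conjCi opprK => r2 r1.
have i0 : ('i : C) != 0 by exact: neq0Ci.
have {}r2 : P^* - Q^* = Q - P.
  by apply: (mulfI i0); transitivity (- 'i * P + 'i * Q); [rewrite -r2|]; ring.
apply: (@mulfI _ 2); first by rewrite pnatr_eq0.
by transitivity (P + Q - (Q - P)); [ring|rewrite -r1 -r2; ring].
Qed.

Lemma kform_herm K u v : psd K -> kform K u v = (kform K v u)^*.
Proof. by move=> pK; apply/kform_herm_of/psd_herm. Qed.

Lemma psd_diag K x : psd K -> 0 <= K x x.
Proof. by move/(_ [:: (1, x)]); rewrite kform11 conjC1 !mul1r. Qed.

Lemma kform_sub_scale K u v t : psd K ->
  kform K (u ++ kscale t v) (u ++ kscale t v) =
  kform K u u + t^* * kform K u v + t * (kform K u v)^* + t * t^* * kform K v v.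
Proof.
move=> pK; rewrite kform_catl !kform_catr !kform_scalel !kform_scaler.
by rewrite (kform_herm v u pK); ring.
Qed.

Lemma kform_CS K u v : psd K ->
  `|kform K u v| ^+ 2 <= kform K u u * kform K v v.
Proof.
move=> pK; set b := kform K u v; set A := kform K u u; set D := kform K v v.
have D0 : 0 <= D := pK v.
have expand t : 0 <= A + t^* * b + t * b^* + t * t^* * D.
  by rewrite /A /b /D -kform_sub_scale.
have [D1|D1] := eqVneq D 0.
  suff -> : b = 0 by rewrite normr0 expr0n D1 mulr0.
  apply: contrapT => /eqP b0.
  have b2 : 0 < b * b^* by rewrite -normCK exprn_gt0 ?normr_gt0.
  have A0 : 0 <= A := pK u.
  (* In the degenerate case the polynomial is affine in [t]; this value makes it [A - 2 * (A + 1)],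
     which is negative. *)
  have := expand (- ((A + 1) / (b * b^*)) * b).
  rewrite D1 mulr0 addr0 rmorphM /= rmorphN /=.
  rewrite (CrealP _); last by rewrite rpredM ?rpredV ?rpredD ?ger0_real ?(ltW b2).
  set r := (A + 1) / _.
  have -> : A + - r * b^* * b + - r * b * b^* = A - 2 * (r * (b * b^*)) by ring.
  rewrite /r divfK ?gt_eqF // => h.
  have : A + 2 <= 0.
    by rewrite -oppr_ge0; apply: le_trans h _; rewrite le_eqVlt; apply/orP; left; apply/eqP; ring.
  by move=> h2; have := lt_le_trans (ltr_wpDl A0 (ltr0Sn C 1)) h2; rewrite ltxx.
have Dp : 0 < D by rewrite lt_def D1.
have Dr : D^* = D by apply/CrealP/ger0_real.
have := expand (- (b / D)); rewrite rmorphN rmorphM /= fmorphV /= Dr.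
have -> : A + - (b^* / D) * b + - (b / D) * b^* + - (b / D) * - (b^* / D) * D =
   A - b * b^* / D by field.
by rewrite subr_ge0 ler_pdivrMr // normCK.
Qed.

Lemma psd_CS K x y : psd K -> `|K x y| ^+ 2 <= K x x * K y y.
Proof.
by move=> pK; have := kform_CS [:: (1, x)] [:: (1, y)] pK; rewrite !kform11 conjC1 !mul1r.
Qed.

Lemma psdD K L : psd K -> psd L -> psd (fun x y => K x y + L x y).
Proof.
move=> pK pL v; rewrite (_ : kform _ v v = kform K v v + kform L v v) ?addr_ge0 //.
rewrite !kformE -big_split; apply: eq_bigr => p _; rewrite -big_split.
by apply: eq_bigr => q _; rewrite mulrDr.
Qed.

Lemma psd0 : psd (fun _ _ => 0).
Proof. by move=> v; rewrite kformE big1 // => p _; rewrite big1 // => q _; rewrite mulr0. Qed.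

Lemma psd_sum (I : Type) (r : seq I) (P : pred I) (K : I -> X -> X -> C) :
  (forall i, P i -> psd (K i)) -> psd (fun x y => \sum_(i <- r | P i) K i x y).
Proof.
move=> pK; elim: r => [|i r IH].
  by apply: psd_ext psd0 => x y; rewrite big_nil.
case Pi: (P i); last by apply: psd_ext IH => x y; rewrite big_cons Pi.
by apply: psd_ext (psdD (pK i Pi) IH) => x y; rewrite big_cons Pi.
Qed.

Lemma psd_conj_mul (f : X -> C) K : psd K -> psd (fun x y => f x * (f y)^* * K x y).
Proof.
move=> pK v; have := pK [seq (p.1 * f p.2, p.2) | p <- v].
rewrite !kformE big_map; under eq_bigr do rewrite big_map.
congr (0 <= _); apply: eq_bigr => p _; apply: eq_bigr => q _ /=.
by rewrite rmorphM /=; ring.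
Qed.

Lemma psdZ (a : C) K : 0 <= a -> psd K -> psd (fun x y => a * K x y).
Proof.
move=> a0 pK v; rewrite (_ : kform _ v v = a * kform K v v) ?mulr_ge0 //.
rewrite !kformE mulr_sumr; apply: eq_bigr => p _; rewrite mulr_sumr.
by apply: eq_bigr => q _; ring.
Qed.

Lemma psd1 : psd (fun _ _ => 1).
Proof.
move=> v; rewrite kformE.
rewrite (_ : \sum_(p <- v) _ = (\sum_(p <- v) p.1) * (\sum_(p <- v) p.1)^*).
  by rewrite -normCK exprn_ge0.
rewrite mulr_suml; apply: eq_bigr => p _; rewrite rmorph_sum mulr_sumr.
by apply: eq_bigr => q _; rewrite mulr1.
Qed.

(** Schur complement: this is the kernel of the components orthogonal to [x], obtained by
    subtracting from [v] its projection on [x]. *)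
Lemma psd_pivot K x : psd K -> K x x != 0 ->
  psd (fun y z => K y z - (K x x)^-1 * (K y x * (K z x)^*)).
Proof.
move=> pK Kx v; have Kp : 0 < K x x by rewrite lt_def Kx psd_diag.
set b := kform K v [:: (1, x)].
have := pK (v ++ kscale (- (b / K x x)) [:: (1, x)]).
rewrite kform_sub_scale // -/b kform11 conjC1 !mul1r rmorphN rmorphM /= fmorphV /=.
rewrite (CrealP (ger0_real (ltW Kp))).
have -> : kform K v v + - (b^* / K x x) * b + - (b / K x x) * b^* +
   - (b / K x x) * - (b^* / K x x) * K x x = kform K v v - (K x x)^-1 * (b * b^*).
  by field.
congr (0 <= _).
have -> : b = \sum_(p <- v) p.1 * K p.2 x.
  by rewrite /b kformE; apply: eq_bigr => p _; rewrite big_seq1 conjC1 mulr1.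
rewrite !kformE rmorph_sum mulr_suml mulr_sumr -sumrB; apply: eq_bigr => p _.
rewrite !mulr_sumr -sumrB; apply: eq_bigr => q _.
by rewrite rmorphM /=; ring.
Qed.

(** Gaussian elimination, one pivot per listed point. The nonnegative weights stay beside the
    functions, which avoids square roots. A zero residual on the diagonal suffices, as
    Cauchy-Schwarz then makes the residual vanish between listed points. *)
Lemma psd_cholesky K (xs : seq X) : psd K ->
  exists fs : seq (C * (X -> C)),
    (forall i, 0 <= (nth (0, fun=> 0) fs i).1) /\
    let L := fun x y => K x y - \sum_(f <- fs) f.1 * (f.2 x * (f.2 y)^*) in
    psd L /\ forall i x0, (i < size xs)%N -> L (nth x0 xs i) (nth x0 xs i) = 0.
Proof.
move=> pK; elim: xs => [|x xs [fs [fs0 [pL Lxs]]]] /=.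
  exists [::]; split; first by move=> i; rewrite nth_nil.
  by split=> //; apply: psd_ext pK => x y; rewrite big_nil subr0.
set L := (fun x y : X => _) in pL Lxs.
have [Lx|Lx] := eqVneq (L x x) 0.
  by exists fs; split=> //; split=> // -[|i] x0 //=; exact: Lxs.
exists (((L x x)^-1, L^~ x) :: fs); split.
  by case=> [|i] //=; rewrite ?invr_ge0 ?psd_diag.
set L' := (fun y z : X => _); have eL' y z :
  L' y z = L y z - (L x x)^-1 * (L y x * (L z x)^*).
  by rewrite /L' big_cons opprD addrCA [LHS]addrC.
split; first by apply: psd_ext (psd_pivot pL Lx) => y z; rewrite eL'.
case=> [|i] x0 /= lti.
  rewrite -[LHS]/(L' x x) eL'.
  by rewrite (CrealP (ger0_real (psd_diag x pL))); field.
rewrite -[LHS]/(L' (nth x0 xs i) (nth x0 xs i)) eL'.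
(* A point treated earlier keeps a zero residual: by Cauchy-Schwarz the correction of the new pivot
   vanishes there. *)
have := psd_CS (nth x0 xs i) x pL.
have -> : L (nth x0 xs i) (nth x0 xs i) = 0 by exact: Lxs.
rewrite !mul0r.
move=> h; have /eqP : `|L (nth x0 xs i) x| ^+ 2 = 0.
  by apply/le_anti; rewrite h exprn_ge0.
by rewrite expf_eq0 /= normr_eq0 => /eqP ->; rewrite mul0r mulr0 subr0.
Qed.

(* Schur's product theorem: by [psd_cholesky], [K] is a sum of rank one kernels on
   the finitely many points involved. *)
Lemma psdM K L : psd K -> psd L -> psd (fun x y => K x y * L x y).
Proof.
move=> pK pL v.
have [fs [fs0 [/= pK' zK']]] := psd_cholesky [seq p.2 | p <- v] pK.
have eK i j : (i < size v)%N -> (j < size v)%N -> forall p0,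
    K (nth p0 v i).2 (nth p0 v j).2 =
    \sum_(f <- fs) f.1 * (f.2 (nth p0 v i).2 * (f.2 (nth p0 v j).2)^*).
  move=> lti ltj p0; have := psd_CS (nth p0 v i).2 (nth p0 v j).2 pK'.
  have := zK' i p0.2; rewrite size_map (nth_map p0) // => -> //; rewrite mul0r => h.
  have /eqP := le_anti (introT andP (conj h (exprn_ge0 2 (normr_ge0 _)))).
  by rewrite expf_eq0 /= normr_eq0 subr_eq0 => /eqP.
have psdS : psd (fun x y => \sum_(i < size fs) (nth (0, fun=> 0) fs i).1 *
   ((nth (0, fun=> 0) fs i).2 x * ((nth (0, fun=> 0) fs i).2 y)^* * L x y)).
  by apply: psd_sum => i _; apply: psdZ => //; exact: psd_conj_mul.
have := psdS v; congr (0 <= _); rewrite !kformE.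
case: v eK {zK'} => [|p0 v'] eK; first by rewrite !big_nil.
move: (p0 :: v') eK => {}v eK.
rewrite !(big_nth p0) !big_mkord; apply: eq_bigr => i _.
rewrite !(big_nth p0) !big_mkord; apply: eq_bigr => j _; congr (_ * _).
rewrite eK // mulr_suml (big_nth (0, fun=> 0)) big_mkord; apply: eq_bigr => l _.
by rewrite mulrA.
Qed.

Lemma psd_prod (I : Type) (r : seq I) (P : pred I) (K : I -> X -> X -> C) :
  (forall i, P i -> psd (K i)) -> psd (fun x y => \prod_(i <- r | P i) K i x y).
Proof.
move=> pK; elim: r => [|i r IH].
  by apply: psd_ext psd1 => x y; rewrite big_nil.
case Pi: (P i); last by apply: psd_ext IH => x y; rewrite big_cons Pi.
by apply: psd_ext (psdM (pK i Pi) IH) => x y; rewrite big_cons Pi.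
Qed.

(** Different classes of [E] are orthogonal, so the form of [v] is that of the class of its first
    point plus that of the remaining, shorter list. *)
Lemma psd_blocks (E : X -> X -> bool) K :
    (forall x, E x x) -> (forall x y z, E x y -> E x z -> E y z) ->
    (forall x y, ~~ E x y -> K x y = 0) ->
    (forall x v, 0 <= kform K [seq p <- v | E x p.2] [seq p <- v | E x p.2]) ->
  psd K.
Proof.
move=> Exx Etr KE pE v; have [n] := ubnP (size v); elim: n v => // n IH [|p v] szv.
  by rewrite kformE big_nil.
have Es x y : E x y = E y x by apply/idP/idP => h; exact: (Etr _ _ _ h (Exx _)).
have z w q x : kform K [seq p <- w | E x p.2] [seq p <- q | ~~ E x p.2] = 0.
  rewrite kformE big_filter big1 // => r Pr; rewrite big_filter big1 // => s Ps.
  rewrite KE ?mulr0 //; apply: contra Ps => rs.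
  by apply: (@Etr r.2) => //; rewrite Es.
have z' w q x : kform K [seq p <- w | ~~ E x p.2] [seq p <- q | E x p.2] = 0.
  rewrite kformE big_filter big1 // => r Pr; rewrite big_filter big1 // => s Ps.
  rewrite KE ?mulr0 //; apply: contra Pr => rs.
  by apply: (@Etr s.2) => //; rewrite Es.
rewrite (kform_split (E p.2)) z addr0 z' add0r.
apply: addr_ge0; first exact: pE.
apply: IH; rewrite /= Exx /= size_filter.
by apply: leq_ltn_trans (count_size _ _) _; rewrite -ltnS.
Qed.
End Form.
End PositiveKernels.

(** * Reproducing kernel Hilbert spaces *)

Section RealNorm.
Local Open Scope ring_scope.
Local Open Scope complex_scope.
Variable R : rcfType.
Implicit Types z w : R[i].

Definition nrm z : R := complex.Re `|z|.

Lemma nrmE z : (nrm z)%:C = `|z|.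
Proof. by rewrite RRe_real // normr_real. Qed.

Lemma nrm_ge0 z : 0 <= nrm z.
Proof. by rewrite -ler0c nrmE. Qed.

Lemma nrmM z w : nrm (z * w) = nrm z * nrm w.
Proof. by apply: complexI; rewrite rmorphM /= !nrmE normrM. Qed.

Lemma nrmD z w : nrm (z + w) <= nrm z + nrm w.
Proof. by rewrite -lecR rmorphD /= !nrmE ler_normD. Qed.

Lemma nrmN z : nrm (- z) = nrm z.
Proof. by rewrite /nrm normrN. Qed.

Lemma nrmB z w : nrm (z - w) <= nrm z + nrm w.
Proof. by rewrite -(nrmN w) nrmD. Qed.

Lemma nrm0 : nrm 0 = 0.
Proof. by rewrite /nrm normr0. Qed.

Lemma nrm0_eq0 z : nrm z = 0 -> z = 0.
Proof. by move=> z0; apply/eqP; rewrite -normr_eq0 -nrmE z0. Qed.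

Lemma nrmJ z : nrm z^*%R = nrm z.
Proof. by rewrite /nrm norm_conjC. Qed.

Lemma nrm_real (x : R) : nrm x%:C = `|x|.
Proof.
by apply: complexI; rewrite nrmE normc_def /= expr0n addr0 sqrtr_sqr.
Qed.

Lemma Re_le_nrm z : `|complex.Re z| <= nrm z.
Proof. by rewrite -lecR nrmE normc_ge_Re. Qed.

Lemma nrm_sq z : nrm z ^+ 2 = complex.Re z ^+ 2 + complex.Im z ^+ 2.
Proof. by apply: complexI; rewrite rmorphXn /= nrmE add_Re2_Im2. Qed.

Lemma mulJ_nrm z : z * z^*%R = (nrm z ^+ 2)%:C.
Proof. by rewrite -normCK rmorphXn /= nrmE. Qed.

Lemma nrm_le_ReIm z : nrm z <= `|complex.Re z| + `|complex.Im z|.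
Proof.
rewrite -(@ler_pXn2r _ 2) ?nnegrE ?nrm_ge0 ?addr_ge0 //.
rewrite nrm_sq sqrrD !real_normK ?num_real // lerD2r lerDl.
by rewrite mulrn_wge0 ?mulr_ge0.
Qed.

Lemma Im_le_nrm z : `|complex.Im z| <= nrm z.
Proof.
rewrite -(@ler_pXn2r _ 2) ?nnegrE ?nrm_ge0 // nrm_sq real_normK ?num_real //.
by rewrite lerDr sqr_ge0.
Qed.

Lemma le_complex_nrm z (b : R) : (`|z| <= b%:C) = (nrm z <= b).
Proof. by rewrite -nrmE lecR. Qed.

Lemma lt_complex_nrm z (b : R) : (`|z| < b%:C) = (nrm z < b).
Proof. by rewrite -nrmE ltcR. Qed.

Lemma ReD z w : complex.Re (z + w) = complex.Re z + complex.Re w.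
Proof. by case: z w => [a b] [c d]. Qed.

Lemma ReB z w : complex.Re (z - w) = complex.Re z - complex.Re w.
Proof. by case: z w => [a b] [c d]. Qed.

Lemma ImB z w : complex.Im (z - w) = complex.Im z - complex.Im w.
Proof. by case: z w => [a b] [c d]. Qed.

Lemma ReJ z : complex.Re z^*%R = complex.Re z.
Proof.
by apply: complexI; rewrite !complexRe Re_conj.
Qed.

Lemma small_eq0 z (c : R) : 
  (forall e : R, 0 < e -> e <= 1 -> nrm z <= c * e) -> z = 0.
Proof.
move=> h; apply: nrm0_eq0; apply/eqP; rewrite eq_le nrm_ge0 andbT.
apply/ler_addgt0Pl => e e0; rewrite addr0.
have c1 : 0 < `|c| + 1 by rewrite ltr_wpDl.
have d0 : 0 < Num.min 1 (e / (`|c| + 1)) by rewrite lt_min ltr01 divr_gt0.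
apply: (le_trans (h _ d0 _)); first by rewrite ge_min lexx.
apply: (@le_trans _ _ ((`|c| + 1) * Num.min 1 (e / (`|c| + 1)))).
  by rewrite ler_wpM2r ?(ltW d0) // (le_trans (ler_norm c)) // lerDl.
by rewrite mulrC -ler_pdivlMr // ge_min lexx orbT.
Qed.
End RealNorm.

(** * Common points of families of intervals and discs *)

Section Intervals.
Local Open Scope ring_scope.
Local Open Scope complex_scope.
Variable R : realType.

(** Helly's theorem on the line: the supremum of the left endpoints lies in all the intervals. *)
Lemma interval_point (I : Type) (i0 : I) (a r : I -> R) :
  (forall i j, `|a i - a j| <= r i + r j) -> exists s, forall i, `|s - a i| <= r i.
Proof.
move=> ar; pose S : set R := fun x => exists i, x = a i - r i.
have ub j : ubound S (a j + r j).
  move=> _ [i ->]; have := ar i j; rewrite ler_norml => /andP[_ h]; lra.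
have hS : has_sup S by split; [exists (a i0 - r i0), i0|exists (a i0 + r i0)].
exists (sup S) => i; rewrite ler_norml; apply/andP; split.
  have : a i - r i <= sup S by apply: ub_le_sup; [exact: (proj2 hS)|exists i].
  by lra.
have : sup S <= a i + r i by apply: ge_sup (ub i); exact: (proj1 hS).
by lra.
Qed.

(** Discs that meet pairwise may have no common point; treating real and imaginary parts separately
    costs the factor 2. As the index is arbitrary, this produces limits without sequences. *)
Lemma disc_point (I : Type) (i0 : I) (a : I -> R[i]) (r : I -> R) :
  (forall i j, nrm (a i - a j) <= r i + r j) ->
  exists s, forall i, nrm (s - a i) <= 2 * r i.
Proof.
move=> ar.
have [x hx] : exists x, forall i, `|x - complex.Re (a i)| <= r i.
  apply: (interval_point i0) => i j; rewrite -ReB.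
  exact: le_trans (Re_le_nrm _) (ar i j).
have [y hy] : exists x, forall i, `|x - complex.Im (a i)| <= r i.
  apply: (interval_point i0) => i j; rewrite -ImB.
  exact: le_trans (Im_le_nrm _) (ar i j).
exists (x +i* y) => i; apply: (le_trans (nrm_le_ReIm _)).
rewrite ReB ImB /=; have := hx i; have := hy i; lra.
Qed.
End Intervals.

Section RKHS.
Local Open Scope ring_scope.
Local Open Scope complex_scope.
Variables (R : realType) (X : Type) (K : X -> X -> R[i]).
Hypothesis pK : psd K.
Implicit Types (f g : X -> R[i]) (u v : seq (R[i] * X)).

Definition ksq v : R := complex.Re (kform K v v).
Definition klen v : R := Num.sqrt (ksq v).

Lemma ksqE v : (ksq v)%:C = kform K v v.
Proof. by rewrite RRe_real // ger0_real. Qed.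

Lemma ksq_ge0 v : 0 <= ksq v.
Proof. by rewrite -ler0c ksqE. Qed.

Lemma klen_ge0 v : 0 <= klen v. Proof. exact: sqrtr_ge0. Qed.

Lemma klen_sq v : klen v ^+ 2 = ksq v.
Proof. by rewrite sqr_sqrtr // ksq_ge0. Qed.

Lemma ksq_scale a v : ksq (kscale a v) = nrm a ^+ 2 * ksq v.
Proof.
apply: (@complexI R); rewrite ksqE kform_scalel kform_scaler mulrA mulJ_nrm -ksqE.
by rewrite [RHS]rmorphM.
Qed.

Lemma ksq_cat u v : ksq (u ++ v) = ksq u + ksq v + 2 * complex.Re (kform K u v).
Proof.
rewrite /ksq kform_catl !kform_catr (kform_herm v u pK) !ReD ReJ; ring.
Qed.

Lemma kform_le u v : nrm (kform K u v) <= klen u * klen v.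
Proof.
rewrite -(@ler_pXn2r _ 2) ?nnegrE ?mulr_ge0 ?nrm_ge0 ?klen_ge0 //.
rewrite exprMn !klen_sq -lecR rmorphXn rmorphM /= nrmE !ksqE.
exact: kform_CS.
Qed.

(* The norm of the reproducing kernel Hilbert space of [K] is the least bound [b],
   see [rk_norm_bound] and [rk_norm_le]. *)
Definition rk_bound f (b : R) := 0 <= b /\ forall v, nrm (keval f v) <= b * klen v.

Lemma rk_boundW f b b' : b <= b' -> rk_bound f b -> rk_bound f b'.
Proof.
move=> bb [b0 fb]; split=> [|v]; first exact: le_trans bb.
by apply: le_trans (fb v) _; rewrite ler_wpM2r ?klen_ge0.
Qed.

Lemma rk_bound_lin f g a b c : rk_bound f b -> rk_bound g c ->
  rk_bound (fun x => a * f x + g x) (nrm a * b + c).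
Proof.
move=> [b0 fb] [c0 gc]; split=> [|v]; first by rewrite addr_ge0 ?mulr_ge0 ?nrm_ge0.
rewrite keval_lin; apply: (le_trans (nrmD _ _)); rewrite nrmM mulrDl -mulrA.
by rewrite lerD // ler_wpM2l ?nrm_ge0.
Qed.

Lemma rk_bound_comb u : rk_bound (kcomb K u) (klen u).
Proof. by split=> [|v]; [exact: klen_ge0|exact: kform_le]. Qed.

Lemma rk_bound0 : rk_bound (fun=> 0) 0.
Proof.
split=> // v; rewrite mul0r (_ : keval _ v = 0) ?nrm0 //.
by rewrite /keval big1 // => q _; rewrite mulr0.
Qed.

(** Completing the square, 2 Re f(v) - |v|^2 = |f|^2 - |f - v|^2 in the space to be built, so the
    supremum is the squared norm and near-maximizers are good approximants. *)
Definition rk_test f : set R := range (fun v => 2 * complex.Re (keval f v) - ksq v).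

Lemma rk_bound_test f b : rk_bound f b -> ubound (rk_test f) (b ^+ 2).
Proof.
move=> [b0 fb] _ [v _ <-]; have := fb v; have := klen_sq v; have := klen_ge0 v.
have := le_trans (ler_norm _) (Re_le_nrm (keval f v)).
move: (complex.Re _) (nrm _) (klen v) (ksq v) => r m l q rm l0 <- ml.
have := sqr_ge0 (b - l); have := le_trans rm ml; rewrite !expr2; lra.
Qed.

Definition rk_norm f : R := Num.sqrt (sup (rk_test f)).

Lemma rk_test_sup f b : rk_bound f b -> has_sup (rk_test f).
Proof.
move=> fb; split; first by exists (2 * complex.Re (keval f [::]) - ksq [::]), [::].
by exists (b ^+ 2); exact: rk_bound_test.
Qed.

Lemma rk_test_ge0 f b : rk_bound f b -> 0 <= sup (rk_test f).
Proof.
move=> fb; apply: ub_le_sup; first exact: (proj2 (rk_test_sup fb)).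
by exists [::] => //; rewrite /ksq kformE /keval !big_nil /= mulr0 subr0.
Qed.

Lemma rk_norm_ge0 f : 0 <= rk_norm f. Proof. exact: sqrtr_ge0. Qed.

Lemma rk_norm_le f b : rk_bound f b -> rk_norm f <= b.
Proof.
move=> fb; have b0 := fb.1; rewrite -(@ler_pXn2r _ 2) ?nnegrE ?rk_norm_ge0 //.
rewrite sqr_sqrtr ?(rk_test_ge0 fb) //; apply: ge_sup (rk_bound_test fb).
exact: (proj1 (rk_test_sup fb)).
Qed.

Lemma rk_norm_test f b v : rk_bound f b ->
  2 * complex.Re (keval f v) - ksq v <= rk_norm f ^+ 2.
Proof.
move=> fb; rewrite sqr_sqrtr ?(rk_test_ge0 fb) //; apply: ub_le_sup; last by exists v.
exact: (proj2 (rk_test_sup fb)).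
Qed.

Lemma rk_norm_bound f b : rk_bound f b -> rk_bound f (rk_norm f).
Proof.
move=> fb; split=> [|v]; first exact: rk_norm_ge0.
set m := nrm (keval f v); set N := rk_norm f.
have m0 : 0 <= m := nrm_ge0 _.
have h (t : R) : 2 * t * m ^+ 2 - t ^+ 2 * m ^+ 2 * ksq v <= N ^+ 2.
  (* The factor [keval f v] aligns the phase, so that the test value becomes a real quadratic
     polynomial in [t]. *)
  have := rk_norm_test (kscale (t%:C * keval f v) v) fb; rewrite -/N.
  rewrite keval_scale ksq_scale nrmM nrm_real exprMn real_normK ?num_real // -/m.
  rewrite rmorphM /= (CrealP _) ?complex_real //.
  rewrite -mulrA [_^* * _]mulrC mulJ_nrm -rmorphM /= -/m.
  by rewrite mulrA.
have [m1|m1] := eqVneq m 0; first by rewrite m1 mulr_ge0 ?rk_norm_ge0 ?klen_ge0.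
have mp : 0 < m ^+ 2 by rewrite exprn_gt0 // lt_def m1.
have [q0|q0] := eqVneq (ksq v) 0.
  (* The polynomial is linear here and would take the value [N ^+ 2 + 1], above its bound. *)
  have := h ((N ^+ 2 + 1) / (2 * m ^+ 2)); rewrite q0 mulr0 subr0.
  have -> : 2 * ((N ^+ 2 + 1) / (2 * m ^+ 2)) * m ^+ 2 = N ^+ 2 + 1.
    by field.
  by rewrite gerDl ler10.
have qp : 0 < ksq v by rewrite lt_def q0 ksq_ge0.
have := h (ksq v)^-1.
have -> : 2 * (ksq v)^-1 * m ^+ 2 - (ksq v)^-1 ^+ 2 * m ^+ 2 * ksq v = m ^+ 2 / ksq v.
  by field.
rewrite ler_pdivrMr // -klen_sq -exprMn ler_pXn2r ?nnegrE ?mulr_ge0 ?rk_norm_ge0 //.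
exact: klen_ge0.
Qed.

(** Density of the combinations of kernel functions: a [u] maximizing the test values up to [e ^+ 2]
    is at distance at most [e] from [f]. *)
Lemma rk_bound_approx f b (e : R) : rk_bound f b -> 0 < e ->
  exists u, rk_bound (fun x => f x - kcomb K u x) e.
Proof.
move=> fb e0; have [_ [u _ <-] hu] := sup_adherent (exprn_gt0 2 e0) (rk_test_sup fb).
exists u; have gb : rk_bound (fun x => f x - kcomb K u x) (klen u + b).
  have := rk_bound_lin (-1) (rk_bound_comb u) fb.
  rewrite nrmN /nrm normr1 mul1r; congr (rk_bound _ _); apply/funext => x; ring.
apply: rk_boundW (rk_norm_bound gb).
rewrite -(@ler_pXn2r _ 2) ?nnegrE ?rk_norm_ge0 ?(ltW e0) //.
rewrite sqr_sqrtr ?(rk_test_ge0 gb) //; apply: ge_sup; first exact: (proj1 (rk_test_sup gb)).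
move=> _ [v _ <-].
have -> : keval (fun x => f x - kcomb K u x) v = keval f v - kform K u v.
  rewrite -[kform K u v]mul1r -mulNr addrC -keval_lin; apply: keval_ext => x; ring.
(* The test value of [u ++ v] is that of [u] for [f] plus that of [v] for [f - kcomb K u]; the
   former is within [e ^+ 2] of the supremum. *)
have := rk_norm_test (u ++ v) fb; rewrite sqr_sqrtr ?(rk_test_ge0 fb) //.
by rewrite keval_cat ksq_cat ReD ReB; lra.
Qed.

Definition rk_pred : {pred X -> R[i]} := fun f => `[< exists b, rk_bound f b >].

Lemma rk_predP f : reflect (exists b, rk_bound f b) (f \in rk_pred).
Proof. exact: asboolP. Qed.

Fact rk_pred_submod : submod_closed rk_pred.
Proof.
split; first by apply/rk_predP; exists 0; exact: rk_bound0.
move=> a f g /rk_predP[b fb] /rk_predP[c gc]; apply/rk_predP.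
by exists (nrm a * b + c); exact: rk_bound_lin.
Qed.
HB.instance Definition _ := GRing.isSubmodClosed.Build R[i] _ rk_pred rk_pred_submod.
End RKHS.

Section RKHSpace.
Local Open Scope ring_scope.
Local Open Scope complex_scope.
Variables (R : realType) (X : Type) (K : X -> X -> R[i]) (pK : psd K).

(** The positivity proof is a parameter of the type because the normed structure attached to the
    type depends on it. *)
Record rkhs (p : psd K) := RKHS { rkfun : X -> R[i]; _ : rkfun \in rk_pred K }.

HB.instance Definition _ := [isSub for @rkfun pK].
HB.instance Definition _ := [Choice of rkhs pK by <:].
HB.instance Definition _ := [SubChoice_isSubLmodule of rkhs pK by <:].

Local Notation H := (rkhs pK).
Implicit Types (f g h : H) (u v : seq (R[i] * X)).

Lemma rkfunP f : rk_bound K (rkfun f) (rk_norm K (rkfun f)).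
Proof. by case: f => f /= /rk_predP[b]; exact: rk_norm_bound. Qed.

Definition rknorm f : R := rk_norm K (rkfun f).

Lemma rknorm_ge0 f : 0 <= rknorm f. Proof. exact: rk_norm_ge0. Qed.

Lemma keval_rknorm f v : nrm (keval (rkfun f) v) <= rknorm f * klen K v.
Proof. exact: (rkfunP f).2. Qed.

Lemma rkfun_norm f x : nrm (rkfun f x) <= rknorm f * klen K [:: (1, x)].
Proof. by have := keval_rknorm f [:: (1, x)]; rewrite keval1 conjC1 mul1r. Qed.

Lemma rknorm_le f (b : R) : rk_bound K (rkfun f) b -> rknorm f <= b.
Proof. exact: rk_norm_le. Qed.

Lemma rkfunD f g x : rkfun (f + g) x = rkfun f x + rkfun g x.
Proof. by []. Qed.

Lemma rkfunB f g x : rkfun (f - g) x = rkfun f x - rkfun g x.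
Proof. by []. Qed.

Lemma rkfunZ a f x : rkfun (a *: f) x = a * rkfun f x.
Proof. by []. Qed.

Lemma rkfun_ext f g : rkfun f =1 rkfun g -> f = g.
Proof. by move=> fg; apply: val_inj; apply/funext. Qed.

Lemma rknormD f g : rknorm (f + g) <= rknorm f + rknorm g.
Proof.
apply: rknorm_le; have := rk_bound_lin 1 (rkfunP f) (rkfunP g).
rewrite /nrm normr1 mul1r; congr (rk_bound K _ _).
by apply/funext => x; rewrite mul1r.
Qed.

Lemma rknormZ_le a f : rknorm (a *: f) <= nrm a * rknorm f.
Proof.
apply: rknorm_le; have := rk_bound_lin a (rkfunP f) (rk_bound0 K).
rewrite addr0; congr (rk_bound K _ _).
by apply/funext => x; rewrite addr0.
Qed.

Lemma rknormZ a f : rknorm (a *: f) = nrm a * rknorm f.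
Proof.
apply/le_anti; rewrite rknormZ_le /=.
have [->|a0] := eqVneq a 0; first by rewrite nrm0 mul0r rknorm_ge0.
have na : 0 < nrm a.
  by rewrite lt_def nrm_ge0 andbT; apply: contra a0 => /eqP/nrm0_eq0 ->.
rewrite -ler_pdivlMl // -{1}[f]scale1r -(mulVf a0) -scalerA.
apply: (le_trans (rknormZ_le _ _)); rewrite ler_wpM2r ?rknorm_ge0 //.
have : nrm a^-1 * nrm a = 1 by rewrite -nrmM mulVf // /nrm normr1.
by move/(canRL (mulfK (lt0r_neq0 na))) ->; rewrite mul1r.
Qed.

Lemma rknorm0_eq0 f : rknorm f = 0 -> f = 0.
Proof.
move=> f0; apply: rkfun_ext => x; apply: nrm0_eq0; apply/le_anti.
by rewrite nrm_ge0 andbT; have := rkfun_norm f x; rewrite f0 mul0r.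
Qed.

Fact rk_ler_normD f g : (rknorm (f + g))%:C <= (rknorm f)%:C + (rknorm g)%:C.
Proof. by rewrite -rmorphD lecR rknormD. Qed.

Fact rk_normrZ (a : R[i]) f : (rknorm (a *: f))%:C = `|a| * (rknorm f)%:C.
Proof. by rewrite rknormZ rmorphM /= nrmE. Qed.

Fact rk_normr0_eq0 f : (rknorm f)%:C = 0 -> f = 0.
Proof. by move=> /(@complexI R); exact: rknorm0_eq0. Qed.

HB.instance Definition _ :=
  Lmodule_isNormed.Build R[i] H rk_ler_normD rk_normrZ rk_normr0_eq0.

Lemma rk_normE f : `|f| = (rknorm f)%:C.
Proof. by []. Qed.

Lemma rknormN f : rknorm (- f) = rknorm f.
Proof. by apply: (@complexI R); exact: (@normrN _ H f). Qed.

Lemma rknormB f g : rknorm (f - g) <= rknorm f + rknorm g.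
Proof. by rewrite -(rknormN g) rknormD. Qed.

Lemma rknorm_distC f g : rknorm (f - g) = rknorm (g - f).
Proof. by rewrite -rknormN opprB. Qed.

(** Completeness in terms of error radii. Point evaluations are bounded, so a pointwise limit exists
    by [disc_point]; it is then shown to be a limit in norm. *)
Lemma rk_limit (I : Type) (h : I -> H) (r : I -> R) :
    (forall e : R, 0 < e -> exists i, r i <= e) ->
    (forall i j, rknorm (h i - h j) <= r i + r j) ->
  exists f : H, forall i, rknorm (f - h i) <= r i.
Proof.
move=> r0 hr; have [i0 _] := r0 1 ltr01.
pose c x : R := klen K [:: (1, x)].
have c0 x : 0 <= c x by exact: klen_ge0.
have [f0 hf0] : exists f0 : X -> R[i], forall x i,
    nrm (f0 x - rkfun (h i) x) <= 2 * (r i * c x).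
  suff /boolp.choice[f0 hf0] : forall x, exists z, forall i,
    nrm (z - rkfun (h i) x) <= 2 * (r i * c x) by exists f0.
  move=> x; apply: (disc_point i0) => i j; rewrite -mulrDl -rkfunB.
  by apply: (le_trans (rkfun_norm _ _)); rewrite ler_wpM2r ?klen_ge0.
have rge0 i : 0 <= r i.
  have [j rj] := r0 _ (@ltr01 R).
  apply/ler_addgt0Pl => e e0; have [{rj}j rj] := r0 e e0.
  by apply: le_trans (rknorm_ge0 _) (le_trans (hr i j) _); rewrite addrC lerD2r.
have fb i : rk_bound K (fun x => f0 x - rkfun (h i) x) (r i).
  split=> // v; pose M : R := \sum_(q <- v) nrm q.1 * (2 * c q.2).
  have M0 : 0 <= M by apply: sumr_ge0 => q _; rewrite mulr_ge0 ?nrm_ge0 ?mulr_ge0.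
  have ev j : nrm (keval (fun x => f0 x - rkfun (h j) x) v) <= r j * M.
    rewrite /keval /M mulr_sumr; elim: (v) => [|q w IH].
      by rewrite !big_nil nrm0.
    rewrite !big_cons; apply: (le_trans (nrmD _ _)); apply: lerD => //.
    rewrite nrmM nrmJ mulrCA ler_wpM2l ?nrm_ge0 //.
    by apply: (le_trans (hf0 _ _)); rewrite mulrCA.
  (* The pointwise bounds carry a constant depending on [v]; going through some [h j] with [r j]
     tiny removes it and leaves [r i]. *)
  apply/ler_addgt0Pl => e e0.
  have d0 : 0 < e / (M + klen K v + 1) by rewrite divr_gt0 // ltr_wpDl // addr_ge0 // klen_ge0.
  have [j rj] := r0 _ d0.
  have -> : keval (fun x => f0 x - rkfun (h i) x) v =
      keval (fun x => f0 x - rkfun (h j) x) v + keval (rkfun (h j - h i)) v.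
    rewrite -[X in X + _]mul1r -keval_lin; apply: keval_ext => x.
    by rewrite rkfunB; ring.
  apply: (le_trans (nrmD _ _)).
  apply: (@le_trans _ _ (r j * M + (r j + r i) * klen K v)).
    apply: lerD => //; apply: (le_trans (keval_rknorm _ _)).
    by rewrite ler_wpM2r ?klen_ge0.
  rewrite mulrDl addrA lerD2r -mulrDr.
  apply: (@le_trans _ _ (r j * (M + klen K v + 1))).
    by rewrite ler_wpM2l // lerDl.
  by rewrite -ler_pdivlMr // ltr_wpDl // addr_ge0 // klen_ge0.
have pf : f0 \in rk_pred K.
  apply/rk_predP; have := rk_bound_lin 1 (fb i0) (rkfunP (h i0)).
  rewrite (_ : (fun _ => _) = f0); first by exists (nrm 1 * r i0 + rk_norm K (rkfun (h i0))).
  by apply/funext => x; ring.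
by exists (RKHS pK pf) => i; apply: rknorm_le; exact: fb.
Qed.

Lemma rk_ballE f g (e : R) : ball f e%:C g <-> rknorm (f - g) < e.
Proof.
rewrite -ball_normE /ball_ /= -[X in X <-> _]/(is_true ((rknorm (f - g))%:C < e%:C)).
by rewrite ltcR.
Qed.

Fact rk_complete (F : set_system H) : ProperFilter F -> cauchy F -> cvg F.
Proof.
move=> FF /cauchyP Fc.
(* The family given to [rk_limit] is indexed by the radii themselves: [h e] is the centre of a ball
   of radius [e] belonging to [F]. *)
have Fe (e : {e : R | 0 < e}) : exists h : H, F (ball h (sval e)%:C).
  have e0 : 0 < (sval e)%:C by rewrite ltcR; exact: (svalP e).
  by have [h Fh] := Fc _ e0; exists h.
have [h Fh] := boolp.choice Fe.
have [f hf] : exists f : H, forall e, rknorm (f - h e) <= sval e.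
  apply: rk_limit => [e e0|e1 e2]; first by exists (exist _ e e0).
  have [g [/rk_ballE g1 /rk_ballE g2]] := filter_ex (filterI (Fh e1) (Fh e2)).
  rewrite -(subrKA g); apply: (le_trans (rknormD _ _)); apply: lerD; first exact: ltW.
  by rewrite rknorm_distC ltW.
apply/cvg_ex; exists f; apply/cvg_ballP => e e0.
have er : e = (complex.Re e)%:C by rewrite RRe_real // gtr0_real.
have e2 : 0 < complex.Re e / 2 by rewrite divr_gt0 // -ltcR -er.
pose d : {e : R | 0 < e} := exist (fun e : R => 0 < e) _ e2.
have := Fh d; apply: filterS => g /rk_ballE hg.
rewrite er; apply/rk_ballE.
rewrite -(subrKA (h d)); apply: (le_lt_trans (rknormD _ _)).
have := hf d; move: hg => /=; move: (rknorm _) (rknorm _) => a b; lra.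
Qed.

HB.instance Definition _ := Uniform_isComplete.Build H rk_complete.

Fact rkcomb_in u : kcomb K u \in rk_pred K.
Proof. by apply/rk_predP; exists (klen K u); exact: rk_bound_comb. Qed.

Definition rkcomb u : H := RKHS pK (rkcomb_in u).

Lemma rkcomb_norm u : rknorm (rkcomb u) = klen K u.
Proof.
apply/le_anti/andP; split; first by apply: rknorm_le; exact: rk_bound_comb.
have := keval_rknorm (rkcomb u) u; rewrite -[keval _ _]/(kform K u u).
rewrite -ksqE // nrm_real ger0_norm ?ksq_ge0 // -klen_sq // expr2.
have [->|u0] := eqVneq (klen K u) 0; first by rewrite rknorm_ge0.
by rewrite ler_pM2r // lt_def u0 klen_ge0.
Qed.

Lemma rk_approx f (e : R) : 0 < e -> exists u, rknorm (f - rkcomb u) <= e.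
Proof.
move=> e0; have [u hu] := rk_bound_approx pK (rkfunP f) e0.
by exists u; exact: rknorm_le.
Qed.

(* The inner product [<f, g>] is the limit of [<f, rkcomb u>], which is
   [keval f u], as [rkcomb u] tends to [g]. *)
Fact rkinner_ex f g : exists z, forall u,
  nrm (z - keval (rkfun f) u) <= 2 * (rknorm f * rknorm (g - rkcomb u)).
Proof.
apply: (disc_point [::]) => u v; rewrite -mulrDr.
have -> : keval (rkfun f) u - keval (rkfun f) v = keval (rkfun f) (u ++ kscale (-1) v).
  by rewrite keval_cat keval_scale (_ : (-1)^* = -1)%R ?mulN1r // rmorphN rmorph1.
apply: (le_trans (keval_rknorm _ _)); rewrite ler_wpM2l ?rknorm_ge0 //.
rewrite -rkcomb_norm.
have -> : rkcomb (u ++ kscale (-1) v) = (g - rkcomb v) - (g - rkcomb u).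
  apply: rkfun_ext => x; rewrite !rkfunB /= kcomb_cat kcomb_scale; ring.
by rewrite [X in _ <= X]addrC; exact: rknormB.
Qed.

Definition rkinner f g : R[i] := sval (boolp.cid (rkinner_ex f g)).

Lemma rkinner_approx f g u :
  nrm (rkinner f g - keval (rkfun f) u) <= 2 * (rknorm f * rknorm (g - rkcomb u)).
Proof. exact: (svalP (boolp.cid (rkinner_ex f g))). Qed.

Lemma rkinner_comb f u : rkinner f (rkcomb u) = keval (rkfun f) u.
Proof.
apply/eqP; rewrite -subr_eq0; apply/eqP/nrm0_eq0/le_anti; rewrite nrm_ge0 andbT.
apply: (le_trans (rkinner_approx _ _ u)).
have -> : rkcomb u - rkcomb u = 0 :> H by rewrite subrr.
suff -> : rknorm 0 = 0 by rewrite !mulr0.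
by apply: (@complexI R); rewrite -rk_normE normr0.
Qed.

Lemma rkinner_linear g a f f' :
  rkinner (a *: f + f') g = a * rkinner f g + rkinner f' g.
Proof.
apply/eqP; rewrite -subr_eq0; apply/eqP.
apply: (@small_eq0 _ _ (2 * rknorm (a *: f + f') + 2 * nrm a * rknorm f + 2 * rknorm f')).
move=> e e0 _; have [u hu] := rk_approx g e0.
have -> : rkinner (a *: f + f') g - (a * rkinner f g + rkinner f' g) =
   (rkinner (a *: f + f') g - keval (rkfun (a *: f + f')) u)
    - (a * (rkinner f g - keval (rkfun f) u) + (rkinner f' g - keval (rkfun f') u)).
  have -> : keval (rkfun (a *: f + f')) u = a * keval (rkfun f) u + keval (rkfun f') u.
    exact: keval_lin.
  move: (rkinner (a *: f + f') g) (rkinner f g) (rkinner f' g) => A B D.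
  by move: (keval _ u) (keval _ u) => E F; ring.
apply: (le_trans (nrmB _ _)); rewrite [leRHS]mulrDl [X in _ <= X + _]mulrDl -addrA; apply: lerD.
  apply: (le_trans (rkinner_approx _ _ _)).
  by rewrite -mulrA ler_pM2l // ler_wpM2l ?rknorm_ge0.
apply: (le_trans (nrmD _ _)); apply: lerD.
  rewrite nrmM -!mulrA mulrCA ler_wpM2l ?nrm_ge0 //.
  apply: (le_trans (rkinner_approx _ _ _)).
  by rewrite ler_pM2l // ler_wpM2l ?rknorm_ge0.
apply: (le_trans (rkinner_approx _ _ _)).
by rewrite -mulrA ler_pM2l // ler_wpM2l ?rknorm_ge0.
Qed.

Lemma klen_approx g u (e : R) : rknorm (g - rkcomb u) <= e -> klen K u <= rknorm g + e.
Proof.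
move=> hu; rewrite -rkcomb_norm -[rkcomb u](subKr g).
by apply: (le_trans (rknormB _ _)); rewrite lerD2l.
Qed.

(** With both arguments approximated, identities for the inner product reduce to those of [kform],
    up to an error linear in [e]. *)
Lemma rkinner_approx2 f g w u (e : R) : e <= 1 ->
    rknorm (f - rkcomb w) <= e -> rknorm (g - rkcomb u) <= e ->
  nrm (rkinner f g - kform K w u) <= (2 * rknorm f + rknorm g + 1) * e.
Proof.
move=> e1 hw hu; have e0 := le_trans (rknorm_ge0 _) hw.
have -> : rkinner f g - kform K w u =
    (rkinner f g - keval (rkfun f) u) + keval (rkfun (f - rkcomb w)) u.
  have -> : keval (rkfun (f - rkcomb w)) u = keval (rkfun f) u - kform K w u.
    transitivity (-1 * keval (kcomb K w) u + keval (rkfun f) u).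
      by rewrite -keval_lin; apply: keval_ext => x; rewrite mulN1r addrC.
    by rewrite mulN1r addrC.
  by rewrite addrA subrK.
apply: (le_trans (nrmD _ _)); rewrite -addrA [in leRHS]mulrDl; apply: lerD.
  apply: (le_trans (rkinner_approx _ _ _)).
  by rewrite -mulrA ler_pM2l // ler_wpM2l ?rknorm_ge0.
apply: (le_trans (keval_rknorm _ _)); rewrite mulrC.
apply: ler_pM; [exact: klen_ge0|exact: rknorm_ge0| |exact: hw].
by apply: (le_trans (klen_approx hu)); rewrite lerD2l.
Qed.

Lemma rkinnerC f g : rkinner f g = (rkinner g f)^*%R.
Proof.
apply/eqP; rewrite -subr_eq0; apply/eqP.
apply: (@small_eq0 _ _ ((2 * rknorm f + rknorm g + 1) + (2 * rknorm g + rknorm f + 1))).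
move=> e e0 e1; have [u hu] := rk_approx g e0; have [w hw] := rk_approx f e0.
have -> : rkinner f g - (rkinner g f)^*%R =
   (rkinner f g - kform K w u) - (rkinner g f - kform K u w)^*%R.
  by rewrite rmorphB /= -(kform_herm w u pK); ring.
apply: (le_trans (nrmB _ _)); rewrite nrmJ mulrDl.
by apply: lerD; exact: rkinner_approx2.
Qed.

Lemma rkinner_sq f : rkinner f f = (rknorm f ^+ 2)%:C.
Proof.
apply/eqP; rewrite -subr_eq0; apply/eqP.
apply: (@small_eq0 _ _ ((2 * rknorm f + rknorm f + 1) + (2 * rknorm f + 1))).
move=> e e0 e1; have [u hu] := rk_approx f e0.
have -> : rkinner f f - (rknorm f ^+ 2)%:C =
   (rkinner f f - kform K u u) + (klen K u ^+ 2 - rknorm f ^+ 2)%:C.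
  by rewrite klen_sq // rmorphB /= ksqE //; ring.
apply: (le_trans (nrmD _ _)); rewrite [leRHS]mulrDl; apply: lerD.
  exact: rkinner_approx2.
rewrite nrm_real subr_sqr normrM mulrC.
have h1 := klen_approx hu.
have h2 : rknorm f <= klen K u + e.
  rewrite -{1}[f](subrK (rkcomb u)) -rkcomb_norm.
  by apply: (le_trans (rknormD _ _)); rewrite [leRHS]addrC lerD2r.
have := rknorm_ge0 f; have := klen_ge0 K u; move: h1 h2.
move: (rknorm f) (klen K u) => p q h1 h2 q0 p0; apply: ler_pM => //.
  by rewrite ger0_norm ?addr_ge0 //; lra.
by rewrite ler_norml; lra.
Qed.

Fact rkinner_bilinear : bilinear_for *%R (Num.conj \; *%R) rkinner.
Proof.
split=> [g a f f'|f a g g'] /=; first exact: rkinner_linear.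
by rewrite rkinnerC rkinner_linear rmorphD rmorphM (rkinnerC f g) (rkinnerC f g').
Qed.
HB.instance Definition _ :=
  @bilinear_isBilinear.Build R[i] H H R[i] *%R (Num.conj \; *%R) rkinner rkinner_bilinear.

Fact rkinner_hermitian f g : rkinner f g = (-1) ^+ false * Num.conj (rkinner g f).
Proof. by rewrite expr0 mul1r -rkinnerC. Qed.
HB.instance Definition _ :=
  @isHermitianSesquilinear.Build R[i] H false Num.conj rkinner rkinner_hermitian.

Fact rkinner_pos f : f != 0 -> 0 < rkinner f f.
Proof.
move=> f0; rewrite rkinner_sq ltcR exprn_gt0 // lt_def rknorm_ge0 andbT.
by apply: contra f0 => /eqP/rknorm0_eq0 ->.
Qed.
HB.instance Definition _ := @isDotProduct.Build R[i] H rkinner rkinner_pos.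

Fact rkinner_norm f : `|f| ^+ 2 = rkinner f f.
Proof. by rewrite rkinner_sq rk_normE rmorphXn. Qed.

Definition rkhilbert : hilbert R := @Hilbert R H rkinner rkinner_norm.

End RKHSpace.

(** * The GNS construction for groupoids *)

Section PartialMaps.
Local Open Scope ring_scope.
Local Open Scope complex_scope.
Variables (R : realType) (X : Type) (K : X -> X -> R[i]) (pK : psd K).
Variable s : X -> option X.
Hypothesis sK : forall x y x' y', s x = Some x' -> s y = Some y' -> K x' y' = K x y.
Hypothesis s0 : forall x y y', s x = None -> s y = Some y' -> K x y = 0.

(** The intended [s] is left translation by the inverse of an arrow, undefined on arrows with
    another target. [rkpush] is the transpose of [rkpull]. *)
Definition rkpull (f : X -> R[i]) x := oapp f 0 (s x).

Definition rkpush (v : seq (R[i] * X)) :=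
  pmap (fun p => omap (pair p.1) (s p.2)) v.

Lemma keval_pull f v : keval (rkpull f) v = keval f (rkpush v).
Proof.
elim: v => [|p v IH]; first by rewrite /keval !big_nil.
rewrite -cat1s keval_cat IH -[rkpush (_ ++ _)]/(oapp (cons^~ (rkpush v)) (rkpush v)
  (omap (pair p.1) (s p.2))) /keval big_seq1 /rkpull.
by case: (s p.2) => [x|] /=; rewrite ?mulr0 ?add0r // big_cons.
Qed.

Lemma kform_push v : kform K (rkpush v) (rkpush v) =
  kform K [seq p <- v | s p.2] [seq p <- v | s p.2].
Proof.
have E : exists w : seq ((R[i] * X) * X),
    [/\ rkpush v = [seq (p.1.1, p.2) | p <- w], [seq p <- v | s p.2] = [seq p.1 | p <- w] &
      forall i p0, (i < size w)%N -> s (nth p0 w i).1.2 = Some (nth p0 w i).2].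
  elim: v => [|p v [w [w1 w2 w3]]]; first by exists [::].
  rewrite /rkpush /=; case sp: (s p.2) => [x|] /=; last by exists w.
  exists ((p, x) :: w); split; rewrite /= -?w1 -?w2 //.
  by case=> [|i] p0 //= ltiw; rewrite w3.
case: E => w [-> -> ws]; rewrite !kformE !big_map.
case: w ws => [|p0 w'] ws; first by rewrite !big_nil.
move: (p0 :: w') ws => w ws; rewrite !(big_nth p0) !big_mkord; apply: eq_bigr => i _.
rewrite !big_map !(big_nth p0) !big_mkord; apply: eq_bigr => j _ /=.
by congr (_ * _); apply: sK; rewrite ws.
Qed.

(** The parts of [v] where [s] is defined and undefined are orthogonal by [s0]; the push keeps the
    length of the first and drops the second. *)
Lemma ksq_push v : ksq K (rkpush v) <= ksq K v.
Proof.
rewrite -lecR !ksqE // kform_push.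
have z w q : kform K [seq p <- w | ~~ s p.2] [seq p <- q | s p.2] = 0.
  rewrite kformE big_filter big1 // => r Pr; rewrite big_filter big1 // => t Pt.
  case sr: (s r.2) Pr => [|] //; case st: (s t.2) Pt => [y'|] // _ _.
  by rewrite (s0 sr st) mulr0.
have z' : kform K [seq p <- v | s p.2] [seq p <- v | ~~ s p.2] = 0.
  by rewrite (kform_herm _ _ pK) z conjC0.
by rewrite (kform_split (fun x => s x : bool) K v v) z' addr0 z add0r lerDl pK.
Qed.

Lemma klen_push v : klen K (rkpush v) <= klen K v.
Proof. by rewrite ler_wsqrtr // ksq_push. Qed.

Lemma rkpull_bound f b : rk_bound K f b -> rk_bound K (rkpull f) b.
Proof.
move=> [b0 fb]; split=> // v; rewrite keval_pull; apply: (le_trans (fb _)).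
by rewrite ler_wpM2l // klen_push.
Qed.

Fact rkop_in (f : rkhs pK) : rkpull (rkfun f) \in rk_pred K.
Proof. by apply/rk_predP; exists (rknorm f); exact/rkpull_bound/rkfunP. Qed.

Definition rkop (f : rkhs pK) : rkhs pK := RKHS pK (rkop_in f).

Fact rkop_linear : linear rkop.
Proof.
move=> a f g; apply: rkfun_ext => x; rewrite rkfunD rkfunZ /= /rkpull.
by case: (s x) => [y|] //=; rewrite mulr0 add0r.
Qed.
HB.instance Definition _ :=
  @GRing.isLinear.Build R[i] (rkhs pK) (rkhs pK) *:%R rkop rkop_linear.

Lemma rkop_contr f : rknorm (rkop f) <= rknorm f.
Proof. by apply: rknorm_le; exact/rkpull_bound/rkfunP. Qed.

Lemma rkop_continuous : continuous rkop.
Proof.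
move=> f; apply/(@cvg_ballP _ _ _ _ (nbhs_filter f)) => e e0.
have er : e = (complex.Re e)%:C by rewrite RRe_real // gtr0_real.
apply/nbhs_ballP; exists e => //= g; rewrite er => /rk_ballE fg; apply/rk_ballE.
by rewrite -(linearB rkop); apply: (le_lt_trans (rkop_contr _)).
Qed.

End PartialMaps.

Section GNS.
Local Open Scope ring_scope.
Local Open Scope complex_scope.
Variables (R : realType) (G : groupoid) (phi : arrow G -> R[i]).

Definition arr (a b : ob G) (g : hom a b) : arrow G :=
  existT (fun ab : ob G * ob G => hom ab.1 ab.2) (a, b) g.

Definition into (a : ob G) := {b : ob G & hom b a}.

Definition fiber_kernel a (x y : into a) : R[i] :=
  phi (arr (ccomp G (ginv (tagged y)) (tagged x))).

Hypothesis pphi : forall a, psd (@fiber_kernel a).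

Definition allinto := {a : ob G & into a}.
Definition Into a (x : into a) : allinto := existT into a x.

Definition total_kernel (x y : allinto) : R[i] :=
  if pselect (tag x = tag y) is left e then
    fiber_kernel (eq_rect (tag x) into (tagged x) (tag y) e) (tagged y) else 0.

Lemma total_kernelE a (x y : into a) : total_kernel (Into x) (Into y) = fiber_kernel x y.
Proof.
rewrite /total_kernel; case: pselect => [e|/(_ erefl)//].
by rewrite (Prop_irrelevance e erefl).
Qed.

Lemma total_kernel0 x y : tag x <> tag y -> total_kernel x y = 0.
Proof. by rewrite /total_kernel; case: pselect. Qed.

Lemma psd_total : psd total_kernel.
Proof.
apply: (@psd_blocks _ _ (fun x y => `[< tag x = tag y >])).
- by move=> x; apply/asboolP.
- by move=> x y z /asboolP exy /asboolP exz; apply/asboolP; rewrite -exy.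
- by move=> x y /asboolP exy; exact: total_kernel0.
move=> [a x0] v; have : exists w : seq (R[i] * into a),
    [seq p <- v | `[< a = tag p.2 >]] = [seq (p.1, Into p.2) | p <- w].
  elim: v => [|[c [b y]] v [w wE]]; first by exists [::].
  rewrite /=; case: asboolP => [/= e|_]; last by exists w.
  by subst b; exists ((c, y) :: w); rewrite /= wE.
move=> [w ->]; have := pphi w; congr (0 <= _); rewrite !kformE !big_map.
apply: eq_bigr => p _; rewrite big_map; apply: eq_bigr => q _ /=.
by rewrite total_kernelE.
Qed.

Definition lact (a b : ob G) (u : hom a b) (x : into a) : into b :=
  existT (fun c => hom c b) (tag x) (ccomp G u (tagged x)).

Lemma lact_comp a b c (u : hom b c) (v : hom a b) x :
  lact (ccomp G u v) x = lact u (lact v x).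
Proof. by rewrite /lact /= ccompA. Qed.

Lemma lact_id a x : lact (cid G a) x = x.
Proof. by case: x => b g; rewrite /lact /= ccomp1f. Qed.

Lemma lactK a b (u : hom a b) x : lact (ginv u) (lact u x) = x.
Proof. by rewrite -lact_comp gcompVf lact_id. Qed.

Lemma lact_Vid (a : ob G) (x : into a) : lact (ginv (cid G a)) x = x.
Proof. by rewrite -[in LHS](lact_id x) lactK. Qed.

Lemma ginv_comp (a b c : ob G) (u : hom b c) (v : hom a b) :
  @ginv G _ _ (ccomp G u v) = ccomp G (ginv v) (ginv u).
Proof.
apply/esym/ginv_unique; rewrite -ccompA (ccompA G (ginv u)) gcompVf ccomp1f.
by rewrite gcompVf.
Qed.

Lemma ginvK (a b : ob G) (u : hom a b) : @ginv G _ _ (ginv u) = u.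
Proof. by apply/esym/ginv_unique; rewrite gcompfV. Qed.

Lemma fiber_kernel_lact a b (u : hom a b) x y :
  fiber_kernel (lact u x) (lact u y) = fiber_kernel x y.
Proof.
rewrite /fiber_kernel /= ginv_comp -ccompA (ccompA G (ginv u)) gcompVf.
by rewrite ccomp1f.
Qed.

Definition pull_back (a b : ob G) (u : hom a b) (x : allinto) : option allinto :=
  if pselect (tag x = b) is left e then
    Some (Into (lact (ginv u) (eq_rect (tag x) into (tagged x) b e))) else None.

Lemma pull_backE a b (u : hom a b) (x : into b) :
  pull_back u (Into x) = Some (Into (lact (ginv u) x)).
Proof.
rewrite /pull_back; case: pselect => [e|/(_ erefl)//].
by rewrite (Prop_irrelevance e erefl).
Qed.

Lemma pull_back0 a b (u : hom a b) x : tag x <> b -> pull_back u x = None.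
Proof. by rewrite /pull_back; case: pselect. Qed.

Lemma pull_backP a b (u : hom a b) x :
  (exists y : into b, x = Into y /\ pull_back u x = Some (Into (lact (ginv u) y))) \/
  (tag x <> b /\ pull_back u x = None).
Proof.
have [e|ne] := pselect (tag x = b); last by right; rewrite pull_back0.
case: x e => [c y] /= e; subst c; left; exists y; split => //; exact: pull_backE.
Qed.

Fact pull_backK a b (u : hom a b) x y x' y' :
  pull_back u x = Some x' -> pull_back u y = Some y' ->
  total_kernel x' y' = total_kernel x y.
Proof.
case: (pull_backP u x) => [[z [-> ->]]|[_ ->]] // [<-].
case: (pull_backP u y) => [[w [-> ->]]|[_ ->]] // [<-].
by rewrite !total_kernelE fiber_kernel_lact.
Qed.

Fact pull_back_orth a b (u : hom a b) x y y' :
  pull_back u x = None -> pull_back u y = Some y' -> total_kernel x y = 0.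
Proof.
case: (pull_backP u x) => [[z [-> ->]]|[nx ->]] // _.
by case: (pull_backP u y) => [[w [-> ->]]|[_ ->]] // _; exact: total_kernel0.
Qed.

Local Notation H := (rkhilbert psd_total).

Definition gop (a b : ob G) (u : hom a b) : {linear H -> H} :=
  @rkop R allinto total_kernel psd_total (pull_back u) (@pull_backK a b u)
    (@pull_back_orth a b u).

Definition gfiber a : set H := fun f => forall x, tag x <> a -> rkfun f x = 0.

Lemma gopE a b (u : hom a b) (f : H) (x : into b) :
  rkfun (gop u f) (Into x) = rkfun f (Into (lact (ginv u) x)).
Proof. by rewrite /= /rkpull pull_backE. Qed.

Lemma gop_fiber a b (u : hom a b) (f : H) : gfiber b (gop u f).
Proof. by move=> x nx; rewrite /= /rkpull pull_back0. Qed.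

Lemma gop_contr a b (u : hom a b) (f : H) : rknorm (gop u f) <= rknorm f.
Proof. exact: rkop_contr. Qed.

Lemma gfiber_ext a (f g : H) : gfiber a f -> gfiber a g ->
  (forall x : into a, rkfun f (Into x) = rkfun g (Into x)) -> f = g.
Proof.
move=> fa ga fg; apply: rkfun_ext => x.
have [e|ne] := pselect (tag x = a); last by rewrite fa ?ga.
by case: x e => c x /= e; subst c; exact: fg.
Qed.

Lemma gop_comp a b c (u : hom b c) (v : hom a b) (f : H) :
  gop (ccomp G u v) f = gop u (gop v f).
Proof.
apply: (gfiber_ext (@gop_fiber _ _ _ _) (@gop_fiber _ _ _ _)) => x.
by rewrite !gopE ginv_comp lact_comp.
Qed.

Lemma gop_id a (f : H) : gfiber a f -> gop (cid G a) f = f.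
Proof.
move=> fa; apply: (gfiber_ext (@gop_fiber _ _ _ _) fa) => x.
rewrite gopE -[in RHS](lact_id x); congr (rkfun f (Into (lact _ x))).
by apply/esym/ginv_unique; rewrite ccomp1f.
Qed.

Lemma rkinner_point (f : H) x : rkinner f (rkcomb psd_total [:: (1, x)]) = rkfun f x.
Proof. by rewrite rkinner_comb keval1 rmorph1 mul1r. Qed.

Lemma gfiber_point a (x : into a) : gfiber a (rkcomb psd_total [:: (1, Into x)]).
Proof.
move=> y ny; rewrite /= kcomb1 mul1r total_kernel0 //=.
by move=> e; apply: ny.
Qed.

Lemma gfiber_linear a (c : R[i]) (f g : H) :
  gfiber a f -> gfiber a g -> gfiber a (c *: f + g).
Proof.
move=> fa ga x nx; rewrite -[LHS]/(rkfun (c *: (f : rkhs psd_total) + g) x).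
by rewrite rkfunD rkfunZ fa // ga // mulr0 addr0.
Qed.

Lemma gfiber_closed a : closed (gfiber a).
Proof.
move=> f clf x nx; apply: (@small_eq0 _ _ (klen total_kernel [:: (1, x)])) => e e0 _.
have nb : nbhs f (ball f e%:C) by apply: nbhsx_ballx; rewrite ltcR.
have [g [ga /rk_ballE fg]] := clf _ nb.
rewrite -[rkfun f x]subr0 -(ga x nx) -rkfunB mulrC.
by apply: (le_trans (rkfun_norm _ _)); rewrite ler_wpM2r ?klen_ge0 // ltW.
Qed.

(** The identity of [b] acts as a contraction fixing [g]. Applied to an approximant of [g], it
    leaves a combination of arrows into [b], at which [f] vanishes. *)
Lemma gfiber_orth a b (f g : H) : a <> b -> gfiber a f -> gfiber b g -> rkinner f g = 0.
Proof.
move=> nab fa gb; apply: (@small_eq0 _ _ (2 * rknorm f)) => e e0 _.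
have [u hu] := rk_approx g e0; pose P := gop (cid G b).
pose w := rkpush (pull_back (cid G b)) u.
have ew : P (rkcomb psd_total u) = rkcomb psd_total w :> rkhs psd_total.
  apply: rkfun_ext => x; rewrite /= /rkpull.
  case: (pull_backP (cid G b) x) => [[z [-> ->]]|[nx ->]] /=.
    elim: (u) @w => [|[c [d y]] u' IH] /=; first by rewrite /kcomb !big_nil.
    rewrite /rkpush /=; case: (pull_backP (cid G b) (existT into d y)) => [[t [et ->]]|[nt ->]] /=.
      rewrite /kcomb !big_cons; rewrite /kcomb in IH; rewrite IH et !total_kernelE.
      by rewrite !lact_Vid.
    rewrite -IH /kcomb big_cons [X in _ * X]total_kernel0 /= ?mulr0 ?add0r //.
  elim: (u) @w => [|[c [d y]] u' IH] /=; first by rewrite /kcomb big_nil.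
  rewrite /rkpush /=; case: (pull_backP (cid G b) (existT into d y)) => [[t [et ->]]|[nt ->]] //=.
  rewrite /kcomb big_cons -[X in _ + X]IH [X in _ * X]total_kernel0 ?mulr0 ?addr0 //=.
  by move=> e'; apply: nx.
have hw : rknorm (g - rkcomb psd_total w) <= e.
  rewrite -ew -[in X in X - _](gop_id gb) -(linearB P).
  exact: le_trans (gop_contr _ _) hu.
have := rkinner_approx f g w; rewrite (_ : keval (rkfun f) w = 0) ?subr0.
  by move=> h; apply: (le_trans h); rewrite -mulrA ler_pM2l // ler_wpM2l ?rknorm_ge0.
rewrite /w -(keval_pull (pull_back (cid G b))) (_ : keval _ u = keval (fun=> 0) u).
  by rewrite /keval big1 // => q _; rewrite mulr0.
apply: keval_ext => x; rewrite /rkpull.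
case: (pull_backP (cid G b) x) => [[t [_ ->]]|[_ ->]] //=.
by rewrite fa //= => e'; apply: nab.
Qed.

Lemma gfiber_total : closure [set x : H | exists (n : nat) (a : 'I_n -> ob G) (y : 'I_n -> H),
   (forall i, gfiber (a i) (y i)) /\ x = \sum_(i < n) y i] = setT.
Proof.
apply/seteqP; split=> // f _ B /nbhs_ballP[e /= e0 fB].
have er : e = (complex.Re e)%:C by rewrite RRe_real // gtr0_real.
have e2 : 0 < complex.Re e / 2 by rewrite divr_gt0 // -ltcR -er.
have [u hu] := rk_approx f e2; exists (rkcomb psd_total u); split; last first.
  apply: fB; rewrite er; apply/rk_ballE; apply: (le_lt_trans hu).
  by rewrite ltr_pdivrMr // ltr_pMr ?ltr1n // -ltcR -er.
pose y (i : 'I_(size u)) : rkhs psd_total :=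
  (tnth (in_tuple u) i).1 *: rkcomb psd_total [:: (1, (tnth (in_tuple u) i).2)].
exists (size u), (fun i => tag (tnth (in_tuple u) i).2), y; split.
  move=> i; rewrite /y; case: (tnth _ i) => c [d z] /=.
  rewrite -[X in gfiber _ X]addr0; apply: gfiber_linear; last by move=> *.
  exact: (gfiber_point z).
apply: rkfun_ext => x.
have -> : rkfun (\sum_i y i) x = \sum_i rkfun (y i) x.
  elim/big_ind2: _ => // f1 z1 f2 z2 <- <-; exact: rkfunD.
rewrite -[LHS]/(kcomb _ u x) /kcomb (big_tnth _ _ u); apply: eq_bigr => i _.
by rewrite [RHS]rkfunZ [X in _ = _ * X]kcomb1 mul1r.
Qed.

Fact gfiber_sum : is_hilbert_sum gfiber.
Proof.
split; last exact: gfiber_total.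
  by move=> a; split; [|exact: gfiber_linear|exact: gfiber_closed].
by move=> a b nab f g; exact: gfiber_orth.
Qed.

Fact gop_isometry a b (u : hom a b) : partial_isometry (gop u) (gfiber a) (gfiber b).
Proof.
split.
- move=> f fa; rewrite !rk_normE; congr (_%:C); apply/le_anti.
  (* An arrow and its inverse both act by contractions, hence isometrically on the fiber. *)
  rewrite gop_contr /= -[X in rknorm X <= _](gop_id fa) -(gcompVf u) gop_comp.
  exact: gop_contr.
- move=> f fa; apply: (gfiber_ext (@gop_fiber _ _ _ _)) => [x _ //|x].
  by rewrite gopE -rkinner_point; apply: fa; exact: gfiber_point.
- apply/seteqP; split=> [_ [f _ <-]|f fb]; first exact: gop_fiber.
  exists (gop (ginv u) f); first exact: gop_fiber.
  by rewrite -gop_comp gcompfV gop_id.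
Qed.

Definition gns : groupoid_rep R G :=
  @GroupoidRep R G H gfiber gop gfiber_sum
    (fun a b u => @rkop_continuous R allinto total_kernel psd_total (pull_back u)
      (@pull_backK a b u) (@pull_back_orth a b u))
    gop_isometry gop_comp.

Lemma sum_pick (A : seq {classic ob G}) (c : ob G) (F : ob G -> R[i]) :
    uniq A -> (forall d, d <> c -> F d = 0) -> (F c <> 0 -> (c : {classic _}) \in A) ->
  \sum_(d <- A) F d = F c.
Proof.
move=> uA F0 Fc; have [/Fc cA|] := pselect (F c <> 0).
  rewrite (bigD1_seq (c : {classic _})) //= big1 ?addr0 // => d /eqP dc.
  exact: F0.
move=> /contrapT F00; rewrite F00 big1 // => d _.
by have [->|] := pselect (d = c); [|exact: F0].
Qed.

(** The cyclic vector is the sum of the kernel functions at the identities of the objects in [A]. It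
    exists because [A] is finite, which is why [phi] must be supported on arrows between finitely
    many objects. *)
Lemma posdef_of_psd (A : seq {classic ob G}) : uniq A ->
    (forall (a b : ob G) (g : hom a b), phi (arr g) <> 0 ->
      ((a : {classic _}) \in A) && ((b : {classic _}) \in A)) ->
  groupoid_posdef phi.
Proof.
move=> uA sA; pose idx a : allinto := Into (existT (fun c => hom c a) a (cid G a)).
pose u := [seq (1 : R[i], idx a) | a <- A].
exists gns, (rkcomb psd_total u); apply/funext => -[[a b] g].
rewrite -[RHS]/(@rkinner _ _ _ psd_total (gop g (rkcomb psd_total u)) (rkcomb psd_total u)).
rewrite rkinner_comb; apply/esym.
have xiE : rkfun (rkcomb psd_total u) (Into (lact (ginv g) (existT (fun c => hom c b) b (cid G b))))
   = phi (arr g).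
  rewrite /= /kcomb big_map /=.
  under eq_bigr do rewrite mul1r.
  rewrite (@sum_pick A a) //.
  - rewrite total_kernelE /fiber_kernel /= ccompf1 ccompf1.
    by rewrite ginvK.
  - by move=> d da; rewrite total_kernel0.
  - rewrite total_kernelE /fiber_kernel /= ccompf1 ccompf1 ginvK => h.
    by have /andP[] := sA _ _ _ h.
rewrite /keval big_map /=.
under eq_bigr do rewrite rmorph1 mul1r.
rewrite (@sum_pick A b (fun d => rkpull (pull_back g) (rkfun (rkcomb psd_total u)) (idx d))) //.
- by rewrite /rkpull pull_backE /= -[LHS]/(rkfun (rkcomb psd_total u) _) xiE.
- by move=> d db; rewrite /rkpull pull_back0.
- rewrite /rkpull pull_backE /= -[kcomb _ _ _]/(rkfun (rkcomb psd_total u) _) xiE => h.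
  by have /andP[] := sA _ _ _ h.
Qed.
End GNS.

(** * Groupoids of fractions *)

Section Ore.
Local Open Scope ring_scope.
Variable C : category.
Local Notation "g \oc f" := (ccomp C g f) (at level 40, left associativity).

Hypothesis ore : forall (a b c : ob C) (x : hom a b) (y : hom a c),
  exists (l : ob C) (p : hom b l) (q : hom c l), p \oc x = q \oc y.
Hypothesis mono : forall (a b c : ob C) (p : hom b c) (x y : hom a b),
  p \oc x = p \oc y -> x = y.
Hypothesis epi : forall (a b c : ob C) (x : hom a b) (p q : hom b c),
  p \oc x = q \oc x -> p = q.

(* A fraction [y^-1 x] is encoded as the set of all the pairs [(x, y)] that
   represent it. *)
Record fraction_set (a b : ob C) := FractionSet {
  frel :> forall l, hom a l -> hom b l -> Prop;
  fr_sat : forall l m (p : hom l m) x y, frel x y <-> frel (p \oc x) (p \oc y);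
  fr_funl : forall l (x : hom a l) y y', frel x y -> frel x y' -> y = y';
  fr_funr : forall l x x' (y : hom b l), frel x y -> frel x' y -> x = x';
  fr_ex : exists l (x : hom a l) (y : hom b l), frel x y
}.

Lemma fraction_set_eq a b (r s : fraction_set a b) :
  (forall l (x : hom a l) (y : hom b l), r l x y <-> s l x y) -> r = s.
Proof.
case: r s => [r r1 r2 r3 r4] [s s1 s2 s3 s4] /= rs.
have e : r = s.
  apply: functional_extensionality_dep => l; apply: funext => x; apply: funext => y.
  exact/propext.
by subst s; congr FractionSet; exact: Prop_irrelevance.
Qed.

Lemma fr_total a b (r : fraction_set a b) l (x : hom a l) :
  exists m (p : hom l m) y, r m (p \oc x) y.
Proof.
case: (fr_ex r) => l0 [x0 [y0 rxy]]; have [m [p [q e]]] := ore x x0.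
by exists m, p, (q \oc y0); rewrite e -fr_sat.
Qed.

Definition fr_id a : fraction_set a a.
Proof.
refine (@FractionSet a a (fun l x y => x = y) _ _ _ _).
- by move=> l m p x y; split=> [->//|/mono].
- by move=> l x y y' <-.
- by move=> l x x' y ->.
- by exists a, (cid C a), (cid C a).
Defined.

Definition fr_inv a b (r : fraction_set a b) : fraction_set b a.
Proof.
refine (@FractionSet b a (fun l y x => r l x y) _ _ _ _).
- by move=> l m p x y; exact: fr_sat.
- by move=> l y x x'; exact: fr_funr.
- by move=> l y y' x; exact: fr_funl.
- by case: (fr_ex r) => l [x [y rxy]]; exists l, y, x.
Defined.

(** The middle leg [y] may exist only after a further extension [p] of the outer ones. *)
Definition fr_comp_rel a b c (s : fraction_set b c) (r : fraction_set a b) l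
    (x : hom a l) (z : hom c l) :=
  exists m (p : hom l m) y, r m (p \oc x) y /\ s m y (p \oc z).

Lemma fr_comp_fun a b c (s : fraction_set b c) (r : fraction_set a b) l x z z' :
  @fr_comp_rel a b c s r l x z -> fr_comp_rel s r x z' -> z = z'.
Proof.
move=> [m [p [y [rxy syz]]]] [m' [p' [y' [rxy' syz']]]].
have [n [q [q' e]]] := ore p p'.
rewrite (fr_sat r q) ccompA in rxy; rewrite (fr_sat r q') ccompA -e in rxy'.
rewrite (fr_sat s q) ccompA in syz; rewrite (fr_sat s q') ccompA -e in syz'.
rewrite (fr_funl rxy rxy') in syz.
exact: mono (fr_funl syz syz').
Qed.

Lemma fr_comp_rev a b c (s : fraction_set b c) (r : fraction_set a b) l
    (x : hom a l) z : fr_comp_rel s r x z -> fr_comp_rel (fr_inv r) (fr_inv s) z x.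
Proof. by move=> [m [p [y [rxy syz]]]]; exists m, p, y. Qed.

Definition fr_comp a b c (s : fraction_set b c) (r : fraction_set a b) :
  fraction_set a c.
Proof.
refine (@FractionSet a c (fr_comp_rel s r) _ _ _ _).
- move=> l m p x y.
  split=> [[n [q [w [rxw swy]]]]|[n [q [w [rxw swy]]]]]; last first.
    by exists n, (q \oc p), w; rewrite -!ccompA.
  have [n' [q' [p' e]]] := ore p q.
  exists n', q', (p' \oc w); rewrite !ccompA e -!ccompA.
  by split; rewrite -fr_sat.
- exact: fr_comp_fun.
- by move=> l x x' y h h'; exact: fr_comp_fun (fr_comp_rev h) (fr_comp_rev h').
- case: (fr_ex r) => l [x [y rxy]]; have [m [p [z syz]]] := fr_total s y.
  exists m, (p \oc x), z, m, (cid C m), (p \oc y); rewrite !ccomp1f.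
  by split=> //; rewrite -fr_sat.
Defined.

Lemma fr_compA a b c d (t : fraction_set c d) (s : fraction_set b c)
  (r : fraction_set a b) : fr_comp t (fr_comp s r) = fr_comp (fr_comp t s) r.
Proof.
apply: fraction_set_eq => l x w; split.
  move=> [m [p [z [[n [q [y [h1 h2]]]] h3]]]]; exists n, (q \oc p), y.
  rewrite -ccompA; split=> //; exists n, (cid C n), (q \oc z); rewrite !ccomp1f -ccompA.
  by split=> //; rewrite -fr_sat.
move=> [m [p [y [h1 h]]]]; have [n [q [z [h2 h3]]]] := h; exists n, (q \oc p), z.
rewrite -!ccompA; split=> //; exists n, (cid C n), (q \oc y); rewrite !ccomp1f.
by split=> //; rewrite -fr_sat.
Qed.

Lemma fr_comp1f a b (r : fraction_set a b) : fr_comp (fr_id b) r = r.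
Proof.
apply: fraction_set_eq => l x y; split=> [[m [p [z [h /= e]]]]|h].
  by rewrite (fr_sat r p) -e.
by exists l, (cid C l), y; rewrite /= !ccomp1f.
Qed.

Lemma fr_compf1 a b (r : fraction_set a b) : fr_comp r (fr_id a) = r.
Proof.
apply: fraction_set_eq => l x y; split=> [[m [p [z [/= e h]]]]|h].
  by rewrite (fr_sat r p) e.
by exists l, (cid C l), x; rewrite /= !ccomp1f.
Qed.

Lemma fr_compVf a b (r : fraction_set a b) : fr_comp (fr_inv r) r = fr_id a.
Proof.
apply: fraction_set_eq => l x y; split=> /= [[m [p [z [h1 h2]]]]|->].
  exact: mono (fr_funr h1 h2).
by have [m [p [z h]]] := fr_total r y; exists m, p, z.
Qed.

Lemma fr_invK a b (r : fraction_set a b) : fr_inv (fr_inv r) = r.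
Proof. exact: fraction_set_eq. Qed.

Lemma fr_compfV a b (r : fraction_set a b) : fr_comp r (fr_inv r) = fr_id b.
Proof. by rewrite -[X in fr_comp X _]fr_invK fr_compVf. Qed.

Definition fr_groupoid : groupoid :=
  @Groupoid (@Category (ob C) fraction_set (CategoryOn fr_compA fr_comp1f fr_compf1))
    fr_inv fr_compVf fr_compfV.

Definition fr_gen (a b : ob C) (f : @hom C a b) : @hom fr_groupoid a b.
Proof.
refine (@FractionSet a b (fun l x y => x = y \oc f) _ _ _ _).
- by move=> l m p x y; rewrite -ccompA; split=> [->|/mono].
- by move=> l x y y' -> /epi.
- by move=> l x x' y -> ->.
- by exists b, f, (cid C b); rewrite ccomp1f.
Defined.

Lemma fr_gen_functor : @is_functor C fr_groupoid id fr_gen.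
Proof.
split=> [a|a b c g f]; apply: fraction_set_eq => l x y /=; first by rewrite ccompf1.
split=> [->|[m [p [z [/= e1 e2]]]]].
  by exists l, (cid C l), (y \oc g); rewrite /= !ccomp1f ccompA.
by apply: (mono (p := p)); rewrite e1 e2 !ccompA.
Qed.

Local Notation G := (universal_groupoid C).

(** This is what the groupoid of fractions is built for: the universal groupoid maps to it, and
    there [f] is recovered as the numerator over the denominator [cid C b]. *)
Lemma ug_gen_inj (a b : ob C) (f g : hom a b) : ug_gen f = ug_gen g -> f = g.
Proof.
move=> /ug_classP /(gterm_eval_eq fr_gen_functor) /= e.
have : (fr_gen f : fraction_set a b) b f (cid C b) by rewrite /= ccomp1f.
by rewrite e /= ccomp1f.
Qed.

Definition fraction (a b l : ob C) (x : hom a l) (y : hom b l) : @hom G a b :=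
  ccomp G (ginv (ug_gen y)) (ug_gen x).

Lemma ug_gen_comp (a b c : ob C) (g : hom b c) (f : hom a b) :
  ug_gen (g \oc f) = ccomp G (ug_gen g) (ug_gen f).
Proof. exact: (functor_comp (ug_gen_functor C)). Qed.

Lemma ug_gen_id (a : ob C) : ug_gen (cid C a) = cid G a.
Proof. exact: (functor_id (ug_gen_functor C)). Qed.

Lemma fraction_sat (a b l m : ob C) (p : hom l m) (x : hom a l) (y : hom b l) :
  fraction (p \oc x) (p \oc y) = fraction x y.
Proof.
rewrite /fraction !ug_gen_comp ginv_comp -(ccompA G (ginv (ug_gen y))).
by rewrite (ccompA G (ginv (ug_gen p))) gcompVf ccomp1f.
Qed.

Lemma fraction_gen (a b : ob C) (f : hom a b) : fraction f (cid C b) = ug_gen f.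
Proof.
rewrite /fraction ug_gen_id; have <- : cid G b = ginv (cid G b).
  by apply: ginv_unique; rewrite ccomp1f.
exact: ccomp1f.
Qed.

Lemma fraction_inv (a b l : ob C) (x : hom a l) (y : hom b l) :
  ginv (fraction x y) = fraction y x.
Proof. by rewrite /fraction ginv_comp ginvK. Qed.

Lemma fraction_compl (a b c l : ob C) (x : hom a l) (y : hom b l) (z : hom c l) :
  ccomp G (fraction y z) (fraction x y) = fraction x z.
Proof.
rewrite /fraction -(ccompA G (ginv (ug_gen z))) (ccompA G (ug_gen y)).
by rewrite gcompfV ccomp1f.
Qed.

Lemma fractionP (a b : ob C) (u : @hom G a b) :
  exists l (x : hom a l) (y : hom b l), u = fraction x y.
Proof.
rewrite -(ug_reprK u); elim: {u}(ug_repr u) => {a b} [a|a b f|a b t IH|a b c t IHt s IHs].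
- by exists a, (cid C a), (cid C a); rewrite fraction_gen ug_gen_id.
- by exists b, f, (cid C b); rewrite fraction_gen.
- case: IH => l [x [y e]]; exists l, y, x.
  by rewrite -fraction_inv -e /= ug_invE.
- case: IHt => l [x [y e]]; case: IHs => l' [x' [y' e']].
  have [m [p [q pq]]] := ore x y'.
  exists m, (q \oc x'), (p \oc y).
  rewrite -(fraction_compl _ (q \oc y')) -{1}pq !fraction_sat -e -e'.
  by rewrite /= ug_compE.
Qed.

Lemma fraction_eqP (a b l l' : ob C) (x : hom a l) (y : hom b l) (x' : hom a l') (y' : hom b l') :
  fraction x y = fraction x' y' ->
  exists m (p : hom l m) (q : hom l' m), p \oc x = q \oc x' /\ p \oc y = q \oc y'.
Proof.
have [m [p [q pq]]] := ore y y'; exists m, p, q; split=> //.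
move: H; rewrite -(fraction_sat p) -(fraction_sat q) -pq /fraction => e.
apply: ug_gen_inj; have := congr1 (ccomp G (ug_gen (p \oc y))) e.
by rewrite !ccompA gcompfV !ccomp1f.
Qed.

(** * Functions on the groupoid of fractions from invariant kernels *)

Section Jones.
Variables (R : realType) (K : forall l a b : ob C, hom a l -> hom b l -> R[i]).
Hypothesis K_inv : forall (l m a b : ob C) (p : hom l m) (x : hom a l) (y : hom b l),
  K (p \oc x) (p \oc y) = K x y.
Hypothesis K_psd : forall l : ob C,
  psd (fun x y : {a : ob C & hom a l} => K (tagged x) (tagged y)).

Lemma jones_ex (u : arrow G) : exists z, forall (l : ob C)
  (x : @hom C (tag u).1 l) (y : @hom C (tag u).2 l), tagged u = fraction x y -> z = K x y.
Proof.
case: u => -[a b] u /=; have [l [x [y ->]]] := fractionP u.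
exists (K x y) => l' x' y' /fraction_eqP[m [p [q [px py]]]].
by rewrite -(K_inv p) px py K_inv.
Qed.

(* The function [y^-1 x |-> K x y], see [jonesE]. *)
Definition jones (u : arrow G) : R[i] := sval (boolp.cid (jones_ex u)).

Lemma jonesE (a b l : ob C) (x : hom a l) (y : hom b l) :
  jones (@arr G a b (fraction x y)) = K x y.
Proof. exact: (svalP (boolp.cid (jones_ex (@arr G a b (fraction x y))))). Qed.

Definition over (a l : ob C) (y : hom a l) (x : {b : ob C & hom b l}) : @into G a :=
  existT (fun b => @hom G b a) (tag x) (fraction (tagged x) y).

Lemma common_denominator (a : ob C) (w : seq (R[i] * @into G a)) :
  exists (l : ob C) (y : hom a l) (w' : seq (R[i] * {b : ob C & hom b l})),
    w = [seq (p.1, over y p.2) | p <- w'].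
Proof.
elim: w => [|[c [b u]] w [l [y [w' ->]]]]; first by exists a, (cid C a), [::].
have [l' [x' [y' ->]]] := fractionP u.
have [m [p [q pq]]] := ore y y'.
exists m, (p \oc y), ((c, existT (fun b : ob C => hom b m) b (q \oc x')) ::
   [seq (r.1, existT (fun b : ob C => hom b m) (tag r.2) (p \oc tagged r.2)) | r <- w']).
rewrite /=; congr (_ :: _); first by rewrite /over /= pq fraction_sat.
rewrite -map_comp.
by apply: eq_map => r; rewrite /over /= fraction_sat.
Qed.

(** Positivity involves finitely many fractions into [a]. Over a common denominator [y], the
    quotient of y^-1 x by y^-1 x' is x'^-1 x, so the form is that of [K] on the numerators. *)
Lemma jones_psd (a : ob C) : psd (@fiber_kernel R G jones a).
Proof.
move=> w; have [l [y [w' ->]]] := common_denominator w.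
have := K_psd w'; congr (0 <= _); rewrite !kformE !big_map.
apply: eq_bigr => p _; rewrite big_map; apply: eq_bigr => q _ /=; congr (_ * _).
rewrite /fiber_kernel /= -(jonesE (tagged p.2) (tagged q.2)).
congr (jones (arr _)).
rewrite -[RHS]/(ccomp G (ginv (fraction (tagged q.2) y)) (fraction (tagged p.2) y)).
rewrite (_ : ginv _ = fraction y (tagged q.2)); last exact: fraction_inv.
by rewrite fraction_compl.
Qed.
End Jones.
End Ore.

(** * Codes of labelled forests *)

Lemma count1P (T : Type) (p : pred T) (s : seq T) x0 : count p s = 1 ->
  exists2 i, i < size s & p (nth x0 s i) /\
    forall j, j < size s -> p (nth x0 s j) -> j = i.
Proof.
elim: s => //= x s IH; case px: (p x) => /=.
  move=> [/eqP]; rewrite -leqn0 leqNgt -has_count => ps.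
  exists 0 => //; split=> // -[|j] //= ltj pj.
  by case/negP: ps; apply/(has_nthP x0); exists j.
rewrite add0n => /IH[i lti [pi ui]]; exists i.+1 => //; split=> // -[|j] /=.
  by rewrite px.
by rewrite ltnS => ltj /ui ->.
Qed.

Lemma count_eq1 (T : Type) (p : pred T) (s : seq T) x0 i : i < size s -> p (nth x0 s i) ->
  (forall j, j < size s -> p (nth x0 s j) -> j = i) -> count p s = 1.
Proof.
elim: s i => //= x s IH [|i] /= lti pi ui.
  rewrite pi; congr _.+1; apply/eqP; rewrite -leqn0 leqNgt -has_count.
  apply/negP => /(has_nthP x0)[j ltj pj]; by have := ui j.+1 ltj pj.
case px: (p x); first by have := ui 0 isT px.
by rewrite (IH i) // => j ltj pj; have [] := ui j.+1 ltj pj.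
Qed.

Section Codes.
Variables (k : nat) (Gamma : groupType) (th : Gamma -> Gamma).
Hypothesis k_gt0 : 0 < k.
Hypothesis thM : {morph th : x y / (x * y)%g}.
Hypothesis th_inj : injective th.

(* The entry [(r, w, g)] at position [j] of the code of a morphism stands for a
   leaf with address [w] in the tree number [r], which is sent to the point
   number [j] and labelled by [g]. *)
Definition entry : Type := (nat * seq 'I_k * Gamma)%type.
Definition e0 : entry := (0, [::], 1%g).
Implicit Types (u v w : seq 'I_k) (g h : Gamma) (x y z : seq entry).

Definition zero_word u := all (fun i : 'I_k => val i == 0) u.
(* A label [g] at the root, moved through a tree by the corolla relation, becomes
   [push u g] at the leaf with address [u]. *)
Definition push u g : Gamma := if zero_word u then iter (size u) th g else 1%g.

Lemma th1 : th 1 = 1%g.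
Proof. by apply: (mulgI (th 1)); rewrite -thM !mulg1. Qed.

Lemma thV g : th g^-1 = (th g)^-1%g.
Proof. by apply: (mulgI (th g)); rewrite -thM !mulgV th1. Qed.

Lemma iter_th1 n : iter n th 1%g = 1%g.
Proof. by elim: n => //= n ->; exact: th1. Qed.

Lemma iter_thM n : {morph iter n th : g h / (g * h)%g}.
Proof. by elim: n => // n IH g h; rewrite !iterS IH thM. Qed.

Lemma iter_thV n g : iter n th g^-1%g = (iter n th g)^-1%g.
Proof. by elim: n => //= n ->; exact: thV. Qed.

Lemma iter_th_inj n : injective (iter n th).
Proof. by elim: n => //= n IH g h /th_inj/IH. Qed.

Lemma zero_word_cat u v : zero_word (u ++ v) = zero_word u && zero_word v.
Proof. exact: all_cat. Qed.

Lemma push0 g : push [::] g = g. Proof. by []. Qed.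

Lemma push1 u : push u 1%g = 1%g.
Proof. by rewrite /push; case: zero_word => //; exact: iter_th1. Qed.

Lemma pushM u g h : push u (g * h)%g = (push u g * push u h)%g.
Proof. by rewrite /push; case: zero_word; rewrite ?mulg1 //; exact: iter_thM. Qed.

Lemma push_cat u v g : push (u ++ v) g = push v (push u g).
Proof.
rewrite /push zero_word_cat; case: (zero_word u); case: (zero_word v) => //=; last by rewrite iter_th1.
by rewrite size_cat addnC iterD.
Qed.

Definition hit r w (e : entry) := (e.1.1 == r) && prefix e.1.2 w.

(* The addresses listed in [x] form a complete prefix code for each of the [n]
   trees. *)
Definition iscode n x := all (fun e : entry => e.1.1 < n) x /\
  exists d, forall r w, r < n -> d <= size w -> count (hit r w) x = 1.

Definition idcode n : seq entry := [seq (r, [::], 1%g) | r <- iota 0 n].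

(** The label coming from [x] crosses the tree of [z] and is multiplied on the right of the label of
    [z], since a triple is read g o sigma o f. *)
Definition graftE x (e : entry) : entry :=
  let e' := nth e0 x e.1.1 in (e'.1.1, e'.1.2 ++ e.1.2, e.2 * push e.1.2 e'.2)%g.

Definition ccode z x : seq entry := [seq graftE x e | e <- z].

Lemma size_ccode z x : size (ccode z x) = size z.
Proof. exact: size_map. Qed.

Lemma size_idcode n : size (idcode n) = n.
Proof. by rewrite size_map size_iota. Qed.

Lemma nth_ccode z x j : j < size z -> nth e0 (ccode z x) j = graftE x (nth e0 z j).
Proof. by move=> ltj; rewrite (nth_map e0). Qed.

Lemma nth_idcode n j : j < n -> nth e0 (idcode n) j = (j, [::], 1%g).
Proof. by move=> ltj; rewrite (nth_map 0) ?size_iota // nth_iota. Qed.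

Lemma code_lt n x j : iscode n x -> j < size x -> (nth e0 x j).1.1 < n.
Proof. by move=> [/all_nthP h _] ltj; exact: h. Qed.

Lemma graftE_comp y x e : e.1.1 < size y -> graftE (ccode y x) e = graftE x (graftE y e).
Proof.
by move=> lte; rewrite /graftE nth_ccode //= /graftE /= catA push_cat pushM mulgA.
Qed.

Lemma ccodeA n z y x : iscode (size y) z -> iscode n y ->
  ccode z (ccode y x) = ccode (ccode z y) x.
Proof.
move=> [/allP hz _] _; rewrite /ccode -map_comp; apply/eq_in_map => e ez.
by rewrite graftE_comp // hz.
Qed.

Lemma ccode1f x : ccode (idcode (size x)) x = x.
Proof.
apply: (@eq_from_nth _ e0); rewrite size_ccode size_idcode // => j ltj.
rewrite nth_ccode ?size_idcode // nth_idcode // /graftE /=.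
by rewrite cats0 push0 mul1g; case: (nth _ _ _) => -[].
Qed.

Lemma ccodef1 n x : iscode n x -> ccode x (idcode n) = x.
Proof.
move=> [/allP hx _]; rewrite /ccode -[RHS]map_id; apply/eq_in_map => -[[r w] g] /hx /= ltr.
by rewrite /graftE /= nth_idcode //= push1 mulg1.
Qed.

Lemma code_id n : iscode n (idcode n).
Proof.
split; first by apply/allP => e /mapP[r]; rewrite mem_iota => /= ltr ->.
exists 0 => r w ltr _; apply: (@count_eq1 _ _ _ e0 r); rewrite ?size_idcode //.
  by rewrite nth_idcode // /hit eqxx prefix0s.
by move=> j ltj; rewrite nth_idcode // => /andP[/eqP].
Qed.

Lemma prefix_catE u v w : prefix (u ++ v) w = prefix u w && prefix v (drop (size u) w).
Proof.
case uw: (prefix u w).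
  by case/prefixP: uw => s ->; rewrite prefix_catr // eqxx drop_size_cat.
by apply/negbTE/negP => /catl_prefix; rewrite uw.
Qed.

Lemma code_index n x i j r w : iscode n x -> i < size x -> j < size x ->
  hit r w (nth e0 x i) -> hit r w (nth e0 x j) -> i = j.
Proof.
move=> [/(all_nthP e0) xn [d xd]] lti ltj hi hj.
have ltr : r < n by case/andP: hi => /eqP <- _; exact: xn.
(* Padding makes the word long enough for the counting property and keeps its prefixes. *)
pose s := w ++ nseq d (Ordinal k_gt0).
have hit_s e : hit r w e -> hit r s e.
  by move=> /andP[er ew]; rewrite /hit er prefix_catl.
have /(count1P e0)[i0 _ [_ u0]] : count (hit r s) x = 1.
  by apply: xd; rewrite // size_cat size_nseq leq_addl.
by rewrite (u0 i) ?hit_s // (u0 j) ?hit_s.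
Qed.

Lemma code_depth n x : iscode n x ->
  exists d, (forall r w, r < n -> d <= size w -> count (hit r w) x = 1) /\
    forall j, j < size x -> size (nth e0 x j).1.2 <= d.
Proof.
move=> [_ [d xd]]; pose m := \max_(e <- x) size e.1.2.
exists (maxn d m); split=> [r w ltr|j ltj].
  by rewrite geq_max => /andP[dw _]; exact: xd.
rewrite leq_max; apply/orP; right; rewrite /m (big_nth e0) big_mkord.
exact: (leq_bigmax (Ordinal ltj)).
Qed.

Lemma code_hit n x : iscode n x -> exists d, forall r w, r < n -> d <= size w ->
  exists2 i, i < size x & [/\ hit r w (nth e0 x i),
    (nth e0 x i).1.1 = r & w = (nth e0 x i).1.2 ++ drop (size (nth e0 x i).1.2) w].
Proof.
move=> [_ [d xd]]; exists d => r w ltr dw.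
have [i lti [hi _]] := count1P e0 (xd r w ltr dw); exists i => //; split=> //.
  by case/andP: hi => /eqP.
by case/andP: hi => _ /prefixP[s ->]; rewrite drop_size_cat.
Qed.

Lemma code_addr_inj n x i j : iscode n x -> i < size x -> j < size x ->
  (nth e0 x i).1 = (nth e0 x j).1 -> i = j.
Proof.
move=> cx lti ltj e; apply: (code_index (r := (nth e0 x i).1.1) (w := (nth e0 x i).1.2) cx) => //.
  by rewrite /hit eqxx prefix_refl.
by rewrite /hit -e eqxx prefix_refl.
Qed.

Lemma hit_graftE n x r w e i : iscode n x -> i < size x -> hit r w (nth e0 x i) ->
  e.1.1 < size x ->
  hit r w (graftE x e) = hit i (drop (size (nth e0 x i).1.2) w) e.
Proof.
move=> cx lti hi lte; rewrite /hit /graftE /=.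
have [->|ne] := eqVneq e.1.1 i.
  by case/andP: hi => -> /= vw; rewrite prefix_catE vw.
apply/negbTE/negP => /andP[er /catl_prefix ew]; case/eqP: ne.
by apply: (code_index (r := r) (w := w) cx); rewrite // /hit er.
Qed.

Lemma code_comp n x z : iscode n x -> iscode (size x) z -> iscode n (ccode z x).
Proof.
move=> cx [/allP hz [d zd]]; split.
  by apply/allP => _ /mapP[e ez ->]; apply: code_lt => //; exact: hz.
(* As [d'] bounds the addresses in [x], a word of length [d' + d] keeps at least [d] letters beyond
   the leaf of [x] it passes through. *)
have [d' [xd bx]] := code_depth cx; exists (d' + d) => r w ltr dw.
have /(count1P e0)[i lti [hi _]] : count (hit r w) x = 1.
  by apply: xd => //; apply: leq_trans dw; exact: leq_addr.
rewrite count_map -[RHS](zd i (drop (size (nth e0 x i).1.2) w)) //; last first.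
  by rewrite size_drop leq_subRL; have := bx i lti; lia.
by apply/eq_in_count => e ez; apply: hit_graftE cx _ _ _ => //; exact: hz.
Qed.

Lemma size_prefix_drop u w : prefix u w -> u ++ drop (size u) w = w.
Proof. by case/prefixP => s ->; rewrite drop_size_cat. Qed.

Definition zeros (n : nat) : seq 'I_k := nseq n (Ordinal k_gt0).

Lemma zero_word_zeros n : zero_word (zeros n).
Proof. by rewrite /zero_word all_nseq orbT. Qed.

Lemma zero_wordP u : zero_word u -> u = zeros (size u).
Proof.
elim: u => //= i u IH /andP[/eqP i0 /IH {1}->]; congr cons; exact: val_inj.
Qed.

Lemma code_zero n z i : iscode n z -> i < n ->
  exists j, [/\ j < size z, (nth e0 z j).1.1 = i & zero_word (nth e0 z j).1.2].
Proof.
move=> cz lti; have [d hd] := code_hit cz.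
have dz : d <= size (zeros d) by rewrite size_nseq.
have [j ltj [_ ej ew]] := hd i _ lti dz; exists j; split=> //.
by have := zero_word_zeros d; rewrite ew zero_word_cat => /andP[].
Qed.

(** Each leaf of [x] is seen at the leaf of [z] reached from it by zeros only, where its label
    appears under an iterate of [th], which is injective. *)
Lemma ccode_mono z x y : iscode (size x) z -> size x = size y ->
  ccode z x = ccode z y -> x = y.
Proof.
move=> cz sxy e; apply: (@eq_from_nth _ e0) => // i lti.
have [j [ltj ej zj]] := code_zero cz lti.
have := congr1 (nth e0 ^~ j) e; rewrite !nth_ccode // /graftE ej /push zj.
case: (nth e0 x i) (nth e0 y i) => [[r v] g] [[s w] h] /= [-> /eqP].
case: (nth e0 z j) zj => [[? u] f] /= _.
rewrite -(inj_eq (can_inj revK)) !rev_cat.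
move=> /eqP e1 e2.
have : size (rev u ++ rev v) = size (rev u ++ rev w) by rewrite e1.
rewrite !size_cat => /addnI sz.
move/eqP: e1; rewrite eqseq_cat // eqxx /= => /eqP/(can_inj revK) ->.
by move/mulgI/iter_th_inj: e2 => ->.
Qed.

(** The address of a leaf of the composite passes through exactly one leaf of [x], which gives the
    root, then the rest of the address and the label. *)
Lemma ccode_epi n x z y : iscode n x -> iscode (size x) z -> iscode (size x) y ->
  size z = size y -> ccode z x = ccode y x -> z = y.
Proof.
move=> cx [/(all_nthP e0) hz _] [/(all_nthP e0) hy _] szy e.
apply: (@eq_from_nth _ e0) => // j ltj.
have ltj' : j < size y by rewrite -szy.
have := congr1 (nth e0 ^~ j) e; rewrite !nth_ccode // /graftE.
have := hz j ltj; have := hy j ltj'.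
case: (nth e0 z j) (nth e0 y j) => [[r v] g] [[s w] h] /= lts ltr [er ev eg].
have ers : r = s.
  apply: (code_index (r := (nth e0 x r).1.1) (w := (nth e0 x r).1.2 ++ v) cx) => //.
    by rewrite /hit eqxx prefix_prefix.
  by rewrite /hit er ev eqxx prefix_prefix.
move: eg; rewrite -ers in ev *; move/eqP: ev; rewrite eqseq_cat // eqxx /= => /eqP ->.
by move/mulIg => ->.
Qed.

Definition shiftE n (e : entry) : entry := (n + e.1.1, e.1.2, e.2).

Definition tcode n x y : seq entry := x ++ map (shiftE n) y.

Lemma size_tcode n x y : size (tcode n x y) = size x + size y.
Proof. by rewrite size_cat size_map. Qed.

Lemma tcodeA n n' x y z :
  tcode n x (tcode n' y z) = tcode (n + n') (tcode n x y) z.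
Proof.
rewrite /tcode map_cat catA; congr (_ ++ _); rewrite -map_comp.
by apply: eq_map => e; rewrite /shiftE /= addnA.
Qed.

Lemma tcode0 y : tcode 0 [::] y = y.
Proof. by rewrite /tcode /= -[RHS]map_id; apply: eq_map => -[[r w] g]. Qed.

Lemma tcode_id n m : tcode n (idcode n) (idcode m) = idcode (n + m).
Proof.
rewrite /tcode /idcode iotaD map_cat; congr (_ ++ _).
by rewrite add0n -[X in _ = _ (iota X m)]addn0 iotaDl -!map_comp; apply: eq_map.
Qed.

Lemma tcode_comp n x z y t : iscode (size x) z -> iscode (size y) t ->
  tcode n (ccode z x) (ccode t y) = ccode (tcode (size x) z t) (tcode n x y).
Proof.
move=> [/allP hz _] [/allP ht _]; rewrite /tcode /ccode map_cat; congr (_ ++ _).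
  apply/eq_in_map => e /hz lte; rewrite /graftE nth_cat lte //.
rewrite -!map_comp; apply/eq_in_map => e et; rewrite /graftE /shiftE /=.
rewrite nth_cat ltnNge leq_addr /= addKn.
by rewrite (nth_map e0) //; exact: ht.
Qed.
End Codes.

(** * Leaf addresses of trees and forests *)

Section Addresses.
Variable k : nat.

Fixpoint addrs (t : ktree k) : seq (seq 'I_k) :=
  if t is Node c then
    flatten [seq [seq i :: w | w <- addrs (c i)] | i <- enum 'I_k]
  else [:: [::]].

Lemma size_addrs t : size (addrs t) = nleaves t.
Proof.
elim/ktree_ffun_ind: t => //= c IH; rewrite size_flatten /seq.shape -map_comp.
by congr sumn; apply: eq_map => i /=; rewrite size_map.
Qed.

Lemma flatten_iota (T : Type) (sh : seq nat) (F : nat -> seq T) :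
  flatten [seq F r | r <- iota 0 (sumn sh)] =
  flatten [seq flatten [seq F (flatten_index sh i j) | j <- iota 0 (nth 0 sh i)]
          | i <- iota 0 (size sh)].
Proof.
elim: sh F => [|n sh IH] F //=.
rewrite iotaD map_cat flatten_cat; congr (_ ++ _).
rewrite add0n -[X in iota X (sumn _)]addn0 iotaDl -map_comp (IH (F \o addn n)).
rewrite -[in RHS](addn0 1) [in RHS](iotaDl 1 0) -[in RHS]map_comp; congr flatten.
apply: eq_map => i /=; congr flatten; apply: eq_map => j /=.
by rewrite /flatten_index /= addnA.
Qed.

Lemma map_iota_ord n (T : Type) (F : nat -> T) :
  [seq F i | i <- iota 0 n] = [seq F (val i) | i <- enum 'I_n].
Proof. by rewrite -val_enum_ord -map_comp. Qed.

Lemma nth_map_ord n (T : Type) x0 (F : 'I_n -> T) (i : 'I_n) :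
  nth x0 [seq F j | j <- enum 'I_n] i = F i.
Proof. by rewrite (nth_map i) ?size_enum_ord // nth_ord_enum. Qed.

Lemma nth_flatten_index (T : Type) (x0 : T) (ss : seq (seq T)) i j :
  j < size (nth [::] ss i) ->
  nth x0 (flatten ss) (flatten_index (seq.shape ss) i j) = nth x0 (nth [::] ss i) j.
Proof.
move=> ltj; have lti : i < size ss by rewrite ltnNge; apply/negP => h; rewrite nth_default in ltj.
have ltj' : j < nth 0 (seq.shape ss) i by rewrite (nth_map [::]).
by rewrite nth_flatten flatten_indexKl // flatten_indexKr.
Qed.

Lemma addrs_graft t f : addrs (graft t f) =
  flatten [seq [seq nth [::] (addrs t) j ++ u | u <- addrs (f j)]
          | j <- iota 0 (nleaves t)].
Proof.
elim/ktree_ffun_ind: t f => [|c IH] f; first by rewrite /= cats0 map_id.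
set sh := [seq nleaves (c i) | i <- enum 'I_k].
rewrite [addrs _]/= -/sh -[nleaves _]/(sumn sh) flatten_iota size_map size_enum_ord.
rewrite map_iota_ord; congr flatten; apply: eq_map => i.
rewrite ffunE IH map_flatten nth_map_ord; congr flatten; rewrite -map_comp.
apply/eq_in_map => j; rewrite mem_iota /= add0n => ltj.
rewrite -map_comp; apply: eq_map => u; rewrite /= -cat_cons; congr (_ ++ _).
pose ss := [seq [seq i :: w | w <- addrs (c i)] | i <- enum 'I_k].
have sE : nth [::] ss i = [seq i :: w | w <- addrs (c i)] by rewrite nth_map_ord.
have -> : sh = seq.shape ss.
  by rewrite /seq.shape -map_comp; apply: eq_map => i' /=; rewrite size_map size_addrs.
rewrite nth_flatten_index sE ?size_map ?size_addrs //.
by rewrite (nth_map [::]) ?size_addrs.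
Qed.

Definition faddrs n (p : n.-tuple (ktree k)) : seq (nat * seq 'I_k) :=
  flatten [seq [seq (val r, w) | w <- addrs (tnth p r)] | r <- enum 'I_n].

Definition a0 : nat * seq 'I_k := (0, [::]).

Lemma shape_faddrs n m (p : forest k n m) :
  seq.shape [seq [seq (val r, w) | w <- addrs (tnth p r)] | r <- enum 'I_n] = shape p.
Proof.
rewrite /seq.shape -map_comp /shape /= -[in RHS](map_tnth_enum p) -map_comp.
by apply: eq_map => r; rewrite /= size_map size_addrs.
Qed.

Lemma size_faddrs n m (p : forest k n m) : size (faddrs p) = m.
Proof. by rewrite size_flatten shape_faddrs sumn_shape. Qed.

Lemma nth_faddrs n m (p : forest k n m) (r : 'I_n) j : j < nleaves (tnth p r) ->
  nth a0 (faddrs p) (flatten_index (shape p) r j) = (val r, nth [::] (addrs (tnth p r)) j).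
Proof.
move=> ltj; rewrite -shape_faddrs nth_flatten_index nth_map_ord ?size_map ?size_addrs //.
by rewrite (nth_map [::]) ?size_addrs.
Qed.

Definition graftA (s : seq (nat * seq 'I_k)) (a : nat * seq 'I_k) :=
  ((nth a0 s a.1).1, (nth a0 s a.1).2 ++ a.2).

Lemma faddrs_stack n m l (f : forest k m l) (q : forest k n m) :
  faddrs (stack f q) = [seq graftA (faddrs q) a | a <- faddrs f].
Proof.
pose F J := [seq graftA (faddrs q) (J, w) | w <- addrs (nth Leaf f J)].
have -> : [seq graftA (faddrs q) a | a <- faddrs f] = flatten [seq F J | J <- iota 0 (sumn (shape q))].
  rewrite sumn_shape map_iota_ord /faddrs map_flatten -map_comp; congr flatten.
  by apply: eq_map => J; rewrite /F /= -map_comp (tnth_nth Leaf).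
rewrite flatten_iota size_tuple map_iota_ord; congr flatten; apply: eq_map => r.
rewrite tnth_mktuple addrs_graft map_flatten -tnth_nth !tnth_map /=; congr flatten.
rewrite -map_comp; apply/eq_in_map => j; rewrite mem_iota /= add0n => ltj.
rewrite /F -map_comp; apply: eq_map => u.
by rewrite /graftA /= nth_faddrs.
Qed.

Lemma tree_code (t : ktree k) : exists d, forall w : seq 'I_k, d <= size w ->
  count (fun u => prefix u w) (addrs t) = 1.
Proof.
elim/ktree_ffun_ind: t => [|c IH]; first by exists 0 => w _; rewrite /= prefix0s.
have [d hd] := boolp.choice IH.
exists (\max_i d i).+1 => -[|a w] //=; rewrite ltnS => dw.
rewrite count_flatten -map_comp sumnE big_map big_enum /= (bigD1 a) //= count_map.
rewrite (eq_count (a2 := fun u => prefix u w)); last by move=> u; rewrite /= eqxx.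
rewrite hd ?big1 // => [i ia|]; last by apply: leq_trans dw; exact: leq_bigmax.
rewrite count_map; apply/eqP; rewrite -leqn0 leqNgt -has_count -all_predC.
by apply/allP => u _; rewrite /= (negbTE ia).
Qed.

Definition ahit r w (a : nat * seq 'I_k) := (a.1 == r) && prefix a.2 w.

Lemma forest_code n (p : n.-tuple (ktree k)) : exists d, forall r w, r < n -> d <= size w ->
  count (ahit r w) (faddrs p) = 1.
Proof.
have [d hd] := boolp.choice (fun r : 'I_n => tree_code (tnth p r)).
exists (\max_i d i) => r w ltr dw.
rewrite count_flatten -map_comp sumnE big_map big_enum /= (bigD1 (Ordinal ltr)) //= count_map.
rewrite (eq_count (a2 := fun u => prefix u w)); last by move=> u; rewrite /ahit /= eqxx.
rewrite hd ?big1 // => [i ia|]; last by apply: leq_trans dw; exact: (leq_bigmax (Ordinal ltr)).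
rewrite count_map; apply/eqP; rewrite -leqn0 leqNgt -has_count -all_predC.
apply/allP => u _; rewrite /= /ahit /=; apply: contra ia => /andP[/eqP e _].
by apply/eqP/val_inj.
Qed.

Lemma faddrs_lt n (p : n.-tuple (ktree k)) a : a \in faddrs p -> a.1 < n.
Proof. by case/flattenP => s /mapP[r _ ->] /mapP[w _ ->] /=. Qed.

Lemma mem_addrs_node c i w : (i :: w \in addrs (Node c)) = (w \in addrs (c i)).
Proof.
apply/flattenP/idP => [[s /mapP[j _ ->] /mapP[u uj [-> ->]]] //|wi].
exists [seq i :: w | w <- addrs (c i)]; last by rewrite mem_map // => u v [].
by apply: map_f; rewrite mem_enum.
Qed.

Lemma mem_faddrs n (p : n.-tuple (ktree k)) (r : 'I_n) w :
  ((val r, w) \in faddrs p) = (w \in addrs (tnth p r)).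
Proof.
apply/flattenP/idP => [[s /mapP[j _ ->] /mapP[u uj [/val_inj -> ->]]] //|wi].
exists [seq (val r, w) | w <- addrs (tnth p r)]; last by rewrite mem_map // => u v [].
by apply/mapP; exists r; rewrite ?mem_enum.
Qed.

Lemma nil_addrs_node c : [::] \notin addrs (Node c).
Proof. by apply/flattenP => -[s /mapP[i _ ->] /mapP[u _]]. Qed.

Lemma addrs_inj t t' : addrs t =i addrs t' -> t = t'.
Proof.
elim/ktree_ffun_ind: t t' => [|c IH] [|c'] e //.
- by have := nil_addrs_node c'; rewrite -e inE.
- by have := nil_addrs_node c; rewrite e inE.
congr Node; apply/ffunP => i; apply: IH => w.
by rewrite -!mem_addrs_node e.
Qed.

Lemma faddrs_inj n m (p q : forest k n m) : faddrs p =i faddrs q -> p = q.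
Proof.
move=> e; have pq : trees p = trees q.
  by apply: eq_from_tnth => r; apply: addrs_inj => w; rewrite -!mem_faddrs e.
case: p q pq {e} => [p hp] [q hq] /= pq; subst q; congr Forest; exact: Prop_irrelevance.
Qed.

Lemma uniq_addrs t : uniq (addrs t).
Proof.
elim/ktree_ffun_ind: t => //= c IH; elim: (enum 'I_k) (enum_uniq 'I_k) => //= i s IHs /andP[nis us].
rewrite cat_uniq IHs // map_inj_uniq ?IH //= ?andbT; last by move=> u v [].
apply/hasPn => x /flattenP[l /mapP[j js ->] /mapP[u _ ->]].
by apply/mapP => -[v _ [ij _]]; move: nis; rewrite -ij js.
Qed.

Lemma uniq_faddrs n (p : n.-tuple (ktree k)) : uniq (faddrs p).
Proof.
rewrite /faddrs; elim: (enum 'I_n) (enum_uniq 'I_n) => //= i s IHs /andP[nis us].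
rewrite cat_uniq IHs // map_inj_uniq ?uniq_addrs //= ?andbT; last by move=> u v [].
apply/hasPn => x /flattenP[l /mapP[j js ->] /mapP[u _ ->]].
by apply/mapP => -[v _ [/val_inj ij _]]; move: nis; rewrite -ij js.
Qed.

Fixpoint tree_of d (S : pred (seq 'I_k)) : ktree k :=
  if S [::] then Leaf else
  if d is d'.+1 then Node [ffun i => tree_of d' (fun w => S (i :: w))] else Leaf.

(** Every complete prefix code is the set of leaves of a tree. The fuel [d] bounds the depth: the
    first hypothesis makes the default leaf at depth [d] a genuine one. *)
Lemma addrs_tree_of d (S : pred (seq 'I_k)) :
    (forall w, size w = d -> exists2 u, prefix u w & S u) ->
    (forall u v, S u -> S v -> prefix u v -> u = v) ->
  forall w, (w \in addrs (tree_of d S)) = S w.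
Proof.
elim: d S => [|d IH] S Sd Su w.
  have S0 : S [::].
    by have [u] := Sd [::] erefl; rewrite prefixs0 => /eqP ->.
  rewrite /= S0 inE; apply/eqP/idP => [-> //|Sw].
  by rewrite -(Su _ _ S0 Sw) ?prefix0s.
rewrite /=; case: ifP => S0.
  rewrite inE; apply/eqP/idP => [-> //|Sw].
  by rewrite -(Su _ _ S0 Sw) ?prefix0s.
case: w => [|i w]; first by rewrite S0; apply/negbTE/nil_addrs_node.
rewrite mem_addrs_node ffunE IH // => [v sv|u v Siu Siv uv].
  have [|[|j u] uw Su'] := Sd (i :: v); first by rewrite /= sv.
    by rewrite Su' in S0.
  by move: uw; rewrite prefix_cons => /andP[/eqP ij uv]; exists u; rewrite // -ij.
have : i :: u = i :: v by apply: Su; rewrite //= eqxx.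
by case.
Qed.
End Addresses.

(** * The monoidal category *)

Section RecordEq.
Variables (ob : Type) (hom : ob -> ob -> Type).

(** Composition determines the identities, and the laws are proof-irrelevant. *)
Lemma category_on_eq (C D : category_on hom) :
  (forall a b c (g : hom b c) (f : hom a b), ccomp C g f = ccomp D g f) -> C = D.
Proof.
move=> CD; have ids a : cid C a = cid D a.
  by rewrite -[LHS](ccomp1f D) -CD ccompf1.
case: C D CD ids => i1 c1 p1 p2 p3 [i2 c2 q1 q2 q3] /= CD ids.
have ei : i1 = i2 by apply: functional_extensionality_dep.
have ec : c1 = c2.
  do 3! (apply: functional_extensionality_dep => ?).
  by apply: funext => g; apply: funext => f; exact: CD.
by subst i2 c2; congr CategoryOn; exact: Prop_irrelevance.
Qed.

Lemma strict_monoidal_on_eq (tob : ob -> ob -> ob) (u : ob)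
    (C D : strict_monoidal_on hom tob u) :
  smcat C = smcat D ->
  (forall a b c d (f : hom a b) (g : hom c d), tens C f g = tens D f g) -> C = D.
Proof.
case: C D => s1 t1 a1 b1 c1 d1 e1 f1 g1 h1 [s2 t2 a2 b2 c2 d2 e2 f2 g2 h2] /= es et.
have ett : t1 = t2.
  do 4! (apply: functional_extensionality_dep => ?).
  by apply: funext => g; apply: funext => f; exact: et.
have ea : a1 = a2 by exact: Prop_irrelevance.
have eb : b1 = b2 by exact: Prop_irrelevance.
have ec : c1 = c2 by exact: Prop_irrelevance.
subst s2 t2 a2 b2 c2.
by rewrite (Prop_irrelevance d1 d2) (Prop_irrelevance e1 e2) (Prop_irrelevance f1 f2)
  (Prop_irrelevance g1 g2) (Prop_irrelevance h1 h2).
Qed.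
End RecordEq.

(** * Labelled forests as codes, and the composition transported from codes *)

Section LeafMap.
Variables (k : nat) (Gamma : groupType) (th : Gamma -> Gamma).
Hypothesis k_gt0 : 0 < k.
Hypothesis thM : {morph th : x y / (x * y)%g}.

Local Notation lf := (lforest k Gamma).
Local Notation entry := (entry k Gamma).
Local Notation e0 := (e0 k Gamma).
Local Notation a0 := (a0 k).

Definition mkentry (a : nat * seq 'I_k) (g : Gamma) : entry := (a.1, a.2, g).

(** The permutation sends the leaf [i] to [sigma i], hence its inverse at position [j]. *)
Definition lcode n m (x : lf n m) : seq entry :=
  [seq mkentry (nth a0 (faddrs x.1.1) (x.1.2^-1%g j)) (x.2 j) | j <- enum 'I_m].

Lemma size_lcode n m (x : lf n m) : size (lcode x) = m.
Proof. by rewrite size_map size_enum_ord. Qed.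

Lemma nth_lcode n m (x : lf n m) (j : 'I_m) :
  nth e0 (lcode x) j = mkentry (nth a0 (faddrs x.1.1) (x.1.2^-1%g j)) (x.2 j).
Proof. exact: nth_map_ord. Qed.

Lemma mem_lcode_addr n m (x : lf n m) : map fst (lcode x) =i faddrs x.1.1.
Proof.
move=> a; apply/mapP/(nthP a0) => [[e /mapP[j _ ->] ->] /=|[ i]].
  exists (x.1.2^-1%g j); first by rewrite size_faddrs.
  by rewrite /mkentry /=; case: (nth _ _ _).
rewrite size_faddrs => lti <-; pose j := x.1.2 (Ordinal lti).
exists (nth e0 (lcode x) j); first by rewrite mem_nth ?size_lcode.
by rewrite nth_lcode permK /=; case: (nth _ _ _).
Qed.

Lemma lcode_code n m (x : lf n m) : iscode n (lcode x).
Proof.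
split.
  apply/allP => e ex; apply: (@faddrs_lt _ _ x.1.1 e.1); rewrite -mem_lcode_addr.
  exact: map_f.
have [d hd] := forest_code x.1.1; exists d => r w ltr dw.
rewrite -[RHS](hd r w ltr dw) -!sum1_count big_map big_enum_cond /=.
rewrite (big_nth a0) size_faddrs big_mkord [RHS](reindex_inj (@perm_inj _ x.1.2^-1%g)).
by apply: eq_bigl => j; rewrite /hit /ahit.
Qed.

Lemma lcode_inj n m : injective (@lcode n m).
Proof.
move=> x y e; have ef : x.1.1 = y.1.1.
  by apply: faddrs_inj => a; rewrite -!mem_lcode_addr e.
have ej j : mkentry (nth a0 (faddrs x.1.1) (x.1.2^-1%g j)) (x.2 j) =
    mkentry (nth a0 (faddrs y.1.1) (y.1.2^-1%g j)) (y.2 j).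
  by rewrite -!nth_lcode e.
case: x y ef ej {e} => [[f s] g] [[f' s'] g'] /= ef ej; subst f'; congr (_, _, _).
  apply: invg_inj; apply/permP => j; apply: val_inj; apply/eqP.
  rewrite -(nth_uniq a0 _ _ (uniq_faddrs f)) ?size_faddrs ?ltn_ord //; apply/eqP.
  by have := ej j; rewrite /mkentry; case: (nth _ _ _) (nth _ _ _) => a b [a' b'] [-> ->].
by apply/ffunP => j; have := ej j; rewrite /mkentry => -[].
Qed.

(** The set of addresses determines the forest through [tree_of]; the order in which [s] lists them,
    compared with the order from left to right, is the permutation. *)
Lemma lcode_surj n m (s : seq entry) : iscode n s -> size s = m -> exists x : lf n m, lcode x = s.
Proof.
move=> cs ss; pose S (r : 'I_n) w := has (fun e : entry => e.1 == (val r, w)) s.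
have SP (r : 'I_n) w : reflect (exists2 i, i < size s & (nth e0 s i).1 = (val r, w)) (S r w).
  by apply: (iffP (has_nthP e0)) => -[i lti /eqP e]; exists i => //; apply/eqP.
have [d hd] := code_hit cs.
pose ts : n.-tuple (ktree k) := [tuple tree_of d (S r) | r < n].
have tsS r w : (w \in addrs (tnth ts r)) = S r w.
  rewrite tnth_mktuple addrs_tree_of // => [v sv|u v /SP[i lti ei] /SP[j ltj ej] uv].
    have [i lti [hi ri wi]] := hd r v (ltn_ord r) (eq_leq (esym sv)).
    exists (nth e0 s i).1.2; first by case/andP: hi.
    by apply/SP; exists i => //; case: (nth e0 s i) ri => -[a b] g /= ->.
  have ij : i = j.
    apply: (code_index k_gt0 (r := val r) (w := v) cs) => //; rewrite /hit ?ei ?ej eqxx //=.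
    exact: prefix_refl.
  by move: ei; rewrite ij ej => -[].
clearbody ts; have us : uniq (map fst s).
  apply/(uniqP a0) => i j; rewrite !inE !size_map => lti ltj.
  by rewrite !(nth_map e0) //; exact: (code_addr_inj k_gt0 cs).
have pe : perm_eq (map fst s) (faddrs ts).
  apply: uniq_perm us (uniq_faddrs ts) _ => -[r w].
  have [ltr|ler] := ltnP r n.
    rewrite -[r]/(val (Ordinal ltr)) mem_faddrs tsS.
    apply/mapP/SP => [[e /(nthP e0)[i lti <-] ->]|[i lti <-]]; first by exists i.
    by exists (nth e0 s i) => //; exact: mem_nth.
  apply/mapP/idP => [[e /(nthP e0)[i lti <-] er]|/faddrs_lt /=]; last by rewrite ltnNge ler.
  by have := code_lt cs lti; rewrite -er ltnNge ler.
have szf : sumn [seq nleaves t | t <- ts] == m.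
  rewrite -ss -(size_map fst) (perm_size pe) size_flatten /seq.shape -map_comp.
  apply/eqP; congr sumn; rewrite -[in LHS](map_tnth_enum ts) -map_comp.
  by apply: eq_map => r; rewrite /= size_map size_addrs.
pose f := Forest szf.
have sf : size (faddrs f) == m by rewrite size_faddrs.
have /tuple_permP[p ep] : perm_eq (map fst s) (Tuple sf) by exact: pe.
exists (f, p^-1%g, [ffun j : 'I_m => (nth e0 s j).2]).
apply: (@eq_from_nth _ e0); rewrite size_lcode ?ss // => j ltj.
rewrite -[j]/(val (Ordinal ltj)) nth_lcode /= invgK ffunE /mkentry /=.
have -> : nth a0 (faddrs ts) (p (Ordinal ltj)) = (nth e0 s j).1.
  rewrite -(nth_map _ a0) ?ss // ep -[j]/(val (Ordinal ltj)) -tnth_nth tnth_mktuple.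
  by rewrite (tnth_nth a0).
by case: (nth _ _ _) => -[].
Qed.

Lemma faddrs_id n : faddrs (id_forest k n) = [seq (r, [::]) | r <- iota 0 n].
Proof.
rewrite /faddrs map_iota_ord.
have -> : [seq [seq (val r, w) | w <- addrs (tnth (id_forest k n) r)] | r <- enum 'I_n] =
  [seq [:: (val r, [::])] | r <- enum 'I_n].
  by apply: eq_map => r; rewrite tnth_mktuple.
by elim: (enum _) => //= a s ->.
Qed.

Lemma lcode_forest n m (f : forest k n m) :
  lcode (of_forest Gamma f) = [seq mkentry a 1%g | a <- faddrs f].
Proof.
apply: (@eq_from_nth _ e0); rewrite size_lcode ?size_map ?size_faddrs // => j ltj.
rewrite -[j]/(val (Ordinal ltj)) nth_lcode (nth_map a0) ?size_faddrs //=.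
by rewrite invg1 perm1 ffunE.
Qed.

Lemma nth_lcode_perm m (s : 'S_m) (j : 'I_m) :
  nth e0 (lcode (of_perm k Gamma s)) j = (val (s^-1%g j), [::], 1%g).
Proof.
by rewrite nth_lcode /= faddrs_id (nth_map 0) ?size_iota // nth_iota // ffunE.
Qed.

Lemma nth_lcode_labels m (g : {ffun 'I_m -> Gamma}) (j : 'I_m) :
  nth e0 (lcode (of_labels k g)) j = (val j, [::], g j).
Proof.
rewrite nth_lcode /= invg1 perm1 faddrs_id (nth_map 0) ?size_iota //.
by rewrite nth_iota.
Qed.

Lemma lcode_id n : lcode (id_forest k n, 1%g, 1%g) = idcode k Gamma n.
Proof.
apply: (@eq_from_nth _ e0); rewrite size_lcode ?size_idcode // => j ltj.
by rewrite -[j]/(val (Ordinal ltj)) (nth_lcode_labels 1%g) nth_idcode // ffunE.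
Qed.

Lemma faddrs_cat n m n' m' (p : forest k n m) (q : forest k n' m') :
  faddrs (cat_forest p q) = faddrs p ++ [seq (n + a.1, a.2) | a <- faddrs q].
Proof.
pose F (ts : seq (ktree k)) r := [seq (r, w) | w <- addrs (nth Leaf ts r)].
have E n0 (t : n0.-tuple (ktree k)) : faddrs t = flatten [seq F t r | r <- iota 0 n0].
  rewrite map_iota_ord /faddrs; congr flatten; apply: eq_map => r.
  by rewrite (tnth_nth Leaf).
rewrite !E iotaD map_cat flatten_cat; congr (_ ++ _).
  congr flatten; apply/eq_in_map => r; rewrite mem_iota /= add0n => ltr.
  by rewrite /F /= nth_cat size_tuple ltr.
have -> : iota (0 + n) n' = [seq n + r | r <- iota 0 n'] by rewrite -iotaDl addn0.
rewrite map_flatten -!map_comp; congr flatten.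
apply: eq_map => r; rewrite /F /= -map_comp nth_cat size_tuple ltnNge leq_addr /= addKn.
by apply: eq_map.
Qed.

Definition lftens n m n' m' (x : lf n m) (y : lf n' m') : lf (n + n') (m + m') :=
  (cat_forest x.1.1 y.1.1, cat_perm x.1.2 y.1.2, cat_ffun x.2 y.2).

Lemma cat_permV m m' (s : 'S_m) (t : 'S_m') : (cat_perm s t)^-1%g = cat_perm s^-1%g t^-1%g.
Proof.
apply/eqP; rewrite -(inj_eq (mulgI (cat_perm s t))) mulgV eq_sym; apply/eqP/permP => i.
rewrite permM !permE /cat_perm_fun; case: (split_ordP i) => a ->.
  by rewrite (unsplitK (inl _ _)) permK.
by rewrite (unsplitK (inr _ _)) permK.
Qed.

Lemma lcode_tens n m n' m' (x : lf n m) (y : lf n' m') :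
  lcode (lftens x y) = tcode n (lcode x) (lcode y).
Proof.
apply: (@eq_from_nth _ e0); rewrite size_lcode ?size_tcode ?size_lcode // => j ltj.
rewrite -[j]/(val (Ordinal ltj)) nth_lcode /= faddrs_cat cat_permV permE /cat_perm_fun ffunE.
rewrite /tcode [in RHS]nth_cat size_lcode; case: (split_ordP (Ordinal ltj)) => a e.
  have -> : j = a by have := congr1 val e.
  by rewrite nth_lcode nth_cat /= size_faddrs ltn_ord.
have -> : j = m + a by have := congr1 val e.
rewrite addKn (nth_map e0) ?size_lcode // nth_lcode nth_cat size_faddrs /=.
by rewrite ltnNge leq_addr /= addKn (nth_map a0) ?size_faddrs.
Qed.

Lemma lfcomp_ex n m l (z : lf m l) (x : lf n m) :
  exists y : lf n l, lcode y = ccode th (lcode z) (lcode x).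
Proof.
apply: lcode_surj; last by rewrite size_ccode size_lcode.
by apply: code_comp => //; rewrite ?size_lcode; exact: lcode_code.
Qed.

(** Since [lcode] is injective with the codes as image, the category laws are inherited from [ccode]
    without computing with cablings. *)
Definition lfcomp n m l (z : lf m l) (x : lf n m) : lf n l :=
  sval (boolp.cid (lfcomp_ex z x)).

Lemma lcode_comp n m l (z : lf m l) (x : lf n m) :
  lcode (lfcomp z x) = ccode th (lcode z) (lcode x).
Proof. exact: (svalP (boolp.cid (lfcomp_ex z x))). Qed.

Definition lfid n : lf n n := (id_forest k n, 1%g, 1%g).

Fact lfcompA a b c d (h : lf c d) (g : lf b c) (f : lf a b) :
  lfcomp h (lfcomp g f) = lfcomp (lfcomp h g) f.
Proof.
apply: lcode_inj; rewrite !lcode_comp (ccodeA thM (n := b)) //; rewrite ?size_lcode; exact: lcode_code.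
Qed.

Fact lfcomp1f a b (f : lf a b) : lfcomp (lfid b) f = f.
Proof. by apply: lcode_inj; rewrite lcode_comp lcode_id -{1}(size_lcode f) ccode1f. Qed.

Fact lfcompf1 a b (f : lf a b) : lfcomp f (lfid a) = f.
Proof. by apply: lcode_inj; rewrite lcode_comp lcode_id (ccodef1 thM) //; exact: lcode_code. Qed.

Definition lfcategory : category_on lf := CategoryOn lfcompA lfcomp1f lfcompf1.

Lemma lcode_cast a a' b b' (ea : a = a') (eb : b = b') (x : lf a b) :
  lcode (cast_hom ea eb x) = lcode x.
Proof. by subst a' b'. Qed.

Fact lftens_id a b : lftens (lfid a) (lfid b) = lfid (a + b).
Proof. by apply: lcode_inj; rewrite lcode_tens !lcode_id tcode_id. Qed.

Fact lftens_comp a b c a' b' c' (g : lf b c) (f : lf a b) (g' : lf b' c') (f' : lf a' b') :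
  lftens (lfcomp g f) (lfcomp g' f') = lfcomp (lftens g g') (lftens f f').
Proof.
apply: lcode_inj; rewrite lcode_tens !lcode_comp !lcode_tens tcode_comp ?size_lcode //; exact: lcode_code.
Qed.

Fact lftensA a b c a' b' c' (f : lf a a') (g : lf b b') (h : lf c c') :
  cast_hom (addnA a b c) (addnA a' b' c') (lftens f (lftens g h)) = lftens (lftens f g) h.
Proof. by apply: lcode_inj; rewrite lcode_cast !lcode_tens tcodeA. Qed.

Fact lftens1f a b (f : lf a b) : cast_hom (add0n a) (add0n b) (lftens (lfid 0) f) = f.
Proof. by apply: lcode_inj; rewrite lcode_cast lcode_tens lcode_id tcode0. Qed.

Fact lftensf1 a b (f : lf a b) : cast_hom (addn0 a) (addn0 b) (lftens f (lfid 0)) = f.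
Proof. by apply: lcode_inj; rewrite lcode_cast lcode_tens lcode_id /tcode cats0. Qed.

Definition lfmonoidal : strict_monoidal_on lf addn 0 :=
  @StrictMonoidalOn nat lf addn 0 lfcategory lftens addnA add0n addn0 lftens_id lftens_comp
    lftensA lftens1f lftensf1.

End LeafMap.

(** * The diagram rules, and uniqueness of the composition *)

Section Rules.
Variables (k : nat) (Gamma : groupType) (th : Gamma -> Gamma).
Hypothesis k_gt0 : 0 < k.
Hypothesis thM : {morph th : x y / (x * y)%g}.

Local Notation lf := (lforest k Gamma).
Local Notation e0 := (e0 k Gamma).
Local Notation a0 := (a0 k).
Local Notation lfmonoidal := (lfmonoidal k_gt0 thM).
Local Notation lfcomp := (lfcomp th k_gt0).

Lemma lcode_eq n m (x y : lf n m) :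
  (forall j : 'I_m, nth e0 (lcode x) j = nth e0 (lcode y) j) -> x = y.
Proof.
move=> e; apply: lcode_inj; apply: (@eq_from_nth _ e0); rewrite !size_lcode // => j ltj.
exact: (e (Ordinal ltj)).
Qed.

Lemma nth_comp n m l (z : lf m l) (x : lf n m) (j : 'I_l) :
  nth e0 (lcode (lfcomp z x)) j = graftE th (lcode x) (nth e0 (lcode z) j).
Proof. by rewrite lcode_comp nth_ccode ?size_lcode. Qed.

Lemma nth_lcode_forest n m (f : forest k n m) (j : 'I_m) :
  nth e0 (lcode (of_forest Gamma f)) j = mkentry (nth a0 (faddrs f) j) 1%g.
Proof. by rewrite lcode_forest (nth_map a0) ?size_faddrs. Qed.

Lemma faddrs_lt_nth n m (f : forest k n m) (j : 'I_m) : (nth a0 (faddrs f) j).1 < n.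
Proof. by apply: (@faddrs_lt _ _ f); rewrite mem_nth ?size_faddrs. Qed.

Lemma nth_labels_comp n m (g : {ffun 'I_m -> Gamma}) (x : lf n m) (j : 'I_m) :
  nth e0 (lcode (lfcomp (of_labels k g) x)) j =
  ((nth e0 (lcode x) j).1, g j * (nth e0 (lcode x) j).2)%g.
Proof.
by rewrite nth_comp nth_lcode_labels /graftE /= cats0; case: (nth _ _ _) => -[].
Qed.

Lemma nth_perm_comp n m (s : 'S_m) (x : lf n m) (j : 'I_m) :
  nth e0 (lcode (lfcomp (of_perm k Gamma s) x)) j = nth e0 (lcode x) (s^-1%g j).
Proof.
by rewrite nth_comp nth_lcode_perm /graftE /= cats0 mul1g; case: (nth _ _ _) => -[].
Qed.

Lemma faddrs_perm n m (p : forest k n m) (tau : 'S_n) (r : 'I_m) :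
  let a := nth a0 (faddrs (perm_forest tau p)) r in
  forall i : 'I_n, val i = a.1 ->
  nth a0 (faddrs p) (cabling p tau r) = (val (tau i), a.2).
Proof.
set q := perm_forest tau p => a i.
pose i0 : 'I_n := cabling_root p tau r.
pose j := reshape_offset (shape q) r.
have er : r = flatten_index (shape q) i0 j :> nat.
  by rewrite [RHS](reshape_indexK (shape q) r).
have ltj : j < nleaves (tnth p (tau i0)).
  have := @reshape_offsetP (shape q) r; rewrite sumn_shape ltn_ord => /(_ isT).
  rewrite -[reshape_index _ _]/(val i0) -tnth_nth tnth_map /= tnth_mktuple; exact.
have ltj' : j < nleaves (tnth q i0) by rewrite tnth_mktuple.
have -> : a = (val i0, nth [::] (addrs (tnth q i0)) j).
  by rewrite /a er nth_faddrs.
rewrite (cablingE ltj er) nth_faddrs //= => ei.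
by have -> : i = i0 by [exact: val_inj]; rewrite tnth_mktuple.
Qed.

Lemma lfmonoidal_rules : diagram_rules lfmonoidal.
Proof.
split=> /=.
- move=> n m f s g; apply: lcode_eq => j.
  by rewrite nth_labels_comp nth_perm_comp nth_lcode_forest nth_lcode /= mulg1.
- move=> n m l f q; apply: lcode_inj; rewrite lcode_comp !lcode_forest faddrs_stack /ccode.
  rewrite -!map_comp; apply/eq_in_map => a fa; rewrite /= /graftE /=.
  have lta : a.1 < m by exact: faddrs_lt fa.
  by rewrite (nth_map a0) ?size_faddrs //= (push1 thM) mulg1.
- move=> m s t; apply: lcode_eq => j.
  by rewrite nth_perm_comp !nth_lcode_perm invMg permM.
- move=> m g h; apply: lcode_eq => j.
  by rewrite nth_labels_comp !nth_lcode_labels /= ffunE.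
- move=> n m p tau; apply: lcode_eq => j.
  rewrite nth_perm_comp nth_lcode_forest nth_comp nth_lcode_forest.
  pose r := ((cabling p tau)^-1%g j); have -> : j = cabling p tau r by rewrite permKV.
  rewrite permK; pose a := nth a0 (faddrs (perm_forest tau p)) r.
  have lta : a.1 < n by exact: faddrs_lt_nth.
  rewrite (@faddrs_perm _ _ _ _ _ (Ordinal lta)) // /graftE /mkentry /=.
  rewrite nth_lcode_perm permK /= (push1 thM) mulg1 -/a.
  by [].
- move=> m s g; apply: lcode_eq => j.
  by rewrite nth_perm_comp nth_labels_comp !nth_lcode_labels nth_lcode_perm /= ffunE mulg1.
- by [].
Qed.

Lemma faddrs_corolla : faddrs (corolla k) = [seq (0, [:: i]) | i <- enum 'I_k].
Proof.
have e1 : enum 'I_1 = [:: ord0] by rewrite enum_ordSl enum_ord0.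
have -> : faddrs (corolla k) =
    [seq (0, w) | w <- addrs (Node [ffun _ : 'I_k => Leaf])] by rewrite /faddrs e1 /= cats0.
rewrite [addrs _]/=; elim: (enum 'I_k) => //= i s IH.
by rewrite map_cat IH ffunE.
Qed.

Lemma lfmonoidal_corolla : corolla_relation th lfmonoidal.
Proof.
move=> g; apply: lcode_eq => j /=.
rewrite nth_comp nth_labels_comp !nth_lcode_forest faddrs_corolla nth_map_ord /graftE /=.
have := nth_lcode_labels k [ffun _ : 'I_1 => g] ord0 => /= ->.
rewrite !ffunE /push /= mul1g mulg1 andbT.
by case: ifP.
Qed.

Section Push.
Implicit Types C : strict_monoidal_on lf addn 0.

(* The point is that [h] does not depend on [C]. *)
Definition pushable n m (f : forest k n m) := forall g, exists h, forall C,
  diagram_rules C -> corolla_relation th C ->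
  ccomp C (of_forest Gamma f) (of_labels k g) = ccomp C (of_labels k h) (of_forest Gamma f).

(** Comparing bare lists of trees avoids transports along equalities of the indices. *)
Lemma pushable_trees n m n' m' (f : forest k n m) (f' : forest k n' m') :
  tval (trees f) = tval (trees f') -> pushable f -> pushable f'.
Proof.
move=> e; have en : n = n' by rewrite -(size_tuple f) e size_tuple.
have em : m = m'.
  by rewrite -(eqP (leaf_count f)) -(eqP (leaf_count f')) e.
subst n' m'; have -> // : f = f'; apply: faddrs_inj => a.
by have -> : trees f = trees f' by apply: val_inj.
Qed.

Lemma pushable_id n : pushable (id_forest k n).
Proof.
(* The identity forest and the trivial labelling are the same triple, so the rule for labels
   applies. *)
move=> g; exists g => C rC _; rewrite -[of_forest _ _]/(of_labels k (1%g : {ffun 'I_n -> Gamma})).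
by rewrite !(rule_labels rC) mulg1 mul1g.
Qed.

Lemma pushable_corolla : pushable (corolla k).
Proof.
move=> g; exists [ffun i : 'I_k => if val i == 0 then th (g ord0) else 1%g] => C _ cC.
rewrite -(cC (g ord0)); congr (ccomp _ _ (of_labels k _)).
by apply/ffunP => i; rewrite ffunE ord1.
Qed.

Lemma pushable_stack n m l (f : forest k m l) (q : forest k n m) :
  pushable f -> pushable q -> pushable (stack f q).
Proof.
move=> pf pq g; have [h hq] := pq g; have [h' hf] := pf h; exists h' => C rC cC.
by rewrite -(rule_forest rC) -ccompA hq // ccompA hf // ccompA.
Qed.

Lemma pushable_cat n m n' m' (f : forest k n m) (f' : forest k n' m') :
  pushable f -> pushable f' -> pushable (cat_forest f f').
Proof.
move=> pf pf' g.
have [h hf] := pf [ffun i => g (lshift n' i)].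
have [h' hf'] := pf' [ffun i => g (rshift n i)].
exists (cat_ffun h h') => C rC cC.
have p1 a b : cat_perm (1%g : 'S_a) (1%g : 'S_b) = 1%g.
  apply/permP => i; rewrite permE perm1 /cat_perm_fun.
  by case: (split_ordP i) => j ->; rewrite perm1.
have f1 a b : cat_ffun (1%g : {ffun 'I_a -> Gamma}) (1%g : {ffun 'I_b -> Gamma}) = 1%g.
  by apply/ffunP => i; rewrite !ffunE; case: fintype.split => j; rewrite ffunE.
have id2 a b : cat_forest (id_forest k a) (id_forest k b) = id_forest k (a + b).
  apply: faddrs_inj => x; rewrite faddrs_cat !faddrs_id iotaD map_cat add0n.
  have -> : iota a b = [seq a + r | r <- iota 0 b] by rewrite -iotaDl addn0.
  by rewrite -!map_comp.
have tf : tens C (of_forest Gamma f) (of_forest Gamma f') = of_forest Gamma (cat_forest f f').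
  by rewrite (rule_tens rC) p1 f1.
have tl a b (u : {ffun 'I_a -> Gamma}) (v : {ffun 'I_b -> Gamma}) :
    tens C (of_labels k u) (of_labels k v) = of_labels k (cat_ffun u v).
  by rewrite (rule_tens rC) p1 id2.
have -> : g = cat_ffun [ffun i => g (lshift n' i)] [ffun i => g (rshift n i)].
  apply/ffunP => i; rewrite ffunE; case: (split_ordP i) => j ->; by rewrite ffunE.
by rewrite -tf -!tl -!tens_comp hf // hf'.
Qed.

Definition fo (s : seq (ktree k)) : forest k (size s) (sumn [seq nleaves t | t <- s]) :=
  @Forest k (size s) _ (in_tuple s) (eqxx _).

Lemma pushable_seq (s : seq (ktree k)) :
  (forall t, List.In t s -> pushable (fo [:: t])) -> pushable (fo s).
Proof.
elim: s => [|t s IH] ps.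
  by apply: (@pushable_trees _ _ _ _ (id_forest k 0)) (@pushable_id 0); rewrite /= enum_ord0.
apply: (@pushable_trees _ _ _ _ (cat_forest (fo [:: t]) (fo s))) => //.
apply: pushable_cat; first by apply: ps; left.
by apply: IH => u us; apply: ps; right.
Qed.

(** A tree that is not a leaf is the forest of its children stacked on a corolla, for which the
    corolla relation applies. *)
Lemma pushable_tree t : pushable (fo [:: t]).
Proof.
elim/ktree_ffun_ind: t => [|c IH].
  by apply: (@pushable_trees _ _ _ _ (id_forest k 1)) (@pushable_id 1); rewrite /= enum_ordSl enum_ord0.
pose s := [seq c i | i <- enum 'I_k].
have szs : size s = k by rewrite size_map size_enum_ord.
have sP : sumn [seq nleaves t | t <- tcast szs (in_tuple s)] == sumn [seq nleaves t | t <- s].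
  by rewrite val_tcast.
pose fs : forest k k _ := Forest sP.
have pfs : pushable fs.
  apply: (@pushable_trees _ _ _ _ (fo s)); first by rewrite /= val_tcast.
  apply: pushable_seq => t; rewrite /s => /List.in_map_iff[i [<- _]]; exact: IH.
apply: (@pushable_trees _ _ _ _ (stack fs (corolla k))) (pushable_stack pfs pushable_corolla).
rewrite /= enum_ordSl enum_ord0 /=; congr [:: Node _].
apply/ffunP => i; rewrite !ffunE /=.
have -> : tval (tcast szs (in_tuple s)) = s by rewrite val_tcast.
have e1 : [seq nleaves ([ffun=> @Leaf k] i') | i' <- enum 'I_k] = nseq k 1.
  rewrite (eq_map (g := fun=> 1)); last by move=> ?; rewrite ffunE.
  by rewrite -[X in nseq X](size_enum_ord k); elim: (enum _) => //= a l ->.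
rewrite /flatten_index /= e1 take_nseq ?(ltnW (ltn_ord i)) // sumn_nseq addn0 add0n mul1n.
by rewrite nth_map_ord.
Qed.

Lemma pushable_all n m (f : forest k n m) : pushable f.
Proof.
apply: (@pushable_trees _ _ _ _ (fo f)) => //; apply: pushable_seq => t _.
exact: pushable_tree.
Qed.

(** Normal form of a composite: [h] is moved through [f] and [s], then [t] through [f]. The result
    does not involve [C], whence uniqueness. *)
Lemma comp_triple C n m l (f : forest k m l) (q : forest k n m) (s : 'S_l) (t : 'S_m)
    (g : {ffun 'I_l -> Gamma}) (h : {ffun 'I_m -> Gamma}) (h' : {ffun 'I_l -> Gamma}) :
    diagram_rules C ->
    ccomp C (of_forest Gamma f) (of_labels k h) = ccomp C (of_labels k h') (of_forest Gamma f) ->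
  ccomp C ((f, s, g) : lf m l) ((q, t, h) : lf n m) =
    (stack (perm_forest t f) q, (cabling f t * s)%g, (g * [ffun i => h' (s^-1%g i)])%g).
Proof.
move=> rC e; rewrite -(rule_triple rC f) -(rule_triple rC q) -(rule_triple rC).
rewrite -(rule_forest rC) -(rule_perm rC) -(rule_labels rC) -!ccompA; congr (ccomp _ _ _).
rewrite (ccompA C (of_forest Gamma f)) e -!ccompA.
rewrite (ccompA C (of_perm k Gamma s)) (rule_perm_labels rC) -!ccompA.
congr (ccomp _ _ (ccomp _ _ _)).
by rewrite (ccompA C (of_forest Gamma f)) (rule_forest_perm rC) -!ccompA.
Qed.

Lemma diagram_rules_uniq C D : diagram_rules C -> corolla_relation th C ->
  diagram_rules D -> corolla_relation th D -> C = D.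
Proof.
move=> rC cC rD cD; apply: strict_monoidal_on_eq => [|a b c d [[f s] g] [[f' s'] g']].
  apply: category_on_eq => n m l [[f s] g] [[q t] h].
  have [h' hh] := pushable_all f h.
  by rewrite (comp_triple _ _ _ _ rC (hh C rC cC)) (comp_triple _ _ _ _ rD (hh D rD cD)).
by rewrite (rule_tens rC) (rule_tens rD).
Qed.
End Push.
End Rules.

(** * Invariant kernels on codes *)

Section Carets.
Variables (k : nat) (Gamma : groupType) (th : Gamma -> Gamma).
Hypothesis k_gt0 : 0 < k.
Hypothesis thM : {morph th : x y / (x * y)%g}.
Hypothesis th_inj : injective th.

Local Notation entry := (entry k Gamma).
Local Notation e0 := (e0 k Gamma).
Implicit Types (u v w : seq 'I_k) (g h : Gamma) (x y z : seq entry) (a : nat * seq 'I_k).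

Definition lab w g : Gamma := if zero_word w then 1%g else g.

(* The forest above the vertex [a], without the label of its leftmost leaf: this
   is what remains of it modulo the right action of [Gamma]. *)
Definition above1 a (e : entry) : option (seq 'I_k * Gamma) :=
  if (e.1.1 == a.1) && prefix a.2 e.1.2 then
    Some (drop (size a.2) e.1.2, lab (drop (size a.2) e.1.2) e.2) else None.

Definition above x a := map (above1 a) x.

Definition inner x : seq (nat * seq 'I_k) :=
  undup (flatten [seq [seq (e.1.1, take t e.1.2) | t <- iota 0 (size e.1.2)] | e <- x]).

(* Composing with [z] on the left merely adds the carets of [z] to those of [x],
   up to a relabelling ([carets_ccode]); hence the number of unmatched carets of two
   codes is invariant under it. *)
Definition carets x := [seq above x a | a <- inner x].

Lemma innerP x a : reflect (exists2 j, j < size x &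
   exists2 s, (nth e0 x j).1 = (a.1, a.2 ++ s) & s != [::]) (a \in inner x).
Proof.
rewrite mem_undup; apply: (iffP flattenP) => [[l /mapP[e ex ->] /mapP[t]]|[j ltj [s es s0]]].
  rewrite mem_iota /= add0n => lt -> /=.
  have /(nthP e0)[j ltj ej] := ex; exists j => //; exists (drop t e.1.2).
    by rewrite ej cat_take_drop; case: (e) => -[].
  by rewrite -size_eq0 size_drop subn_eq0 -ltnNge.
exists [seq (a.1, take t (a.2 ++ s)) | t <- iota 0 (size (a.2 ++ s))].
  by apply/mapP; exists (nth e0 x j); rewrite ?mem_nth // es.
apply/mapP; exists (size a.2); last by rewrite take_size_cat //; case: (a).
rewrite mem_iota /= add0n size_cat -addn1 leq_add2l.
by case: (s) s0.
Qed.

Lemma size_above x a : size (above x a) = size x.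
Proof. exact: size_map. Qed.

Lemma nth_above x a j : j < size x -> nth None (above x a) j = above1 a (nth e0 x j).
Proof. by move=> ltj; rewrite (nth_map e0). Qed.

(** The forest above a vertex remembers the positions of its leaves in [x]; one such leaf with its
    relative address gives the vertex back. Thus vertices can be compared between two codes as
    elements of sets. *)
Lemma above_inj x a b : a \in inner x -> above x a = above x b -> a = b.
Proof.
move=> /innerP[j ltj [s es _]] e; have := congr1 (nth None ^~ j) e.
rewrite !nth_above // /above1 es /= eqxx prefix_prefix /=.
case: ifP => // /andP[/eqP e1 /prefixP[t e2]] [].
rewrite drop_size_cat // e2 drop_size_cat // => est _; move: e2 e1; rewrite est.
move/eqP; rewrite -(inj_eq (can_inj revK)) !rev_cat eqseq_cat // => /andP[_].
by move/eqP/(can_inj revK); case: (a) (b) => a1 a2 [b1 b2] /= -> ->.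
Qed.

Lemma uniq_carets x : uniq (carets x).
Proof. by rewrite map_inj_in_uniq ?undup_uniq // => a b ax _; exact: above_inj. Qed.

Lemma prefix_total u v w : prefix u w -> prefix v w -> prefix u v || prefix v u.
Proof.
elim: w u v => [|i w IH] [|a u] [|b v] //=.
by move=> /andP[/eqP -> uw] /andP[/eqP -> vw]; rewrite eqxx /= IH.
Qed.

Lemma leaf_not_inner n x a i : iscode n x -> a \in inner x -> i < size x ->
  (nth e0 x i).1.1 = a.1 -> ~~ prefix (nth e0 x i).1.2 a.2.
Proof.
move=> cx /innerP[j ltj [s es s0]] lti ri; apply/negP => ia.
have ij : i = j.
  apply: (code_index k_gt0 (r := a.1) (w := a.2 ++ s) cx) => //.
    by rewrite /hit ri eqxx prefix_catl.
  by rewrite /hit es eqxx prefix_refl.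
move: ia; rewrite ij es /= => /size_prefix; rewrite size_cat.
by case: (s) s0 => //= *; lia.
Qed.

Definition lift1 (d : seq (option (seq 'I_k * Gamma))) (e : entry) :=
  if nth None d e.1.1 is Some (w, g) then
    Some (w ++ e.1.2, lab (w ++ e.1.2) (e.2 * push th e.1.2 g)%g) else None.

Definition lift z d := map (lift1 d) z.

(** Erasing the leftmost label commutes with composition: that label can only reach the leftmost
    leaf of the composite, where it is erased as well. *)
Lemma above_lift n z x a : iscode n x -> iscode (size x) z -> a \in inner x ->
  above (ccode th z x) a = lift z (above x a).
Proof.
move=> cx [/allP hz _] ax; rewrite /above /ccode /lift -map_comp.
apply/eq_in_map => e /hz lte; rewrite /lift1 nth_above // /above1 /graftE /=.
have [er|] := eqVneq (nth e0 x e.1.1).1.1 a.1 => //=.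
have nl := leaf_not_inner cx ax lte er.
move: (nth e0 x e.1.1) nl => [[r v] g] /= nl.
have -> : prefix a.2 (v ++ e.1.2) = prefix a.2 v.
  apply/idP/idP => [h|]; last exact: prefix_catl.
  by have := prefix_total (prefix_prefix v e.1.2) h; rewrite (negbTE nl).
case: ifP => // /prefixP[w ->]; rewrite -catA !drop_size_cat //.
congr Some; congr pair; rewrite /lab zero_word_cat.
case: (zero_word w) => //=; case zu: (zero_word e.1.2) => //.
by rewrite /push zu.
Qed.

(** Of the leaves above the vertex, only the leftmost can receive the label of the leaf [i] of [x],
    and its label is erased; hence nothing of [x] remains. *)
Lemma above_graft n z x i u : iscode n x -> iscode (size x) z -> (i, u) \in inner z ->
  i < size x ->
  above (ccode th z x) ((nth e0 x i).1.1, (nth e0 x i).1.2 ++ u) = above z (i, u).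
Proof.
move=> cx [/allP hz _] uz lti; rewrite /above /ccode -map_comp.
apply/eq_in_map => e /hz lte; rewrite /= /above1 /graftE /=.
have [->|ne] := eqVneq e.1.1 i; last first.
  case: ifP => // /andP[/eqP er /catl_prefix h]; case/eqP: ne.
  apply: (code_index k_gt0 (r := (nth e0 x i).1.1) (w := (nth e0 x e.1.1).1.2 ++ e.1.2) cx) => //.
    by rewrite /hit er eqxx prefix_prefix.
  by rewrite /hit eqxx h.
rewrite eqxx /= prefix_catr // eqxx /=; case: ifP => // /prefixP[w ->].
rewrite catA !drop_size_cat //; congr Some; congr pair; rewrite /lab.
by case zw_: (zero_word w) => //; rewrite /push zero_word_cat zw_ andbF mulg1.
Qed.

Lemma inner_ccode n z x a : iscode n x -> iscode (size x) z ->
  a \in inner (ccode th z x) <-> (a \in inner x \/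
    exists i u, [/\ i < size x, (i, u) \in inner z &
      a = ((nth e0 x i).1.1, (nth e0 x i).1.2 ++ u)]).
Proof.
move=> cx cz; have [/(all_nthP e0) hz _] := cz; split.
  move=> /innerP[j]; rewrite size_ccode => ltj [s]; rewrite nth_ccode // /graftE.
  have := hz _ ltj; case ez: (nth e0 z j) => [[i u] h] /= lti [er ev] s0.
  have pa : prefix a.2 ((nth e0 x i).1.2 ++ u) by rewrite ev prefix_prefix.
  have := prefix_total (prefix_prefix _ _) pa => /orP[/prefixP[t et]|/prefixP[t et]].
    right; exists i, t; split=> //; last by case: (a) er et => a1 a2 /= -> ->.
    apply/innerP; exists j => //; exists s => //; rewrite ez /=; congr pair.
    by move/eqP: ev; rewrite et -catA eqseq_cat // eqxx => /eqP.
  have [t0|t0] := eqVneq t [::].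
    right; exists i, [::]; split=> //; last by rewrite cats0 et t0 cats0; case: (a) er => a1 a2 /= ->.
    apply/innerP; exists j => //; exists s => //; rewrite ez /=; congr pair.
    by move/eqP: ev; rewrite et t0 cats0 eqseq_cat // eqxx => /eqP.
  left; apply/innerP; exists i => //; exists t => //.
  by case: (nth e0 x i) er et => -[r v] g /= -> ->.
case=> [/innerP[i lti [s es s0]]|[i [u [lti /innerP[j ltj [s es s0]] ->]]]].
  have [j [ltj ej zj]] := code_zero k_gt0 cz lti.
  apply/innerP; exists j; rewrite ?size_ccode //; rewrite nth_ccode // /graftE ej es /=.
  exists (s ++ (nth e0 z j).1.2); first by rewrite catA.
  by case: (s) s0.
apply/innerP; exists j; rewrite ?size_ccode //; rewrite nth_ccode // /graftE es /=.
by exists s => //; rewrite catA.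
Qed.

Definition normal (d : seq (option (seq 'I_k * Gamma))) :=
  forall i w g, nth None d i = Some (w, g) -> zero_word w -> g = 1%g.

Lemma above_normal x a : normal (above x a).
Proof.
move=> i w g; have [lti|lei] := ltnP i (size x); last by rewrite nth_default ?size_above.
rewrite nth_above // /above1; case: ifP => // _ [<- <-] z.
by rewrite /lab z.
Qed.

(** As for [ccode_mono], the leaf reached by zeros gives the data back. Labels at words of zeros are
    lost in [lift], but [normal] makes them trivial. *)
Lemma lift_inj m z d d' : iscode m z -> size d = m -> size d' = m ->
  normal d -> normal d' -> lift z d = lift z d' -> d = d'.
Proof.
move=> cz sd sd' nd nd' e; apply: (@eq_from_nth _ None); rewrite ?sd ?sd' // => i lti.
have [j [ltj ej zj]] := code_zero k_gt0 cz lti.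
have := congr1 (nth None ^~ j) e; rewrite !(nth_map e0) // /lift1 ej.
case di: (nth None d i) => [[w g]|]; case di': (nth None d' i) => [[w' g']|] // [].
move/eqP; rewrite -(inj_eq (can_inj revK)) !rev_cat eqseq_cat // => /andP[_].
move=> /eqP/(can_inj revK) ww; subst w'; rewrite /lab zero_word_cat zj andbT.
case zw_: (zero_word w); first by move=> _; rewrite (nd i w g) // (nd' i w g').
by rewrite /push zj => /mulgI/(iter_th_inj th_inj) ->.
Qed.

Lemma carets_ccode n z x : iscode n x -> iscode (size x) z ->
  perm_eq (carets (ccode th z x)) (map (lift z) (carets x) ++ carets z).
Proof.
move=> cx cz.
have sub2 b : b \in inner z -> exists2 a, a \in inner (ccode th z x) &
    above (ccode th z x) a = above z b /\ ~ (a \in inner x).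
  case: b => i u bz; have /innerP[j ltj [s es s0]] := bz.
  have lti : i < size x by have [/(all_nthP e0) hz _] := cz; have := hz _ ltj; rewrite es.
  exists ((nth e0 x i).1.1, (nth e0 x i).1.2 ++ u).
    by apply/(inner_ccode _ cx cz); right; exists i, u.
  split; first exact: above_graft cx cz bz lti.
  by move=> ax; have := leaf_not_inner cx ax lti erefl; rewrite prefix_prefix.
apply: uniq_perm (uniq_carets _) _ _ => [|d].
  rewrite cat_uniq uniq_carets andbT; apply/andP; split.
    rewrite map_inj_in_uniq ?uniq_carets // => d d' /mapP[a ax ->] /mapP[b bx ->].
    by apply: (lift_inj cz); rewrite ?size_above //; exact: above_normal.
  apply/hasPn => d /mapP[b bz ->]; apply/mapP => -[_ /mapP[a ax ->]].
  rewrite -(above_lift cx cz ax); have [c cz' [<- cx']] := sub2 b bz.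
  by move/(above_inj cz') => ca; apply: cx'; rewrite ca.
rewrite mem_cat; apply/mapP/orP => [[a /(inner_ccode _ cx cz)[ax|[i [u [lti uz ->]]]] ->]|[|]].
- by left; rewrite (above_lift cx cz ax); apply: map_f; apply: map_f.
- by right; rewrite (above_graft cx cz uz lti); apply: map_f.
- move=> /mapP[_ /mapP[a ax ->] ->]; exists a; last by rewrite (above_lift cx cz ax).
  by apply/(inner_ccode _ cx cz); left.
- by move=> /mapP[b bz ->]; have [a az [<- _]] := sub2 b bz; exists a.
Qed.

Definition sdiff (T : eqType) (s t : seq T) :=
  count (fun d => d \notin t) s + count (fun d => d \notin s) t.

Lemma sdiffC (T : eqType) (s t : seq T) : sdiff s t = sdiff t s.
Proof. exact: addnC. Qed.

(** Pigeonhole: the path carries [E.+1] distinct vertices of [x], of which at most [E] are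
    unmatched. *)
Lemma matched_prefix x y r w E : (forall t, t <= E -> (r, take t w) \in inner x) ->
    E < size w -> sdiff (carets x) (carets y) <= E ->
  exists2 t, t <= E & exists2 a, a \in inner y & above x (r, take t w) = above y a.
Proof.
move=> bx ltE dE; apply: contrapT => nt.
have : E.+1 <= count (fun d => d \notin carets y) (carets x).
  rewrite -size_filter -(size_iota 0 E.+1) -(size_map (fun t => above x (r, take t w))).
  apply: uniq_leq_size.
    rewrite map_inj_in_uniq ?iota_uniq // => t t'; rewrite !mem_iota /= !add0n => lt lt'.
    move=> /(above_inj (bx t lt)) [] /(congr1 size).
    by rewrite !size_takel // ltnW // (leq_ltn_trans _ ltE).
  move=> d /mapP[t]; rewrite mem_iota /= add0n ltnS => lt ->.
  rewrite mem_filter; apply/andP; split; last by apply: map_f; exact: bx.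
  by apply/mapP => -[a ax ea]; apply: nt; exists t => //; exists a.
by move/leq_trans/(_ (leq_trans (leq_addr _ _) dE)); rewrite ltnn.
Qed.

(** The carets of [z] occur on both sides and match; those of [x] and [y] are transported by the
    same injective map, and never meet those of [z]. *)
Lemma count_carets n n' z x y : iscode n x -> iscode n' y -> size x = size y ->
    iscode (size x) z ->
  count (fun d => d \notin carets (ccode th z y)) (carets (ccode th z x)) =
  count (fun d => d \notin carets y) (carets x).
Proof.
move=> cx cy sxy cz; have cz' : iscode (size y) z by rewrite -sxy.
have pm : carets (ccode th z y) =i map (lift z) (carets y) ++ carets z.
  exact/perm_mem/(carets_ccode cy cz').
have pmx := perm_mem (carets_ccode cx cz).
rewrite (seq.permP (carets_ccode cx cz)) count_cat count_map.
rewrite [X in _ + X](eq_in_count (a2 := pred0)) ?count_pred0 ?addn0; last first.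
  by move=> d dz; rewrite /= pm mem_cat dz orbT.
apply/eq_in_count => d dx /=; congr (~~ _).
rewrite pm mem_cat; have [a ax ed] := mapP dx.
have nz : lift z d \notin carets z.
  apply/negP => dz; have := uniq_carets (ccode th z x).
  rewrite (perm_uniq (carets_ccode cx cz)) cat_uniq => /and3P[_ /hasPn h _].
  by have := h _ dz; rewrite /= map_f.
rewrite (negbTE nz) orbF; apply/mapP/idP => [[d' dy]|dy]; last by exists d.
have [b bY ed'] := mapP dy.
by move/(lift_inj cz) => -> //; rewrite ?ed ?ed' ?size_above //; exact: above_normal.
Qed.

Lemma sdiff_carets n n' z x y : iscode n x -> iscode n' y -> size x = size y ->
    iscode (size x) z ->
  sdiff (carets (ccode th z x)) (carets (ccode th z y)) = sdiff (carets x) (carets y).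
Proof.
move=> cx cy sxy cz; rewrite /sdiff (count_carets cx cy) //.
by rewrite (count_carets cy cx) // -sxy.
Qed.
End Carets.

(** * Kernels of symmetric differences *)

Section PsdMore.
Local Open Scope ring_scope.
Variables (C : numClosedFieldType).

Lemma psd_comp (X Y : Type) (K : Y -> Y -> C) (f : X -> Y) :
  psd K -> psd (fun x y => K (f x) (f y)).
Proof.
move=> pK v; have := pK [seq (p.1, f p.2) | p <- v]; rewrite !kformE big_map.
by congr (0 <= _); apply: eq_bigr => p _; rewrite big_map.
Qed.

(** Positivity only tests finitely many points, so auxiliary bounds and index sets may depend on
    them. *)
Lemma psd_local (X : Type) (K : X -> X -> C) :
    (forall w : seq X, exists2 L, psd L & forall x0 i j, (i < size w)%N -> (j < size w)%N ->
       K (nth x0 w i) (nth x0 w j) = L (nth x0 w i) (nth x0 w j)) -> psd K.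
Proof.
move=> KL v; have [L pL e] := KL [seq p.2 | p <- v].
have := pL v; congr (0 <= _); case: v e => [|p0 v'] e; first by rewrite !kformE !big_nil.
move: (p0 :: v') e => v e; rewrite !kformE !(big_nth p0) !big_mkord.
apply: eq_bigr => i _; rewrite !(big_nth p0) !big_mkord; apply: eq_bigr => j _.
congr (_ * _); have := e p0.2 i j.
by rewrite size_map !(nth_map p0) // => ->.
Qed.

Lemma psd_bool (X : Type) (b : X -> bool) (al : C) : 0 <= al -> al <= 1 ->
  psd (fun x y => if b x == b y then 1 else al).
Proof.
move=> al0 al1; apply: (@psd_ext _ _ (fun x y => al * 1 + (1 - al) *
   ((b x)%:R * ((b y)%:R)^* * 1 + (~~ b x)%:R * ((~~ b y)%:R)^* * 1))).
  by move=> x y; case: (b x); case: (b y); rewrite /= ?conjC0 ?conjC1; ring.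
apply: psdD; first by apply: psdZ => //; exact: psd1.
apply: psdZ; first by rewrite subr_ge0.
apply: psdD.
  exact: (psd_conj_mul (fun x => (b x)%:R) (@psd1 C X)).
exact: (psd_conj_mul (fun x => (~~ b x)%:R) (@psd1 C X)).
Qed.

(** The power is a product of kernels [psd_bool], one for the membership of each element of the
    finite union [Z]. *)
Lemma psd_sdiff (X : Type) (T : eqType) (A : X -> seq T) (al : C) :
  0 <= al -> al <= 1 -> (forall x, uniq (A x)) ->
  psd (fun x y => al ^+ sdiff (A x) (A y)).
Proof.
move=> al0 al1 uA; apply: psd_local => w.
pose Z := undup (flatten [seq A x | x <- w]).
exists (fun x y => \prod_(z <- Z) if (z \in A x) == (z \in A y) then 1 else al).
  by apply: psd_prod => z _; exact: (psd_bool (fun x => z \in A x)).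
move=> x0 i j lti ltj; have sub l : (l < size w)%N -> {subset A (nth x0 w l) <= Z}.
  move=> ltl d dA; rewrite mem_undup; apply/flattenP; exists (A (nth x0 w l)) => //.
  by apply/(nthP (A x0)); exists l; rewrite ?size_map // (nth_map x0).
have cnt (s t : seq T) : uniq s -> {subset s <= Z} ->
    count (fun d => d \notin t) s = count (fun d => (d \in s) && (d \notin t)) Z.
  move=> us sZ.
  rewrite -!size_filter; apply/perm_size/uniq_perm.
  - exact: filter_uniq.
  - by rewrite filter_uniq // undup_uniq.
  - move=> d; rewrite !mem_filter /=; case ds: (d \in s); rewrite ?andbF ?andbT //=.
    by rewrite (sZ _ ds) andbT.
rewrite /sdiff (cnt _ _ (uA _) (sub i lti)) (cnt _ _ (uA _) (sub j ltj)).
elim: Z {sub cnt} => [|z Z IH]; first by rewrite big_nil expr0.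
rewrite big_cons -IH /= !addnA.
set a := count _ Z; set b := count _ Z.
by case: (z \in _); case: (z \in _); rewrite /= ?mul1r ?addn0 ?add0n -?exprS //; congr (_ ^+ _); lia.
Qed.
End PsdMore.

(** * The averaged kernel on labels *)

Section Kappa.
Local Open Scope ring_scope.
Variables (Gamma : groupType) (th : Gamma -> Gamma).
Hypothesis thM : {morph th : x y / (x * y)%g}.
Hypothesis th_inj : injective th.
Variables (C : numClosedFieldType) (phi : Gamma -> C).
Hypothesis phi_psd : psd (fun g h : Gamma => phi (h^-1 * g)%g).
Hypothesis phi1 : phi 1%g = 1.

Lemma norm_phi g : `|phi g| <= 1.
Proof.
have := psd_CS g 1%g phi_psd; rewrite !mulVg phi1 invg1 mul1g mulr1.
by rewrite expr_le1.
Qed.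

(* [phi] transported to the image of [th^n], extended by zero. *)
Definition phi_sub (n : nat) (g : Gamma) : C :=
  if pselect (exists d, iter n th d = g) is left e then phi (sval (boolp.cid e)) else 0.

Lemma phi_sub_iter n d : phi_sub n (iter n th d) = phi d.
Proof.
rewrite /phi_sub; case: pselect => [e|[]]; last by exists d.
by rewrite (iter_th_inj th_inj (svalP (boolp.cid e))).
Qed.

Lemma phi_sub0 n g : ~ (exists d, iter n th d = g) -> phi_sub n g = 0.
Proof. by rewrite /phi_sub; case: pselect. Qed.

(* The value of [phi] at [th^(j - p) g], where [j - p] may be negative. *)
Definition phit (j p : nat) (g : Gamma) : C :=
  if (p <= j)%N then phi (iter (j - p) th g) else phi_sub (p - j) g.

Lemma phitS j p g : phit j.+1 p.+1 g = phit j p g.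
Proof. by rewrite /phit ltnS !subSS. Qed.

Lemma phit_shift d j p g : phit (j + d) (p + d) g = phit j p g.
Proof. by elim: d => [|d IH]; rewrite ?addn0 // !addnS phitS. Qed.

Lemma phit_th j p g : phit j p.+1 (th g) = phit j p g.
Proof.
rewrite /phit; have [lepj|ltjp] := leqP p j.
  case: (ltngtP p j) lepj => // [ltpj|epj] _.
    by rewrite subnS -iterSr prednK ?subn_gt0.
  by rewrite epj subSnn subnn -[th g]/(iter 1 th g) phi_sub_iter.
rewrite ltnNge (ltnW ltjp) /= subSn 1?ltnW //.
have [[d <-]|ng] := pselect (exists d, iter (p - j) th d = g).
  by rewrite -iterS !phi_sub_iter.
rewrite !phi_sub0 // => -[d /= /th_inj e]; by apply: ng; exists d.
Qed.

Lemma phit_iter m j p g : phit j (p + m) (iter m th g) = phit j p g.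
Proof. by elim: m => [|m IH]; rewrite ?addn0 // addnS iterS phit_th. Qed.

Lemma phit1 j p : phit j p 1%g = 1.
Proof.
rewrite /phit; case: ifP => _; first by rewrite (iter_th1 thM).
by rewrite -(iter_th1 thM (p - j)) phi_sub_iter.
Qed.

Lemma norm_phit j p g : `|phit j p g| <= 1.
Proof.
rewrite /phit; case: ifP => _; first exact: norm_phi.
by rewrite /phi_sub; case: pselect => e; rewrite ?norm_phi // normr0 ler01.
Qed.

(** For negative exponents the kernel vanishes between distinct left cosets of the image of the
    iterate of [th], and within a coset it is the kernel of [phi] in the coordinate on that
    image. *)
Lemma phit_psd j p : psd (fun g h : Gamma => phit j p (h^-1 * g)%g).
Proof.
rewrite /phit; case: (p <= j)%N.
  have := psd_comp (iter (j - p) th) phi_psd; apply: psd_ext => g h.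
  by rewrite (iter_thM thM) (iter_thV thM).
move: (p - j)%N => n.
apply: (@psd_blocks _ _ (fun g h : Gamma => `[< exists d, iter n th d = (h^-1 * g)%g >])).
- by move=> g; apply/asboolP; exists 1%g; rewrite mulVg (iter_th1 thM).
- move=> g h l /asboolP[d ed] /asboolP[d' ed']; apply/asboolP.
  exists (d' * d^-1)%g; rewrite (iter_thM thM) (iter_thV thM) ed ed'.
  by rewrite invgM invgK mulgA mulgK.
- by move=> g h /asboolP ng; exact: phi_sub0.
move=> g v; have [w ->] : exists w : seq (C * Gamma),
    [seq p <- v | `[< exists d, iter n th d = (p.2^-1 * g)%g >]] =
    [seq (p.1, (g * iter n th p.2)%g) | p <- w].
  elim: v => [|[c h] v [w IH]]; first by exists [::].
  rewrite /=; case: asboolP => [[d ed]|_]; last by exists w.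
  exists ((c, d^-1%g) :: w); rewrite /= IH (iter_thV thM) ed.
  by rewrite invgM invgK mulVKg.
have := phi_psd w; congr (0 <= _); rewrite !kformE !big_map.
apply: eq_bigr => q _; rewrite big_map; apply: eq_bigr => r _ /=; congr (_ * _).
rewrite invgM -mulgA mulKg -(iter_thV thM) -(iter_thM thM) phi_sub_iter //.
Qed.

Variable N : nat.
Hypothesis N_gt0 : (0 < N)%N.

(* Averaging over a long window of shifts makes the kernel both invariant under
   [(p, g) |-> (p + 1, th g)] and close to [1]. *)
Definition kappa (x y : nat * Gamma) : C :=
  N%:R^-1 * \sum_(0 <= j < N | (x.1 <= j + y.1 < N + x.1)%N) phit j x.1 (y.2^-1 * x.2)%g.

(** With s = j + P - p, the exponent no longer depends on the points, and the window becomes one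
    condition on [x] and the same condition on [y]: a rank one factor, which makes positivity
    visible. *)
Lemma kappa_window P x y : (x.1 <= P)%N -> (y.1 <= P)%N ->
  kappa x y = N%:R^-1 * \sum_(0 <= s < N + P | (P <= s + x.1 < N + P)%N && (P <= s + y.1 < N + P)%N)
    phit s P (y.2^-1 * x.2)%g.
Proof.
move=> xP yP; congr (_ * _); pose d := (P - x.1)%N.
have z m n : (n <= d)%N || (N + d <= m)%N ->
    \sum_(m <= s < n | (P <= s + x.1 < N + P)%N && (P <= s + y.1 < N + P)%N)
      phit s P (y.2^-1 * x.2)%g = 0.
  move=> mn; rewrite big_nat_cond big_pred0 // => s; apply/negP; rewrite /d in mn.
  by move=> /and3P[h1 h2 h3]; lia.
have dNP : (d <= N + P)%N by rewrite /d; lia.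
have NdNP : (N + d <= N + P)%N by rewrite /d; lia.
rewrite [RHS](big_cat_nat (n := d)) // (z 0%N d) ?leqnn //= add0r.
rewrite [RHS](big_cat_nat (n := (N + d)%N)) ?leq_addl //=.
rewrite (z (N + d)%N (N + P)%N) ?leqnn ?orbT //= addr0 -[in RHS](add0n d) big_addn !add0n addnK.
apply: congr_big_nat => // j /andP[_ ltj]; first by rewrite /d; lia.
by rewrite -(phit_shift d j x.1); congr phit; rewrite /d; lia.
Qed.

Lemma kappa_psd : psd kappa.
Proof.
apply: psd_local => w; pose P := \max_(x <- w) x.1.
pose K s (x y : nat * Gamma) : C := (P <= s + x.1 < N + P)%N%:R * ((P <= s + y.1 < N + P)%N%:R)^* *
   phit s P (y.2^-1 * x.2)%g.
exists (fun x y => N%:R^-1 * \sum_(0 <= s < N + P) K s x y).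
  apply: psdZ; first by rewrite invr_ge0 ler0n.
  apply: psd_sum => s _; apply: (psd_conj_mul (fun x => (P <= s + x.1 < N + P)%N%:R)).
  exact: (psd_comp snd (phit_psd s P)).
move=> x0 i j lti ltj.
have leP l : (l < size w)%N -> ((nth x0 w l).1 <= P)%N.
  move=> ltl; rewrite /P (big_nth x0) big_mkord.
  exact: (leq_bigmax (F := fun l : 'I_(size w) => (nth x0 w l).1) (Ordinal ltl)).
rewrite (kappa_window (leP _ lti) (leP _ ltj)); congr (_ * _).
rewrite big_mkcond; apply: eq_bigr => s _; rewrite /K.
by case: (_ <= _ < _)%N; case: (_ <= _ < _)%N; rewrite /= ?conjC0 ?conjC1 ?mulr0 ?mul0r ?mul1r.
Qed.

Lemma kappa_iter m p q g h :
  kappa ((p + m)%N, iter m th g) ((q + m)%N, iter m th h) = kappa (p, g) (q, h).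
Proof.
congr (_ * _); apply: congr_big => // j /=; first by lia.
by rewrite -(iter_thV thM) -(iter_thM thM) phit_iter.
Qed.

Lemma kappa_mulg p q g h f : kappa (p, (f * g)%g) (q, (f * h)%g) = kappa (p, g) (q, h).
Proof.
by congr (_ * _); apply: eq_bigr => j _ /=; rewrite invgM -mulgA mulKg.
Qed.

Lemma kappa_diag x : kappa x x = 1.
Proof.
rewrite /kappa big_mkcond /= (_ : \sum_(0 <= j < N) _ = \sum_(0 <= j < N) 1).
  by rewrite big_mkord sumr_const card_ord mulVf // pnatr_eq0 -lt0n.
rewrite !big_nat; apply: eq_bigr => j /andP[_ ltj]; rewrite ifT ?mulVg ?phit1 //.
by lia.
Qed.

Lemma norm_kappa x y : `|kappa x y| <= 1.
Proof.
by have := psd_CS x y kappa_psd; rewrite !kappa_diag mulr1 expr_le1.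
Qed.

(** If either height reaches [N], the window leaves only indices below [p], so each term requires
    [g] to be in the image of a positive iterate of [th]. *)
Lemma kappa_far p q g : ~ (exists d, th d = g) -> (N <= p)%N || (N <= q)%N ->
  kappa (p, g) (q, 1%g) = 0.
Proof.
move=> ng pq; rewrite /kappa big_nat_cond big1 ?mulr0 // => j /and3P[/= ltj h1 h2].
rewrite invg1 mul1g /phit; case: ifP => [lepj|/negbT]; first by lia.
rewrite -ltnNge => ltjp; apply: phi_sub0 => -[d ed]; apply: ng.
by exists (iter (p - j).-1 th d); rewrite -iterS prednK ?subn_gt0.
Qed.

Lemma kappa_big p q g (e : C) : 0 < e -> e <= `|kappa (p, g) (q, 1%g)| ->
  exists2 j, (j < N)%N & e <= `|phit j p g|.
Proof.
move=> e0 ek; apply: contrapT => nj.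
have lej j : (j < N)%N -> `|phit j p g| < e.
  move=> ltj; rewrite real_ltNge ?normr_real ?gtr0_real //; apply/negP => h.
  by apply: nj; exists j.
have : `|kappa (p, g) (q, 1%g)| < e; last first.
  by move=> h; have := lt_le_trans h ek; rewrite ltxx.
rewrite normrM normfV normr_nat mulrC ltr_pdivrMr ?ltr0n //.
apply: le_lt_trans (ler_norm_sum _ _ _) _ => /=; rewrite invg1 mul1g.
apply: (@le_lt_trans _ _ (\sum_(0 <= j < N) `|phit j p g|)).
  by rewrite [leLHS]big_mkcond; apply: ler_sum => j _; case: ifP.
rewrite (_ : e * N%:R = \sum_(0 <= j < N) e); last first.
  by rewrite big_mkord sumr_const card_ord mulr_natr.
rewrite !big_mkord; case: (N) N_gt0 lej => // n _ lej.
rewrite !big_ord_recl; apply: ltr_leD; first exact: (lej 0%N).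
by apply: ler_sum => j _; apply/ltW/lej; rewrite /= /bump leq0n; have := ltn_ord j; lia.
Qed.

Lemma phit_finite (e : C) j p : 0 < e -> finite_set [set g | e <= `|phi g|] ->
  finite_set [set g | e <= `|phit j p g|].
Proof.
move=> e0 fin; have [lepj|ltjp] := leqP p j.
  rewrite /phit lepj; apply: (@finite_preimage _ _ [set g | e <= `|phi g|] (iter (j - p) th)) => //.
  by move=> g h _ _; exact: iter_th_inj.
rewrite /phit leqNgt ltjp /=.
apply: (@sub_finite_set _ _ [set iter (p - j) th g | g in [set g | e <= `|phi g|]]).
  move=> g /=; rewrite /phi_sub; case: pselect => [h|_]; last first.
    by rewrite normr0 => /(lt_le_trans e0); rewrite ltxx.
  by move=> eh; exists (sval (boolp.cid h)) => //; exact: (svalP (boolp.cid h)).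
exact: finite_image.
Qed.

(** At most p + q indices are bad, namely [j < p] (negative exponent) and [N <= j + q] (possibly
    outside the window); each costs at most 2, and the others at most [e / 2]. *)
Lemma kappa_close p q g h (e : C) : 0 < e -> (2 * (p + q))%N%:R <= e / 2 * N%:R ->
    (forall r, (r < N)%N -> `|1 - phi (iter r th (h^-1 * g)%g)| <= e / 2) ->
  `|1 - kappa (p, g) (q, h)| <= e.
Proof.
move=> e0 eN er; have Np : 0 < N%:R :> C by rewrite ltr0n.
pose T j : C := if (p <= j + q < N + p)%N then phit j p (h^-1 * g)%g else 0.
have -> : 1 - kappa (p, g) (q, h) = N%:R^-1 * \sum_(0 <= j < N) (1 - T j).
  rewrite sumrB big_mkord sumr_const card_ord mulrBr mulVf ?gt_eqF //.
  by congr (_ - _ * _); rewrite big_mkcond.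
rewrite normrM normfV normr_nat mulrC ler_pdivrMr //.
apply: le_trans (ler_norm_sum _ _ _) _.
apply: (@le_trans _ _ (\sum_(0 <= j < N) (e / 2 + ((j < p) || (N <= j + q))%N%:R * 2))).
  rewrite !big_nat; apply: ler_sum => j /andP[_ ltj].
  have e20 : 0 <= e / 2 by rewrite divr_ge0 // ltW.
  have T2 : `|1 - T j| <= 2.
    apply: (le_trans (ler_normB _ _)); rewrite normr1 -[2]/(1 + 1) lerD2l /T.
    by case: ifP => _; rewrite ?norm_phit // normr0 ler01.
  have [_|] := boolP ((j < p) || (N <= j + q))%N; first by rewrite mul1r (le_trans T2) // lerDr.
  rewrite negb_or -!leqNgt -ltnNge => /andP[lepj ltq]; rewrite mul0r addr0 /T ifT; last by lia.
  rewrite /phit lepj; apply: er; lia.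
rewrite big_split /=. rewrite -[X in _ + X]mulr_suml -natr_sum.
have cnt : (\sum_(0 <= j < N) ((j < p) || (N <= j + q)) <= p + q)%N.
  apply: (@leq_trans (\sum_(0 <= j < N) ((j < p) + (N <= j + q)))%N).
    by apply: leq_sum => j _; case: (j < p)%N; case: (N <= j + q)%N.
  have sumI (P : pred nat) a b : (forall l, P l -> a <= l < b)%N ->
      (\sum_(0 <= l < N) P l <= b - a)%N.
    move=> Pab; rewrite -big_mkcond /= sum1_count -size_filter -(size_iota a (b - a)).
    apply: uniq_leq_size; first by rewrite filter_uniq // iota_uniq.
    by move=> l; rewrite mem_filter mem_iota => /andP[/Pab hl _]; lia.
  rewrite big_split /=; apply: leq_add.
    by rewrite -[leqRHS]subn0; apply: sumI => l ->.
  have -> : (\sum_(0 <= l < N) (N <= l + q) = \sum_(0 <= l < N) ((N <= l + q) && (l < N)))%N.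
    by rewrite !big_nat; apply: eq_bigr => l /andP[_ ->]; rewrite andbT.
  apply: leq_trans (sumI (fun l => (N <= l + q) && (l < N))%N (N - q)%N N _) _; last by lia.
  by move=> l; lia.
rewrite big_mkord sumr_const card_ord -[e / 2 *+ N]mulr_natr.
apply: (@le_trans _ _ (e / 2 * N%:R + e / 2 * N%:R)); last first.
  by rewrite -mulrDl -splitr.
rewrite lerD2l; apply: le_trans eN; rewrite natrM mulrC ler_wpM2l ?ler0n // ler_nat.
exact: cnt.
Qed.
End Kappa.

(** * Full forests, completion, and cancellation of last carets *)

Section FullCodes.
Variables (k : nat) (Gamma : groupType) (th : Gamma -> Gamma).
Hypothesis k_gt0 : 0 < k.
Hypothesis thM : {morph th : x y / (x * y)%g}.
Hypothesis th_inj : injective th.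

Local Notation entry := (entry k Gamma).
Local Notation e0 := (e0 k Gamma).
Local Notation ccode := (ccode th).
Implicit Types (u v w : seq 'I_k) (g h : Gamma) (x y z : seq entry) (a : nat * seq 'I_k).

Definition letter j : 'I_k := Ordinal (ltn_pmod j k_gt0).

Definition caretl m : seq entry :=
  [seq (j %/ k, [:: letter j], 1%g) | j <- iota 0 (m * k)].

Lemma size_caretl m : size (caretl m) = m * k.
Proof. by rewrite size_map size_iota. Qed.

Lemma block_lt m i (c : 'I_k) : i < m -> i * k + c < m * k.
Proof.
move=> lti; apply: (@leq_trans (i.+1 * k)); last by rewrite leq_mul2r lti orbT.
by rewrite mulSn addnC ltn_add2r.
Qed.

Lemma letterE i (c : 'I_k) : letter (i * k + c) = c.
Proof. by apply: val_inj; rewrite /= modnMDl modn_small. Qed.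

Lemma blockE i (c : 'I_k) : (i * k + c) %/ k = i.
Proof. by rewrite divnMDl // divn_small ?addn0. Qed.

Lemma nth_caretl m i (c : 'I_k) : i < m -> nth e0 (caretl m) (i * k + c) = (i, [:: c], 1%g).
Proof.
move=> lti; rewrite (nth_map 0) ?size_iota ?block_lt // nth_iota ?block_lt // add0n.
by rewrite letterE blockE.
Qed.

Lemma blockP j m : j < m * k -> exists i (c : 'I_k), i < m /\ j = i * k + c.
Proof.
move=> ltj; exists (j %/ k), (letter j); rewrite ltn_divLR // ltj; split=> //.
exact: divn_eq.
Qed.

Lemma code_caretl m : iscode m (caretl m).
Proof.
split.
  apply/allP => e /mapP[j]; rewrite mem_iota /= add0n => ltj -> /=.
  by rewrite ltn_divLR.
exists 1 => r [|c w] // ltr _; apply: (@count_eq1 _ _ _ e0 (r * k + c)).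
- by rewrite size_caretl block_lt.
- by rewrite nth_caretl // /hit /= !eqxx prefix0s.
move=> j; rewrite size_caretl => /blockP[i [c' [lti ->]]].
by rewrite nth_caretl // /hit /= => /andP[/eqP -> /andP[/eqP -> _]].
Qed.

Fixpoint fullc n D : seq entry :=
  if D is D'.+1 then ccode (caretl (size (fullc n D'))) (fullc n D') else idcode k Gamma n.

Lemma size_fullcS n D : size (fullc n D.+1) = size (fullc n D) * k.
Proof. by rewrite /= size_ccode size_caretl. Qed.

Lemma code_fullc n D : iscode n (fullc n D).
Proof.
elim: D => [|D IH]; first exact: code_id.
by apply: (code_comp th k_gt0 IH); exact: code_caretl.
Qed.

Lemma fullcP n D j : j < size (fullc n D) ->
  size (nth e0 (fullc n D) j).1.2 = D /\ (nth e0 (fullc n D) j).2 = 1%g.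
Proof.
elim: D j => [|D IH] j; first by rewrite size_idcode => ltj; rewrite nth_idcode.
rewrite size_fullcS => /blockP[i [c [lti ->]]].
rewrite /= nth_ccode ?size_caretl ?block_lt // nth_caretl // /graftE /=.
by have [sz ->] := IH i lti; rewrite size_cat addn1 sz (push1 thM) mulg1.
Qed.

Lemma nth_fullcS n D i (c : 'I_k) : i < size (fullc n D) ->
  nth e0 (fullc n D.+1) (i * k + c) =
  ((nth e0 (fullc n D) i).1.1, rcons (nth e0 (fullc n D) i).1.2 c, 1%g).
Proof.
move=> lti; rewrite /= nth_ccode ?size_caretl ?block_lt // nth_caretl // /graftE /=.
by have [_ ->] := fullcP lti; rewrite (push1 thM) mulg1 cats1.
Qed.

Lemma fullc_count n D r w : r < n -> D <= size w -> count (hit r w) (fullc n D) = 1.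
Proof.
move=> ltr Dw; have cf := code_fullc n D; have [d [fd _]] := code_depth cf.
pose s := w ++ zeros k_gt0 d.
rewrite -(fd r s ltr) /s ?size_cat ?size_nseq ?leq_addl //.
apply/eq_in_count => e /(nthP e0)[j ltj <-]; rewrite /hit; congr andb.
have [sz _] := fullcP ltj; apply/idP/idP => [|]; first exact: prefix_catl.
by rewrite !prefixE take_cat sz; case: ltngtP Dw => // -> _; rewrite subnn take0 cats0 take_size.
Qed.

Lemma full_completion n x : iscode n x -> exists d, forall D, d <= D ->
  exists2 p, iscode (size x) p & ccode p x = fullc n D.
Proof.
move=> cx; have [d [xd bx]] := code_depth cx; exists d => D dD.
pose idx (e : entry) := find (hit e.1.1 e.1.2) x.
have idxP e : e \in fullc n D -> idx e < size x /\ hit e.1.1 e.1.2 (nth e0 x (idx e)).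
  move=> eF; have /(nthP e0)[j ltj ej] := eF.
  have ltr : e.1.1 < n by have [/allP h _] := code_fullc n D; exact: h.
  have hh : has (hit e.1.1 e.1.2) x.
    by rewrite has_count xd // -ej (fullcP ltj).1.
  by split; [rewrite -has_find|exact: nth_find].
(* Each leaf of the full forest lies above a leaf [idx e] of [x]; the label of [p] is the inverse of
   what arrives from there, so that the composite has trivial labels. *)
pose p := [seq (idx e, drop (size (nth e0 x (idx e)).1.2) e.1.2,
  (push th (drop (size (nth e0 x (idx e)).1.2) e.1.2) (nth e0 x (idx e)).2)^-1%g) | e <- fullc n D].
exists p; last first.
  rewrite /p -[LHS]/[seq graftE th x e | e <- _] -map_comp -[RHS]map_id; apply/eq_in_map => e eF.
  have [lti /andP[/eqP ri vi]] := idxP e eF; rewrite /= /graftE /= ri mulVg.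
  rewrite size_prefix_drop //; have /(nthP e0)[j ltj ej] := eF.
  by have [_] := fullcP ltj; rewrite ej; case: (e) => -[r w] g /= ->.
split; first by apply/allP => e' /mapP[e eF ->] /=; exact: (idxP e eF).1.
exists D => i u lti Du.
have ltr := code_lt cx lti.
rewrite -(@fullc_count n D (nth e0 x i).1.1 ((nth e0 x i).1.2 ++ u) ltr); last first.
  by rewrite size_cat (leq_trans Du) // leq_addl.
rewrite count_map; apply/eq_in_count => e eF; rewrite /hit /=.
have [lte he] := idxP e eF; have /andP[/eqP re ve] := he.
apply/andP/andP => [[/eqP ei]|[/eqP er ew]].
  rewrite ei in re ve * => du; rewrite re eqxx; split=> //.
  by rewrite -{1}(size_prefix_drop ve) prefix_catr // eqxx.
have /(nthP e0)[j ltj ej] := eF; have [sz _] := fullcP ltj.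
have vi : prefix (nth e0 x i).1.2 e.1.2.
  move: ew; rewrite -ej !prefixE sz take_cat => /eqP <-.
  have := leq_trans (bx i lti) dD; rewrite leq_eqVlt => /orP[/eqP e1|lt1].
    by rewrite -{1 3}e1 ltnn subnn take0 cats0 take_size.
  by rewrite ltnNge (ltnW lt1) /= take_size_cat.
have ie : idx e = i.
  apply: (code_index k_gt0 cx lte lti he); by rewrite /hit -er eqxx vi.
rewrite ie eqxx; split=> //.
by move: ew; rewrite -{1}(size_prefix_drop vi) prefix_catr // eqxx.
Qed.

(** By the corolla relation, this is a corolla composed with a leaf labelled [h]: these [k] leaves
    can be merged into one. *)
Definition block x i := exists r v h, forall c : 'I_k,
  nth e0 x (i * k + c) = (r, rcons v c, if val c == 0 then th h else 1%g).

Lemma block_factor n m x : iscode n x -> size x = m * k -> (forall i, i < m -> block x i) ->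
  exists x1, [/\ iscode n x1, size x1 = m & x = ccode (caretl m) x1].
Proof.
move=> cx sx bx.
have /boolp.choice[e eP] : forall i, exists e : entry, i < m -> forall c : 'I_k,
    nth e0 x (i * k + c) = (e.1.1, rcons e.1.2 c, if val c == 0 then th e.2 else 1%g).
  move=> i; have [lti|_] := ltnP i m; last by exists e0.
  by have [r [v [h H]]] := bx i lti; exists (r, v, h).
pose x1 := mkseq e m; exists x1.
have sx1 : size x1 = m by rewrite size_mkseq.
have ne i : i < m -> nth e0 x1 i = e i by move=> lti; rewrite nth_mkseq.
split; [|by []|].
- split.
    apply/(all_nthP e0) => i; rewrite sx1 => lti; rewrite ne //.
    have := @code_lt _ _ n x (i * k + letter 0) cx; rewrite sx block_lt // eP //=.
    exact.
  have [d [xd bd]] := code_depth cx; exists d => r w ltr dw.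
  have sz i : i < m -> size (e i).1.2 < size w.
    move=> lti; apply: leq_trans dw; apply: leq_trans (bd (i * k + letter 0) _).
      by rewrite eP //= size_rcons.
    by rewrite sx block_lt.
  have [j ltj [hj uj]] := count1P e0 (xd r w ltr dw).
  have := ltj; rewrite sx => /blockP[i [c [lti ej]]].
  apply: (@count_eq1 _ _ _ e0 i); rewrite ?sx1 // ?ne //.
    move: hj; rewrite ej eP // /hit /= -cats1 => /andP[-> h]; exact: catl_prefix h.
  (* The word is strictly longer than the merged address, so its next letter [c'] selects the leaf
     of [x] in the block [i']. *)
  move=> i'; move=> lti'; rewrite ne // => /andP[er /prefixP[[|c' s] ew]].
    by have := sz i' lti'; rewrite ew cats0 ltnn.
  have : i' * k + c' = j.
    apply: uj; first by rewrite sx block_lt.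
    by rewrite eP // /hit /= er ew -cats1 prefix_catr // eqxx /= eqxx prefix0s.
  by rewrite ej => /(congr1 (divn^~ k)); rewrite !blockE.
- apply: (@eq_from_nth _ e0); rewrite ?size_ccode ?size_caretl // => j; rewrite sx.
  move=> /blockP[i [c [lti ->]]].
  rewrite nth_ccode ?size_caretl ?block_lt // nth_caretl // /graftE /= ne // eP //.
  by rewrite cats1 mul1g /push /= andbT.
Qed.
End FullCodes.

(** * The kernel on codes: invariance, estimates and depth bound *)

Section CodeKernel.
Local Open Scope ring_scope.
Variables (k : nat) (Gamma : groupType) (th : Gamma -> Gamma).
Hypothesis k_gt0 : (0 < k)%N.
Hypothesis thM : {morph th : x y / (x * y)%g}.
Hypothesis th_inj : injective th.
Variables (C : numClosedFieldType) (phi : Gamma -> C).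
Hypothesis phi_psd : psd (fun g h : Gamma => phi (h^-1 * g)%g).
Hypothesis phi1 : phi 1%g = 1.
Variable N : nat.
Hypothesis N_gt0 : (0 < N)%N.
Variable al : C.
Hypothesis al0 : 0 < al.
Hypothesis al1 : al < 1.

Local Notation entry := (entry k Gamma).
Local Notation e0 := (e0 k Gamma).
Local Notation ccode := (ccode th).
Local Notation kappa := (kappa th phi N).
Implicit Types (u v w : seq 'I_k) (x y z : seq entry).

(** Grafting a word of [m] zeros raises this height by [m] while the label undergoes [iter m th], as
    in [kappa_iter]. *)
Definition trailing_zeros w := find (fun i : 'I_k => val i != 0%N) (rev w).

Lemma trailing_zeros_cat w u : trailing_zeros (w ++ u) =
  if zero_word u then (trailing_zeros w + size u)%N else trailing_zeros u.
Proof.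
rewrite /trailing_zeros rev_cat find_cat has_rev.
have -> : has (fun i : 'I_k => val i != 0%N) u = ~~ zero_word u.
  by rewrite /zero_word -has_predC; apply: eq_has.
by case: (zero_word u); rewrite /= ?size_rev // addnC.
Qed.

Definition leaf_point (e : entry) : nat * Gamma := (trailing_zeros e.1.2, e.2).

Definition leaf_kernel x y j := kappa (leaf_point (nth e0 x j)) (leaf_point (nth e0 y j)).

Definition code_kernel x y : C :=
  al ^+ sdiff (carets x) (carets y) * \prod_(j < size x) leaf_kernel x y j.

(** At a leaf of [z] not reached by zeros, the labels of [x] and [y] are lost and both sides give
    the same point, where [kappa] is 1. *)
Lemma leaf_kernel_ccode x y z j (e := nth e0 z j) : (j < size z)%N ->
  leaf_kernel (ccode z x) (ccode z y) j =
    if zero_word e.1.2 then leaf_kernel x y e.1.1 else 1.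
Proof.
move=> ltj; rewrite /leaf_kernel !nth_ccode // -/e /graftE /leaf_point /= !trailing_zeros_cat.
case zu: (zero_word e.1.2); last by rewrite /push zu !mulg1 kappa_diag.
by rewrite (kappa_mulg th phi N) /push zu (kappa_iter thM th_inj).
Qed.

Lemma code_kernel_ccode n n' x y z : iscode n x -> iscode n' y -> size x = size y ->
    iscode (size x) z ->
  code_kernel (ccode z x) (ccode z y) = code_kernel x y.
Proof.
move=> cx cy sxy cz; rewrite /code_kernel (sdiff_carets k_gt0 th_inj cx cy) //.
congr (_ * _); rewrite size_ccode.
pose ix (j : 'I_(size z)) : 'I_(size x) := Ordinal (code_lt cz (ltn_ord j)).
rewrite (eq_bigr _ (fun j _ => leaf_kernel_ccode x y (ltn_ord j))) -big_mkcond /=.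
(* Above each root of [z] there is exactly one leaf reached by zeros, and it contributes the factor
   of the corresponding leaf of [x]. *)
rewrite (partition_big ix xpredT) //=; apply: eq_bigr => i _.
have [j [ltj ej zj]] := code_zero k_gt0 cz (ltn_ord i).
rewrite (big_pred1 (Ordinal ltj)) ?ej // => j' /=; apply/andP/eqP => [[zj' /eqP ij']|->].
  apply: val_inj => /=.
  have ej' : (nth e0 z j').1.1 = i by have := congr1 val ij'.
  have [lea|leb] := leqP (size (nth e0 z j).1.2) (size (nth e0 z j').1.2).
    apply: (code_index k_gt0 (r := val i) (w := (nth e0 z j').1.2) cz) => //.
      by rewrite /hit ej' eqxx prefix_refl.
    rewrite /hit ej eqxx /= (zero_wordP k_gt0 zj) (zero_wordP k_gt0 zj') prefixE size_nseq.
    by rewrite /zeros take_nseq.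
  apply: (code_index k_gt0 (r := val i) (w := (nth e0 z j).1.2) cz) => //.
    rewrite /hit ej' eqxx /= (zero_wordP k_gt0 zj) (zero_wordP k_gt0 zj') prefixE size_nseq.
    by rewrite /zeros take_nseq // ltnW.
  by rewrite /hit ej eqxx prefix_refl.
by split=> //; apply/eqP/val_inj.
Qed.

Lemma code_kernel_psd (X : Type) (f : X -> seq entry) l : (forall x : X, size (f x) = l) ->
  psd (fun x y : X => code_kernel (f x) (f y)).
Proof.
move=> sf; apply: (@psd_ext _ _ (fun x y : X => al ^+ sdiff (carets (f x)) (carets (f y)) *
    \prod_(j < l) leaf_kernel (f x) (f y) j)).
  by move=> x y; rewrite /code_kernel sf.
apply: psdM; first by apply: (psd_sdiff (ltW al0) (ltW al1)) => x; exact: uniq_carets.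
apply: psd_prod => j _.
exact: (psd_comp (fun x : X => leaf_point (nth e0 (f x) j)) (kappa_psd thM th_inj phi_psd N_gt0)).
Qed.

Lemma norm_leaf x y j : `|leaf_kernel x y j| <= 1.
Proof. exact: norm_kappa. Qed.

Lemma norm_code_kernel x y : `|code_kernel x y| <= al ^+ sdiff (carets x) (carets y).
Proof.
rewrite normrM normrX (gtr0_norm al0) ler_piMr ?exprn_ge0 ?(ltW al0) //.
by rewrite normr_prod; apply: prodr_ile1 => j _; rewrite normr_ge0 norm_leaf.
Qed.

Lemma norm_code_kernel_leaf x y j : (j < size x)%N ->
  `|code_kernel x y| <= `|leaf_kernel x y j|.
Proof.
move=> ltj; rewrite normrM; apply: (@le_trans _ _ (1 * `|\prod_(j < size x) leaf_kernel x y j|)).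
  rewrite ler_wpM2r ?normr_ge0 // normrX (gtr0_norm al0).
  by rewrite exprn_ile1 ?(ltW al0) ?(ltW al1).
rewrite mul1r (bigD1 (Ordinal ltj)) //= normrM ler_piMr ?normr_ge0 //.
by rewrite normr_prod; apply: prodr_ile1 => i _; rewrite normr_ge0 norm_leaf.
Qed.

(** Telescoping: the factors have modulus at most 1, so their errors add up. *)
Lemma close_prod (e : C) (I : Type) (r : seq I) (F : I -> C) : 0 <= e ->
  (forall i, `|F i| <= 1) -> (forall i, `|1 - F i| <= e) ->
  `|1 - \prod_(i <- r) F i| <= (size r)%:R * e.
Proof.
move=> e0' F1 Fe; elim: r => [|i r IH]; first by rewrite big_nil subrr normr0 mul0r.
rewrite big_cons /= -natr1 mulrDl mul1r [X in _ <= X]addrC.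
have -> : 1 - F i * \prod_(j <- r) F j = (1 - F i) + F i * (1 - \prod_(j <- r) F j) by ring.
apply: (le_trans (ler_normD _ _)); apply: lerD => //.
by rewrite normrM; apply: (le_trans _ IH); rewrite ler_piMl.
Qed.

Lemma code_kernel_close (e : C) x y : 0 <= e -> 1 - al <= e ->
    (forall j, (j < size x)%N -> `|1 - leaf_kernel x y j| <= e) ->
  `|1 - code_kernel x y| <= (sdiff (carets x) (carets y) + size x)%:R * e.
Proof.
move=> e0' ale le; rewrite /code_kernel; set m := sdiff _ _.
have alr : `|al| <= 1 by rewrite gtr0_norm ?ltW.
have A : `|1 - al ^+ m| <= m%:R * e.
  have := @close_prod e nat (nseq m 0%N) (fun=> al) e0'; rewrite size_nseq big_nseq.
  have -> : iter m ( *%R al) 1 = al ^+ m by elim: m => //= m ->; rewrite exprS.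
  by apply => // _; rewrite ger0_norm // subr_ge0 ltW.
have B : `|1 - \prod_(j < size x) leaf_kernel x y j| <= (size x)%:R * e.
  have -> : \prod_(j < size x) leaf_kernel x y j =
      \prod_(j <- enum 'I_(size x)) leaf_kernel x y j by rewrite big_enum.
  rewrite -[in leRHS](size_enum_ord (size x)); apply: close_prod => // j; first exact: norm_leaf.
  exact: le.
have -> : 1 - al ^+ m * \prod_(j < size x) leaf_kernel x y j =
  (1 - al ^+ m) + al ^+ m * (1 - \prod_(j < size x) leaf_kernel x y j) by ring.
rewrite natrD mulrDl; apply: (le_trans (ler_normD _ _)); apply: lerD => //.
rewrite normrM; apply: (le_trans _ B); rewrite ler_piMl ?normr_ge0 //.
by rewrite normrX exprn_ile1 ?normr_ge0.
Qed.

(* If a block of the full forest of depth [D + 1] does not merge with a caret of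
   [x], none of the vertices below it can be matched with a vertex of [x] unless
   the relative label of its first leaf, which is then reached by zeros only from
   the matched vertex, is not in the image of [th]. *)
Lemma not_block_depth n m D i E x (y := fullc th k_gt0 m D.+1) :
    iscode n x -> size x = size y -> (i < size (fullc th k_gt0 m D))%N ->
    ~ block th x i -> (sdiff (carets x) (carets y) <= E)%N ->
    (forall j, (j < size x)%N -> leaf_kernel x y j != 0) ->
  (D <= N + E)%N.
Proof.
move=> cx sxy lti nb dE nz; rewrite leqNgt; apply/negP => ltD.
pose e := nth e0 (fullc th k_gt0 m D) i.
have [se le] := fullcP thM lti; rewrite -/e in se le.
have yE (c : 'I_k) : nth e0 y (i * k + c) = (e.1.1, rcons e.1.2 c, 1%g).
  exact: nth_fullcS.
have lty (c : 'I_k) : (i * k + c < size y)%N by rewrite size_fullcS block_lt.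
pose b t := (e.1.1, take t e.1.2).
have by_ t : (t <= D)%N -> b t \in inner y.
  move=> letD; apply/innerP; exists (i * k + letter k_gt0 0)%N; first exact: lty.
  exists (drop t (rcons e.1.2 (letter k_gt0 0))).
    by rewrite yE /= -cats1 -{1}(cat_take_drop t (_ ++ _)) takel_cat ?se.
  by rewrite -size_eq0 size_drop size_rcons se; lia.
have yE' t : (t <= E)%N -> b t \in inner y by move=> letE; apply: by_; lia.
have ltE : (E < size e.1.2)%N by rewrite se; lia.
(* Along the path to the block, one of the lowest [E.+1] vertices of the full forest is matched with
   a vertex [a] of [x]. *)
rewrite sdiffC in dE; have [t letE [a ax ea]] := matched_prefix yE' ltE dE.
pose w := drop t e.1.2.
have ew : e.1.2 = take t e.1.2 ++ w by rewrite cat_take_drop.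
have xE (c : 'I_k) : exists2 g, nth e0 x (i * k + c) = (a.1, rcons (a.2 ++ w) c, g) &
    lab (rcons w c) g = 1%g.
  have := congr1 (nth None ^~ (i * k + c)%N) ea.
  have ec : rcons e.1.2 c = take t e.1.2 ++ rcons w c by rewrite -rcons_cat -ew.
  rewrite !nth_above ?sxy ?lty // yE ec {1}/above1 /= eqxx prefix_prefix drop_size_cat //=.
  rewrite /above1; case: (nth e0 x _) => -[r v] g /=; case: ifP => // /andP[/eqP -> /prefixP[s ->]].
  rewrite drop_size_cat // => -[<- el]; exists g; first by rewrite rcons_cat.
  by rewrite -el /lab; case: ifP.
have zc (c : 'I_k) : zero_word (rcons w c) = zero_word w && (val c == 0%N).
  by rewrite -cats1 zero_word_cat /= andbT.
have [g0 x0 _] := xE (letter k_gt0 0).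
have l0 : val (letter k_gt0 0) = 0%N by rewrite /= mod0n.
have xc0 (c : 'I_k) : val c = 0%N -> c = letter k_gt0 0.
  by move=> c0; apply: val_inj; rewrite l0.
(* By the matching, [x] has the addresses of a caret above [a], and trivial labels except possibly
   at its leftmost leaf. The block can only fail through [g0], which is unconstrained when [w] is
   made of zeros. *)
have blk h : (zero_word w -> g0 = th h) -> (~~ zero_word w -> h = 1%g) -> block th x i.
  move=> h1 h2; exists a.1, (a.2 ++ w), h => c.
  have [c0|c0] := eqVneq (val c) 0%N.
    rewrite (xc0 c c0) x0; congr (_, _, _); case zw_: (zero_word w); first exact: h1.
    have [g' e1] := xE (letter k_gt0 0); move: e1; rewrite x0 => -[<-].
    by rewrite /lab zc zw_ /= h2 ?zw_ // (th1 thM).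
  have [g -> lg] := xE c; congr (_, _, _).
  by move: lg; rewrite /lab zc (negbTE c0) andbF.
have [zw_|zw_] := boolP (zero_word w); last by apply: nb; apply: (blk 1%g) => //; rewrite (negbTE zw_).
have ng : ~ (exists d, th d = g0).
  by move=> [d ed]; apply: nb; apply: (blk d) => //; rewrite zw_.
have := nz (i * k + letter k_gt0 0)%N; rewrite sxy lty => /(_ isT)/eqP; apply.
(* This leaf of [x] has at least [D - t + 1] trailing zeros, and [t <= E] with [N + E < D] puts this
   beyond [N]. *)
rewrite /leaf_kernel x0 yE /leaf_point /=; apply: kappa_far => //.
rewrite -cats1 -catA trailing_zeros_cat zero_word_cat zw_ /= mod0n eqxx /= size_cat /= /w size_drop se.
apply/orP; left; lia.
Qed.
End CodeKernel.

(** * The Haagerup property *)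

Section Nets.
Local Open Scope ring_scope.
Local Open Scope complex_scope.
Variable R : realType.

Lemma directed_seq (I : Type) (le : I -> I -> Prop) (X : Type) (P : X -> I -> Prop) (s : seq X) :
  directed le -> (forall x, exists i0, forall i, le i0 i -> P x i) ->
  exists i, forall x, List.In x s -> P x i.
Proof.
move=> dl Px; suff [i0 hi] : exists i0, forall i, le i0 i -> forall x, List.In x s -> P x i.
  by exists i0; apply: hi; exact: (directed_refl dl).
elim: s => [|x s [i0 hi]]; first by have [i _] := directed_inhabited dl; exists i.
have [i1 h1] := Px x; have [i [l0 l1]] := directed_ub dl i0 i1; exists i => j lj y [<-|ys].
  by apply: h1; exact: (directed_trans dl l1).
by apply: hi ys; exact: (directed_trans dl l0).
Qed.

(** The net is indexed by pairs of a finite list and a precision [n.+1%:R^-1], ordered by inclusion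
    and size. *)
Lemma haagerup_of_approx (X : Type) (P : (X -> R[i]) -> Prop) :
  (forall (F : seq X) (e : R), 0 < e -> exists phi, [/\ P phi, vanishes_at_infinity phi &
     forall x, List.In x F -> `|phi x - 1| < e%:C]) -> haagerup_for P.
Proof.
move=> h; pose I := (seq X * nat)%type.
have /boolp.choice[phi hphi] : forall i : I, exists phi, [/\ P phi, vanishes_at_infinity phi &
     forall x, List.In x i.1 -> `|phi x - 1| < (i.2.+1%:R^-1)%:C].
  by move=> [F n]; apply: h; rewrite invr_gt0.
pose le (i j : I) := (forall x, List.In x i.1 -> List.In x j.1) /\ (i.2 <= j.2)%N.
exists I, le, phi; split.
- split.
  + by move=> i; split.
  + by move=> i j l [a b] [c d]; split; [move=> x /a/c|exact: leq_trans d].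
  + by exists ([::], 0%N).
  + move=> [F n] [F' n']; exists (F ++ F', maxn n n').
    split; split=> /=; rewrite ?leq_maxl ?leq_maxr // => x xF; apply/List.in_app_iff; by [left|right].
- by move=> i; have [] := hphi i.
- by move=> i; have [] := hphi i.
move=> x e e0; exists ([:: x], Num.truncn e^-1) => -[F n] [/= xF le_n].
have [_ _ /(_ x)] := hphi (F, n); move=> /(_ (xF x (or_introl erefl))) /lt_le_trans; apply.
rewrite lecR /= invf_ple ?posrE // ltW //; apply: lt_le_trans (truncnS_gt _) _.
by rewrite ler_nat ltnS.
Qed.
End Nets.

Section NormalizedPosdef.
Local Open Scope ring_scope.
Local Open Scope complex_scope.
Variables (R : realType) (Gamma : groupType).

Lemma psd_of_posdef (phi : Gamma -> R[i]) : group_posdef phi ->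
  psd (fun g h : Gamma => phi (h^-1 * g)%g).
Proof.
move=> pphi v; have := pphi (size v) (fun i => (tnth (in_tuple v) i).2)
  (fun i => (tnth (in_tuple v) i).1).
congr (0 <= _); rewrite kformE (big_tnth _ _ v) exchange_big; apply: eq_bigr => i _ /=.
rewrite (big_tnth _ _ v); apply: eq_bigr => j _.
by rewrite [X in _ = X * _]mulrC.
Qed.

Lemma haagerup_normalized (L : seq Gamma) (e : R) : group_haagerup R Gamma -> 0 < e ->
  exists phi : Gamma -> R[i], [/\ psd (fun g h : Gamma => phi (h^-1 * g)%g), phi 1%g = 1,
    forall d : R, 0 < d -> finite_set [set g | d%:C <= `|phi g|]%classic &
    forall g, g \in L -> `|1 - phi g| <= e%:C].
Proof.
move=> [I [le [phi [dl pd vi cv]]]] e0.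
(* Normalization divides by [c], the value at 1, which then exceeds 3/4; the error [2 * eta / c] is
   at most [e]. *)
pose eta : R := Num.min e 1 / 4.
have eta0 : 0 < eta by rewrite divr_gt0 // lt_min e0 ltr01.
have eta4 : 4 * eta = Num.min e 1 by rewrite /eta; field.
have etae : 4 * eta <= e by rewrite eta4 ge_min lexx.
have eta1 : 4 * eta <= 1 by rewrite eta4 ge_min lexx orbT.
have [i hi] := directed_seq (P := fun g i => `|phi i g - 1| < eta%:C) (1%g :: L) dl
  (fun g => cv g eta eta0).
have h1 := hi 1%g (or_introl erefl).
have p0 : 0 <= phi i 1%g.
  have := psd_diag 1%g (psd_of_posdef (pd i)); by rewrite mulVg.
pose c : R := complex.Re (phi i 1%g).
have ec : phi i 1%g = c%:C by rewrite RRe_real // ger0_real.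
have c1 : `|c - 1| < eta.
  by move: h1; rewrite ec -(rmorph1 (real_complex R)) -rmorphB lt_complex_nrm nrm_real.
have cp : 0 < c by move: c1; rewrite ltr_norml => /andP[h _]; lra.
have cp' : 0 < c^-1 by rewrite invr_gt0.
exists (fun g => (c^-1)%:C * phi i g); split.
- apply: (psd_ext _ (psdZ (a := (c^-1)%:C) _ (psd_of_posdef (pd i)))) => //.
  by rewrite ler0c ltW.
- by rewrite ec -rmorphM mulVf ?gt_eqF.
- move=> d d0; have := vi i (c * d) (mulr_gt0 cp d0); apply: sub_finite_set => g /=.
  rewrite normrM -!nrmE -rmorphM !lecR nrm_real ger0_norm ?(ltW cp') //.
  by rewrite mulrC ler_pdivlMr // mulrC.
- move=> g gL; have {}gL : List.In g (1%g :: L).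
    by right; elim: (L) gL => //= x s IH; rewrite inE => /orP[/eqP ->|/IH]; [left|right].
  have := hi g gL; rewrite lt_complex_nrm => hg; rewrite le_complex_nrm.
  have -> : 1 - (c^-1)%:C * phi i g = (c^-1)%:C * ((c - 1)%:C - (phi i g - 1)).
    rewrite rmorphB rmorph1 mulrBr; have -> : (1 : R[i]) = (c^-1)%:C * c%:C.
      by rewrite -rmorphM mulVf ?gt_eqF.
    ring.
  rewrite nrmM nrm_real ger0_norm ?(ltW cp') // mulrC ler_pdivrMr //.
  apply: (le_trans (nrmB _ _)); rewrite nrm_real.
  have : `|c - 1| + nrm (phi i g - 1) <= 2 * eta by lra.
  move/le_trans; apply; move: c1; rewrite ltr_norml => /andP[h _]; nra.
Qed.
End NormalizedPosdef.

Lemma finite_seqs (T : choiceType) (Q : set T) n : finite_set Q ->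
  finite_set [set s : seq T | (size s <= n)%N /\ forall e, e \in s -> Q e]%classic.
Proof.
move=> fQ; elim: n => [|n IH].
  by apply: (sub_finite_set _ (finite_set1 [::])) => s /= []; rewrite leqn0 => /eqP/size0nil.
apply: (@sub_finite_set _ _ ([set [::]] `|` (fun p => p.1 :: p.2) @`
   (Q `*` [set s : seq T | (size s <= n)%N /\ forall e, e \in s -> Q e]))%classic).
  move=> [|x s] /= [sz h]; [by left|right; exists (x, s)] => //; split=> /=.
    by apply: h; rewrite inE eqxx.
  by split=> // e es; apply: h; rewrite inE es orbT.
by rewrite finite_setU; split; [exact: finite_set1|apply/finite_image/finite_setX].
Qed.

(** * Finiteness of the codes close to a full forest *)

Section FiniteCodes.
Local Open Scope ring_scope.
Variables (k : nat) (Gamma : groupType) (th : Gamma -> Gamma).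
Hypothesis k_gt0 : (0 < k)%N.
Hypothesis thM : {morph th : x y / (x * y)%g}.
Hypothesis th_inj : injective th.
Local Notation entry := (entry k Gamma).
Local Notation e0 := (e0 k Gamma).

(** Some vertex at height at most [E] on the way to the leaf [j] of [x] is matched, and beyond it
    the relative address agrees with one in [y], of length at most [D]. *)
Lemma matched_depth (x y : seq entry) E D j : size x = size y ->
    (forall i, (i < size y)%N -> size (nth e0 y i).1.2 = D) ->
    (sdiff (carets x) (carets y) <= E)%N -> (j < size x)%N ->
  (size (nth e0 x j).1.2 <= D + E)%N.
Proof.
move=> sxy yD dE ltj; rewrite leqNgt; apply/negP => ltD.
pose e := nth e0 x j; pose b t := (e.1.1, take t e.1.2).
have bx t : (t <= E)%N -> b t \in inner x.
  move=> letE; apply/innerP; exists j => //; exists (drop t e.1.2).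
    by rewrite /= cat_take_drop -/e; case: (e) => -[].
  rewrite -/e in ltD; rewrite -size_eq0 size_drop subn_eq0 -ltnNge /=.
  apply: leq_ltn_trans ltD; exact: leq_trans letE (leq_addl _ _).
have [t letE [a ay ea]] := matched_prefix bx (leq_ltn_trans (leq_addl _ _) ltD) dE.
have := congr1 (nth None ^~ j) ea.
rewrite !nth_above -?sxy // {1}/above1 -/e /= eqxx prefix_take /=.
rewrite /above1; case: ifP => // _ [/(congr1 size)].
rewrite !size_drop yD -?sxy // size_take -/e; rewrite -/e in ltD.
by case: ifP; lia.
Qed.

Variables (C : numClosedFieldType) (phi : Gamma -> C).
Variable N : nat.
Hypothesis N_gt0 : (0 < N)%N.

Lemma trailing_zeros_le (u : seq 'I_k) : (trailing_zeros u <= size u)%N.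
Proof. by rewrite /trailing_zeros -(size_rev u) find_size. Qed.

(** The labels of [y] are trivial, so by [kappa_big] each label of [x] lies in one of the finite
    sets of [phit_finite]; the parameters j and p are bounded by [N] and by the depth. *)
Lemma finite_codes n m D E (e : C) (y := fullc th k_gt0 m D) : 0 < e ->
    finite_set [set g | e <= `|phi g|]%classic ->
  finite_set [set x : seq entry | [/\ iscode n x, size x = size y,
    (sdiff (carets x) (carets y) <= E)%N &
    forall j, (j < size x)%N -> e <= `|leaf_kernel th phi N x y j|]]%classic.
Proof.
move=> e_gt0 fin.
pose W : set (seq 'I_k) := [set w | (size w <= D + E)%N]%classic.
have fW : finite_set W.
  apply: sub_finite_set (finite_seqs (D + E) (@finite_finset 'I_k [set: 'I_k]%classic)).
  by move=> w hw; split.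
pose Lb : set Gamma := (\bigcup_(p in `I_(D + E).+1) \bigcup_(j in `I_N)
  [set g | e <= `|phit th phi j p g|])%classic.
have fL : finite_set Lb.
  apply: bigcup_finite => [|p _]; first exact: finite_II.
  apply: bigcup_finite => [|j _]; first exact: finite_II.
  exact: phit_finite.
apply: (sub_finite_set _ (finite_seqs (size y) (finite_setX (finite_setX (finite_II n) fW) fL))).
move=> x [cx sx dE lk]; split=> /=; first by rewrite sx.
move=> _ /(nthP e0)[j ltj <-].
have yD i : (i < size y)%N -> size (nth e0 y i).1.2 = D by move=> /(fullcP thM)[].
have szj := matched_depth sx yD dE ltj.
split=> /=; first by split; [exact: code_lt cx ltj|].
have := lk j ltj; rewrite /leaf_kernel /leaf_point /=.
have lty : (j < size y)%N by rewrite -sx.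
have [_] := fullcP thM lty; rewrite -/y => ->; move/(kappa_big N_gt0 e_gt0) => [i lti hi].
exists (trailing_zeros (nth e0 x j).1.2) => /=; first by rewrite ltnS (leq_trans (trailing_zeros_le _)).
by exists i.
Qed.
End FiniteCodes.

(** * Coefficients on the universal groupoid *)

Section Main.
Local Open Scope ring_scope.
Local Open Scope complex_scope.
Variables (k : nat) (Gamma : groupType) (th : Gamma -> Gamma).
Hypothesis k_gt0 : (0 < k)%N.
Hypothesis thM : {morph th : x y / (x * y)%g}.
Hypothesis th_inj : injective th.

Local Notation entry := (entry k Gamma).
Local Notation P := (positive_part (lfmonoidal k_gt0 thM)).
Local Notation G := (universal_groupoid P).
Local Notation fullc := (fullc th k_gt0).
Local Notation "g \oc f" := (ccomp P g f) (at level 40, left associativity).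

Definition hcode (a b : ob P) (x : hom a b) : seq entry :=
  lcode (x : lforest k Gamma (sval a) (sval b)).

Lemma hcode_comp (a b c : ob P) (g : hom b c) (f : hom a b) :
  hcode (g \oc f) = ccode th (hcode g) (hcode f).
Proof. exact: lcode_comp. Qed.

Lemma hcode_inj (a b : ob P) : injective (@hcode a b).
Proof. exact: lcode_inj. Qed.

Lemma size_hcode (a b : ob P) (x : hom a b) : size (hcode x) = sval b.
Proof. exact: size_lcode. Qed.

Lemma iscode_hcode (a b : ob P) (x : hom a b) : iscode (sval a) (hcode x).
Proof. exact: lcode_code. Qed.

Lemma hcode_surj (a b : ob P) (s : seq entry) : iscode (sval a) s -> size s = sval b ->
  exists x : hom a b, hcode x = s.
Proof. by move=> cs ss; have [x ex] := lcode_surj k_gt0 cs ss; exists x. Qed.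

Lemma ob_eq (a b : ob P) : sval a = sval b -> a = b.
Proof. by case: a b => a pa [b pb] /= e; exact: eq_exist. Qed.

Lemma size_fullc n D : size (fullc n D) = (n * k ^ D)%N.
Proof.
elim: D => [|D IH]; first by rewrite expn0 muln1 size_idcode.
by rewrite size_fullcS IH expnSr mulnA.
Qed.

Lemma full_gt0 (a : ob P) D : (0 < size (fullc (sval a) D))%N.
Proof. by rewrite size_fullc muln_gt0 (svalP a) expn_gt0 k_gt0. Qed.

Definition full_ob (a : ob P) D : ob P := exist _ (size (fullc (sval a) D)) (full_gt0 a D).

Lemma full_ex (a : ob P) D : exists x : hom a (full_ob a D), hcode x = fullc (sval a) D.
Proof. by apply: hcode_surj => //; exact: code_fullc. Qed.

Definition full (a : ob P) D : hom a (full_ob a D) := sval (boolp.cid (full_ex a D)).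

Lemma code_full (a : ob P) D : hcode (full a D) = fullc (sval a) D.
Proof. exact: svalP (boolp.cid (full_ex a D)). Qed.

(** This provides the common multiples and allows the denominator of every fraction to be a full
    forest without labels. *)
Lemma complete (a b : ob P) (x : hom a b) : exists d, forall D, (d <= D)%N ->
  exists p : hom b (full_ob a D), p \oc x = full a D.
Proof.
have [d hd] := full_completion k_gt0 thM (iscode_hcode x); exists d => D /hd[p cp ep].
have [||q eq] := @hcode_surj b (full_ob a D) p; first by rewrite -(size_hcode x).
  by rewrite /= -ep size_ccode.
by exists q; apply: hcode_inj; rewrite hcode_comp eq code_full.
Qed.

Lemma complete2 (a b c : ob P) (x : hom a b) (y : hom a c) :
  exists (l : ob P) (p : hom b l) (q : hom c l), p \oc x = q \oc y.
Proof.
have [d hd] := complete x; have [d' hd'] := complete y.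
have [p ep] := hd (maxn d d') (leq_maxl _ _); have [q eq] := hd' (maxn d d') (leq_maxr _ _).
by exists (full_ob a (maxn d d')), p, q; rewrite ep eq.
Qed.

Lemma comp_mono (a b c : ob P) (p : hom b c) (x y : hom a b) : p \oc x = p \oc y -> x = y.
Proof.
move=> /(congr1 (@hcode _ _)); rewrite !hcode_comp => e; apply: hcode_inj.
apply: (ccode_mono k_gt0 th_inj _ _ e); rewrite !size_hcode //; exact: iscode_hcode.
Qed.

Lemma comp_epi (a b c : ob P) (x : hom a b) (p q : hom b c) : p \oc x = q \oc x -> p = q.
Proof.
move=> /(congr1 (@hcode _ _)); rewrite !hcode_comp => e; apply: hcode_inj.
apply: (ccode_epi k_gt0 (iscode_hcode x) _ _ _ e); rewrite !size_hcode //; exact: iscode_hcode.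
Qed.

(* If all the last carets merged, one could cancel them and lower the depth. *)
Lemma minimal_fraction (a b : ob P) (u : @hom G a b) :
  exists D (x : hom a (full_ob b D)), u = fraction x (full b D) /\
    forall D', D = D'.+1 ->
      exists2 i, (i < size (fullc (sval b) D'))%N & ~ block th (hcode x) i.
Proof.
have ex : exists D, `[< exists x : hom a (full_ob b D), u = fraction x (full b D) >].
  have [l [x [y ->]]] := fractionP complete2 u.
  have [d /(_ d (leqnn d))[p ep]] := complete y; exists d; apply/asboolP; exists (p \oc x).
  by rewrite -ep fraction_sat.
case: (ex_minnP ex) => D /asboolP[x ux] minD; exists D, x; split=> // D' eD; subst D.
apply: contrapT => nb; have blk i : (i < size (fullc (sval b) D'))%N -> block th (hcode x) i.
  by move=> lti; apply: contrapT => h; apply: nb; exists i.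
have sx : size (hcode x) = (size (fullc (sval b) D') * k)%N.
  by rewrite size_hcode /= -size_fullcS.
have [x1 [cx1 sx1 ex1]] := block_factor k_gt0 (iscode_hcode x) sx blk.
have [x' ex'] := @hcode_surj a (full_ob b D') x1 cx1 sx1.
have [q eq] := @hcode_surj (full_ob b D') (full_ob b D'.+1)
  _ (code_caretl Gamma k_gt0 _) (etrans (size_caretl _ _ _) (esym (size_fullcS _ _ _ _))).
have := minD D'; rewrite ltnn => /(_ _)/negP; apply => //; apply/asboolP; exists x'.
rewrite ux -(fraction_sat q); congr fraction; apply: hcode_inj.
  by rewrite hcode_comp eq ex'.
by rewrite hcode_comp eq !code_full.
Qed.

Variables (R : realType) (phi : Gamma -> R[i]).
Hypothesis phi_psd : psd (fun g h : Gamma => phi (h^-1 * g)%g).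
Hypothesis phi1 : phi 1%g = 1.
Variable N : nat.
Hypothesis N_gt0 : (0 < N)%N.
Variable al : R.
Hypothesis al0 : 0 < al.
Hypothesis al1 : al < 1.

Definition hom_kernel (l a b : ob P) (x : hom a l) (y : hom b l) : R[i] :=
  code_kernel th phi N al%:C (hcode x) (hcode y).

Lemma hom_kernel_comp (l m a b : ob P) (p : hom l m) (x : hom a l) (y : hom b l) :
  hom_kernel (p \oc x) (p \oc y) = hom_kernel x y.
Proof.
rewrite /hom_kernel !hcode_comp.
apply: (code_kernel_ccode k_gt0 thM th_inj phi1 N_gt0 _ (iscode_hcode x) (iscode_hcode y)).
  by rewrite !size_hcode.
rewrite size_hcode; exact: iscode_hcode.
Qed.

Lemma hom_kernel_psd (l : ob P) :
  psd (fun x y : {a : ob P & hom a l} => hom_kernel (tagged x) (tagged y)).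
Proof.
apply: (code_kernel_psd thM th_inj phi_psd N_gt0 _ _
  (f := fun x : {a : ob P & hom a l} => hcode (tagged x)) (l := sval l)).
- by rewrite -(rmorph0 (real_complex R)) ltcR.
- by rewrite -(rmorph1 (real_complex R)) ltcR.
- by move=> x; exact: size_hcode.
Qed.

Definition hom_coef : arrow G -> R[i] :=
  jones complete2 comp_mono comp_epi hom_kernel_comp.

Lemma hom_coefE (a b l : ob P) (x : hom a l) (y : hom b l) :
  hom_coef (@arr G a b (fraction x y)) = hom_kernel x y.
Proof. exact: jonesE. Qed.

(** The cut keeps finitely many objects, for [posdef_of_psd] and for vanishing at infinity; it
    multiplies each fiber kernel by a positive kernel. *)
Definition cut_coef B (u : arrow G) : R[i] :=
  if (sval (tag u).1 <= B)%N && (sval (tag u).2 <= B)%N then hom_coef u else 0.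

Lemma finite_objects B : finite_set [set a : ob P | (sval a <= B)%N]%classic.
Proof.
apply: (@finite_preimage _ _ (`I_B.+1)%classic (fun a : ob P => sval a)).
  by move=> a b _ _; exact: ob_eq.
exact: finite_II.
Qed.

Lemma cut_coef_posdef B : groupoid_posdef (cut_coef B).
Proof.
have [A eA] := (finite_seqP (T := {classic ob P}) _).1 (finite_objects B).
have memA (a : ob P) : (sval a <= B)%N -> (a : {classic ob P}) \in undup A.
  move=> leB; rewrite mem_undup; have : [set` A]%classic (a : {classic ob P}) by rewrite -eA.
  by [].
apply: (@posdef_of_psd R G _ _ (undup A) (undup_uniq A)).
  move=> a.
  apply: (@psd_ext _ _ (fun x y : @into G a => (sval (tag x) <= B)%N%:R *
     ((sval (tag y) <= B)%N%:R)^* * @fiber_kernel R G hom_coef a x y)).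
    move=> x y; rewrite /fiber_kernel /cut_coef /=.
    by case: (_ <= B)%N; case: (_ <= B)%N; rewrite /= ?conjC0 ?conjC1 ?mulr0 ?mul0r ?mul1r.
  apply: (psd_conj_mul (fun x : @into G a => (sval (tag x) <= B)%N%:R)).
  by apply: jones_psd; exact: hom_kernel_psd.
move=> a b g; rewrite /cut_coef /=; case: ifP => // /andP[ha hb] _.
by rewrite !memA.
Qed.

Lemma expr_small (e : R) : 0 < e -> exists E, forall n, (E < n)%N -> al ^+ n < e.
Proof.
move=> e0; pose d := al^-1 - 1; have d0 : 0 < d by rewrite subr_gt0 invf_gt1.
(* Bernoulli's inequality for [al^-1 = 1 + d]. *)
have B n : 1 + n%:R * d <= al^-1 ^+ n.
  elim: n => [|n IH]; first by rewrite mul0r addr0 expr0.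
  rewrite exprS; have -> : al^-1 = 1 + d by rewrite /d; ring.
  have nd : 0 <= n%:R * d by rewrite mulr_ge0 // ltW.
  have : (1 + d) * (1 + n%:R * d) <= (1 + d) * (1 + d) ^+ n.
    rewrite ler_pM2l; last by lra.
    by move: IH; have -> : al^-1 = 1 + d by rewrite /d; ring.
  apply: le_trans; rewrite -natr1; nra.
exists (Num.truncn (e^-1 / d)) => n ltn.
have h : e^-1 < n%:R * d.
  rewrite -ltr_pdivrMr //; apply: lt_le_trans (truncnS_gt _) _; by rewrite ler_nat.
rewrite -ltf_pV2 ?posrE ?exprn_gt0 // -exprVn; apply: lt_le_trans (B n); lra.
Qed.

Hypothesis phi_fin : forall d : R, 0 < d -> finite_set [set g | d%:C <= `|phi g|]%classic.

Lemma cut_coef_vanishes B : vanishes_at_infinity (cut_coef B).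
Proof.
move=> e e0; have [E hE] := expr_small e0.
have al0C : 0 < al%:C by rewrite -(rmorph0 (real_complex R)) ltcR.
have al1C : al%:C < 1 by rewrite -(rmorph1 (real_complex R)) ltcR.
have e0C : 0 < e%:C by rewrite -(rmorph0 (real_complex R)) ltcR.
pose S (a b : ob P) D := [set z : seq entry | [/\ iscode (sval a) z,
    size z = size (fullc (sval b) D), (sdiff (carets z) (carets (fullc (sval b) D)) <= E)%N &
    forall j, (j < size z)%N -> e%:C <= `|leaf_kernel th phi N z (fullc (sval b) D) j|]]%classic.
pose O := [set a : ob P | (sval a <= B)%N]%classic.
(* A minimal depth is 0 or some [D'.+1], where [not_block_depth] gives [D' <= N + E]: hence depths
   below [(N + E).+2]. *)
pose V := (\bigcup_(a in O) \bigcup_(b in O) \bigcup_(D in `I_(N + E).+2)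
  (fun x => @arr G a b (fraction x (full b D))) @` (@hcode a (full_ob b D) @^-1` S a b D))%classic.
apply: (@sub_finite_set _ _ V); last first.
  apply: bigcup_finite => [|a _]; first exact: finite_objects.
  apply: bigcup_finite => [|b _]; first exact: finite_objects.
  apply: bigcup_finite => [|D _]; first exact: finite_II.
  apply: finite_image; apply: (@finite_preimage _ _ (S a b D) (@hcode a (full_ob b D))).
    by move=> x y _ _; exact: hcode_inj.
  exact: (@finite_codes _ _ _ k_gt0 thM th_inj _ phi N N_gt0 (sval a) (sval b) D E _ e0C (phi_fin e0)).
move=> -[[a b] u] /=; rewrite /cut_coef /=; case: ifP => [/andP[aB bB]|_]; last first.
  by rewrite normr0 => /(lt_le_trans e0C); rewrite ltxx.
have [D [x [-> minD]]] := minimal_fraction u; rewrite hom_coefE /hom_kernel code_full => eK.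
have sxy : size (hcode x) = size (fullc (sval b) D) by rewrite size_hcode.
have lk j : (j < size (hcode x))%N ->
    e%:C <= `|leaf_kernel th phi N (hcode x) (fullc (sval b) D) j|.
  move=> ltj; apply: le_trans eK _.
  exact: (norm_code_kernel_leaf thM th_inj phi_psd phi1 N_gt0 al0C al1C).
have dE : (sdiff (carets (hcode x)) (carets (fullc (sval b) D)) <= E)%N.
  rewrite leqNgt; apply/negP => /hE; rewrite -ltcR rmorphXn /= => lte.
  have := le_lt_trans (le_trans eK (norm_code_kernel thM th_inj phi_psd phi1 N_gt0 al0C _ _)) lte.
  by rewrite ltxx.
exists a => //; exists b => //; exists D; last by exists x => //; split=> //; exact: iscode_hcode.
case: D x minD {eK} sxy lk dE => [//|D] x minD sxy lk dE; rewrite /= !ltnS.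
have [i lti nb] := minD D erefl.
apply: (@not_block_depth _ _ _ k_gt0 thM _ phi N N_gt0 _ al0C al1C _ _ _ _ _ _
  (iscode_hcode x) sxy lti nb dE) => j /lk h.
by apply/eqP => z0; move: h; rewrite z0 normr0 => /(lt_le_trans e0C); rewrite ltxx.
Qed.

Lemma cut_coef_close B (e : R) (a b l : ob P) (x : hom a l) (y : hom b l) :
    (sval a <= B)%N -> (sval b <= B)%N -> 0 < e -> 1 - al <= e ->
    (forall j, (j < sval l)%N -> let p := leaf_point (nth (e0 k Gamma) (hcode x) j) in
      let q := leaf_point (nth (e0 k Gamma) (hcode y) j) in
      (2 * (p.1 + q.1))%N%:R <= e / 2 * N%:R /\
      forall r, (r < N)%N -> `|1 - phi (iter r th (q.2^-1 * p.2)%g)| <= (e / 2)%:C) ->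
  `|1 - cut_coef B (@arr G a b (fraction x y))| <=
    ((sdiff (carets (hcode x)) (carets (hcode y)) + sval l)%:R * e)%:C.
Proof.
move=> aB bB e_gt0 ale pq; rewrite /cut_coef /= aB bB /= hom_coefE /hom_kernel.
have al0C : 0 < al%:C by rewrite -(rmorph0 (real_complex R)) ltcR.
have al1C : al%:C < 1 by rewrite -(rmorph1 (real_complex R)) ltcR.
have e0C : 0 < e%:C by rewrite -(rmorph0 (real_complex R)) ltcR.
have e2 : (e / 2)%:C = e%:C / 2 by rewrite rmorphM fmorphV rmorphMn rmorph1.
rewrite rmorphM /= rmorph_nat -(size_hcode x).
apply: (code_kernel_close thM th_inj phi_psd phi1 N_gt0 al0C al1C (ltW e0C)).
  by rewrite -(rmorph1 (real_complex R)) -rmorphB lecR.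
move=> j; rewrite size_hcode => ltj; have [pq1 pq2] := pq j ltj.
rewrite /leaf_kernel; case: (leaf_point _) (leaf_point _) pq1 pq2 => p g [q h] /= pq1 pq2.
apply: (kappa_close phi_psd phi1 N_gt0) => //.
  by move: pq1; rewrite -lecR rmorphM /= e2 !rmorph_nat.
by move=> r ltr; rewrite -e2; exact: pq2.
Qed.
End Main.

Lemma In_leq_sum (T : Type) (f : T -> nat) (s : seq T) x :
  List.In x s -> (f x <= \sum_(y <- s) f y)%N.
Proof.
elim: s => //= y s IH [->|/IH h]; rewrite big_cons ?leq_addr //.
exact: leq_trans h (leq_addl _ _).
Qed.

Lemma In_flatten (T : Type) (S : eqType) (f : T -> seq S) (s : seq T) x y :
  List.In x s -> y \in f x -> y \in flatten (map f s).
Proof.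
by elim: s => //= z s IH [->|/IH h] yf; rewrite mem_cat ?yf // h ?orbT.
Qed.

(** * Choice of the parameters *)

Section Haagerup.
Local Open Scope ring_scope.
Local Open Scope complex_scope.
Variables (k : nat) (Gamma : groupType) (th : Gamma -> Gamma).
Hypothesis k_gt0 : (0 < k)%N.
Hypothesis thM : {morph th : x y / (x * y)%g}.
Hypothesis th_inj : injective th.
Variable R : realType.

Local Notation P := (positive_part (lfmonoidal k_gt0 thM)).
Local Notation G := (universal_groupoid P).

Lemma arrow_fraction (u : arrow G) :
  exists r : {l : ob P & (@hom P (tag u).1 l * @hom P (tag u).2 l)%type},
  u = @arr G _ _ (fraction (tagged r).1 (tagged r).2).
Proof.
case: u => -[a b] u /=; have [l [x [y ->]]] := fractionP (@complete2 k Gamma th k_gt0 thM) u.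
by exists (existT (fun l : ob P => (@hom P a l * @hom P b l)%type) l (x, y)).
Qed.

Lemma positive_part_haagerup : group_haagerup R Gamma -> groupoid_haagerup R G.
Proof.
move=> hG; apply: haagerup_of_approx => F e e_gt0.
pose rep u := sval (boolp.cid (arrow_fraction u)).
have repE u : u = @arr G _ _ (fraction (tagged (rep u)).1 (tagged (rep u)).2).
  exact: svalP (boolp.cid (arrow_fraction u)).
pose cx u := hcode (tagged (rep u)).1; pose cy u := hcode (tagged (rep u)).2.
pose len u := sval (tag (rep u)).
pose px u j := leaf_point (nth (e0 k Gamma) (cx u) j).
pose py u j := leaf_point (nth (e0 k Gamma) (cy u) j).
(* [T], [B] and [W] bound, for all the arrows of [F] at once, the number of factors of the kernel,
   the objects, and twice the heights of a pair of leaves. *)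
pose T := (\sum_(u <- F) (sdiff (carets (cx u)) (carets (cy u)) + len u))%N.
pose B := (\sum_(u <- F) (sval (tag u).1 + sval (tag u).2))%N.
pose W := (\sum_(u <- F) \sum_(j <- iota 0 (len u)) 2 * ((px u j).1 + (py u j).1))%N.
(* Each factor may be off by [d]: at most [T] of them add up to less than [e], and [d < 1] makes
   [1 - d] an admissible base. *)
pose d : R := Num.min e 1 / (2 * T.+1%:R).
have T0 : 0 < T.+1%:R :> R by rewrite ltr0n.
have d_gt0 : 0 < d by rewrite divr_gt0 ?mulr_gt0 // lt_min e_gt0 ltr01.
have dT : d * (2 * T.+1%:R) = Num.min e 1 by rewrite /d divfK // gt_eqF // mulr_gt0.
have de : d * (2 * T.+1%:R) <= e by rewrite dT ge_min lexx.
have d1 : d * (2 * T.+1%:R) <= 1 by rewrite dT ge_min lexx orbT.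
have dlt1 : d < 1 by move: d1; rewrite -natr1; have : 0 <= T%:R :> R by []; nra.
have Tde : T%:R * d < e.
  by apply: lt_le_trans de; rewrite -natr1; have : 0 <= T%:R :> R by []; nra.
have d2 : 0 < d / 2 by rewrite divr_gt0.
pose N := (Num.truncn (W%:R / (d / 2))).+1.
have WN : W%:R <= d / 2 * N%:R.
  by rewrite mulrC -ler_pdivrMr //; apply/ltW/truncnS_gt.
(* Closeness of [kappa] to 1 needs [phi] close to 1 at the first [N] iterates of each relative
   label; [N] depends only on [W] and [d], so [phi] can be chosen after it. *)
pose L := flatten [seq flatten [seq [seq iter r th ((py u j).2^-1 * (px u j).2)%g | r <- iota 0 N] |
  j <- iota 0 (len u)] | u <- F].
have [phi [phi_psd phi1 phi_fin phiL]] := haagerup_normalized L hG d2.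
have N_gt0 : (0 < N)%N by [].
have al0 : 0 < 1 - d by rewrite subr_gt0.
have al1 : 1 - d < 1 by rewrite gtrBl.
exists (cut_coef th_inj phi1 N_gt0 (1 - d) B); split.
- exact: cut_coef_posdef.
- exact: cut_coef_vanishes.
move=> u uF; rewrite distrC [u]repE.
have uB := In_leq_sum (fun u : arrow G => sval (tag u).1 + sval (tag u).2)%N uF.
have uT := In_leq_sum (fun u => sdiff (carets (cx u)) (carets (cy u)) + len u)%N uF.
have uW := In_leq_sum (fun u => \sum_(j <- iota 0 (len u)) 2 * ((px u j).1 + (py u j).1))%N uF.
apply: le_lt_trans (cut_coef_close th_inj phi_psd phi1 N_gt0 al0 al1 (e := d) _ _ _ _ _) _.
- exact: leq_trans (leq_addr _ _) uB.
- exact: leq_trans (leq_addl _ _) uB.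
- by [].
- by rewrite opprB addrC subrK.
- move=> j ltj p q; split.
    apply: le_trans WN; rewrite ler_nat; apply: leq_trans uW.
    by rewrite (big_rem j) ?mem_iota //= leq_addr.
  move=> r ltr; apply: phiL; apply: (In_flatten uF); apply/flattenP.
  exists [seq iter r th ((py u j).2^-1 * (px u j).2)%g | r <- iota 0 N].
    by apply/mapP; exists j; rewrite ?mem_iota.
  by apply/mapP; exists r; rewrite ?mem_iota.
rewrite ltcR; apply: le_lt_trans Tde; rewrite ler_pM2r // ler_nat; exact: uT.
Qed.
End Haagerup.

Theorem theorem3 (Gamma : groupType) (theta : {multiplicative Gamma -> Gamma})
    (theta_inj : injective theta) (k : nat) (k_ge2 : (2 <= k)%N) :
  (exists! C : strict_monoidal_on (lforest k Gamma) addn 0%N,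
     diagram_rules C /\ corolla_relation theta C)
  /\
  (forall C : strict_monoidal_on (lforest k Gamma) addn 0%N,
     diagram_rules C -> corolla_relation theta C ->
     forall R : realType,
       group_haagerup R Gamma ->
       groupoid_haagerup R (universal_groupoid (positive_part C))).
Proof.
have k_gt0 : (0 < k)%N by exact: ltnW.
have thM : {morph theta : x y / (x * y)%g} by move=> x y; exact: gmulfM.
split.
  exists (lfmonoidal k_gt0 thM); split.
    by split; [exact: lfmonoidal_rules|exact: lfmonoidal_corolla].
  move=> C [rC cC]; exact: diagram_rules_uniq (lfmonoidal_rules _ _) (lfmonoidal_corolla _ _) rC cC.
move=> C rC cC R hG.
(* By uniqueness, the property is only needed for the category built from codes. *)
have -> : C = lfmonoidal k_gt0 thM.
  exact: diagram_rules_uniq rC cC (lfmonoidal_rules _ _) (lfmonoidal_corolla _ _).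
exact: positive_part_haagerup.
Qed.
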